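(* Let $n\ge 1$ be an integer and let $p>1$. There exists a positive constant $\beta(p,n)$, depending only on $p$ and $n$, such that the following holds. Let $R>\rho>0$ satisfy $$\text{(i)}\quad R\ \ge\ \rho+\Big(\frac{(2n-1)\rho}{4}\Big)^{1/3},\qquad\qquad \text{(ii)}\quad R\ \ge\ \beta(p,n)\,\rho ,$$ let $T\subset\mathbb H^n$ be the torus $$T=\{\xi=(x,y,t)\in\mathbb H^n:\ (r-R)^2+t^2<\rho^2\},\qquad r=\sqrt{|x|^2+|y|^2},$$ and let $d(\xi)$ be the Euclidean distance (in $\mathbb R^{2n+1}$) from $\xi\in T$ to $\partial T$. Then $\Delta_{p,\mathbb H^n}d\le 0$ in the weak sense in $T$, and $$\int_T|\nabla_{\mathbb H^n}u|^p\,d\xi\ \ge\ \Big(\frac{p-1}{p}\Big)^p\int_T\frac{|\nabla_{\mathbb H^n}d|^p}{d^p}\,|u|^p\,d\xi\qquad\text{for all }u\in C_c^\infty(T).$$ Moreover the constant $((p-1)/p)^p$ is sharp, i.e. it cannot be replaced by any larger constant.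
   Context: The Heisenberg group $\mathbb H^n$ is $\mathbb R^{2n+1}=\{\xi=(x,y,t):x,y\in\mathbb R^n,\ t\in\mathbb R\}$ with group law $\xi\xi'=(x+x',y+y',t+t'+2(x\cdot y'-y\cdot x'))$. The left-invariant horizontal vector fields are $X_i=\partial_{x_i}+2y_i\partial_t$, $Y_i=\partial_{y_i}-2x_i\partial_t$ ($i=1,\dots,n$), and $\nabla_{\mathbb H^n}=(X_1,\dots,X_n,Y_1,\dots,Y_n)$ is the horizontal gradient. The horizontal $p$-Laplacian is $\Delta_{p,\mathbb H^n}u=\mathrm{div}_{\mathbb H^n}(|\nabla_{\mathbb H^n}u|^{p-2}\nabla_{\mathbb H^n}u)$, where $\mathrm{div}_{\mathbb H^n}(f_1,\dots,f_n,h_1,\dots,h_n)=\sum_i (X_if_i+Y_ih_i)$. The inequality $\Delta_{p,\mathbb H^n}d\le0$ in the weak (distributional) sense in $T$ means $\int_T|\nabla_{\mathbb H^n}d|^{p-2}\nabla_{\mathbb H^n}d\cdot\nabla_{\mathbb H^n}\varphi\,d\xi\ge0$ for every non-negative $\varphi\in C_c^\infty(T)$. $d\xi$ is Lebesgue measure. *)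

(* Defs.v *)
From HB Require Import structures.
From mathcomp Require Import all_boot all_order all_algebra.
From mathcomp Require Import all_classical all_reals all_analysis.

Set Implicit Arguments.
Unset Strict Implicit.
Unset Printing Implicit Defensive.

Import Order.TTheory GRing.Theory Num.Theory.
Import numFieldNormedType.Exports.

Local Open Scope classical_set_scope.
Local Open Scope ring_scope.

Definition rV_display : measure_display. Proof. exact: default_measure_display. Qed.

(* The product sigma-algebra on R^m, generated by the coordinate maps; it is
   the Borel sigma-algebra of the usual topology of 'rV[R]_m. *)
Section measurable_rV.
Context {R : realType} (m : nat).

Definition rV_coord (i : 'I_m) (v : 'rV[R]_m) : measurableTypeR R := v ord0 i.

Let rV_measurable : set (set 'rV[R]_m) := g_sigma_preimage rV_coord.

Let rV_set0 : rV_measurable set0.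
Proof. exact: sigma_algebra0. Qed.

Let rV_setC A : rV_measurable A -> rV_measurable (~` A).
Proof. exact: sigma_algebraC. Qed.

Let rV_bigcup (F : (set 'rV[R]_m)^nat) :
  (forall i, rV_measurable (F i)) -> rV_measurable (\bigcup_i F i).
Proof. exact: sigma_algebra_bigcup. Qed.

HB.instance Definition _ := @isMeasurable.Build rV_display
  'rV[R]_m rV_measurable rV_set0 rV_setC rV_bigcup.

Lemma measurable_rV_coord (i : 'I_m) : measurable_fun setT (rV_coord i).
Proof.
move=> _ Y mY; apply: sub_sigma_algebra => /=.
rewrite -bigcup_seq/=; exists i => /=; first by rewrite mem_index_enum.
by exists Y.
Qed.

Lemma measurable_fun_rV d (T : measurableType d) (f : T -> 'rV[R]_m) :
  (forall i, measurable_fun setT (rV_coord i \o f)) -> measurable_fun setT f.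
Proof.
move=> mf _ A mA.
have : preimage_set_system setT f rV_measurable (setT `&` f @^-1` A) by exists A.
rewrite /rV_measurable -g_sigma_preimage_comp; move: (_ `&` _).
apply: smallest_sub; first exact: sigma_algebra_measurable.
rewrite -bigcup_seq; apply: bigcup_sub => i _ _ [B mB <-].
exact: mf.
Qed.

End measurable_rV.

(* The sigma-finite instance of the library is not inferred for m1 \x m2. *)
Lemma product_sigma_finite d1 d2 (T1 : measurableType d1)
    (T2 : measurableType d2) (R : realType)
    (m1 : {sigma_finite_measure set T1 -> \bar R})
    (m2 : {sigma_finite_measure set T2 -> \bar R}) :
  sigma_finite setT (m1 \x m2)%E.
Proof.
have /sigma_finiteP[F [TF ndF Foo]] := sigma_finiteT m1.
have /sigma_finiteP[G [TG ndG Goo]] := sigma_finiteT m2.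
exists (fun n => F n `*` G n).
  rewrite -setXTT TF TG predeqE => -[x y]; split.
    move=> [/= [n _ Fnx] [k _ Gky]]; exists (maxn n k) => //; split.
    - by move: x Fnx; exact/subsetPset/ndF/leq_maxl.
    - by move: y Gky; exact/subsetPset/ndG/leq_maxr.
  by move=> [n _ []/= ? ?]; split; exists n.
move=> k; have [? ?] := Foo k; have [? ?] := Goo k.
split; first exact: measurableX.
by rewrite product_measure1E// lte_mul_pinfty// ge0_fin_numE.
Qed.

Section lebesgue_measure_rV.
Context {R : realType}.
Local Open Scope ereal_scope.

Definition rV_cons (m : nat) (z : measurableTypeR R * 'rV[R]_m) : 'rV[R]_m.+1 :=
  row_mx (const_mx z.1 : 'rV[R]_1) z.2.

Definition rV_uncons (m : nat) (v : 'rV[R]_m.+1) :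
    measurableTypeR R * 'rV[R]_m :=
  (rV_coord ord0 v, \row_i v ord0 (lift ord0 i)).

Lemma rV_consE m z (i : 'I_m.+1) :
  rV_cons z ord0 i = if unlift ord0 i is Some j then z.2 ord0 j else z.1.
Proof.
rewrite /rV_cons; case: unliftP => [j|] ->.
  by rewrite -rshift1 (row_mxEr (const_mx z.1 : 'rV_1)).
by rewrite mxE; case: splitP => // j _; rewrite mxE.
Qed.

Lemma rV_consK m : cancel (@rV_cons m) (@rV_uncons m).
Proof.
move=> [x v]; rewrite /rV_uncons /rV_coord; congr pair.
  by rewrite rV_consE unlift_none.
by apply/rowP => i; rewrite mxE rV_consE liftK.
Qed.

Lemma measurable_rV_cons m : measurable_fun setT (@rV_cons m).
Proof.
apply: measurable_fun_rV => i.
rewrite (_ : _ \o _ = fun z => if unlift ord0 i is Some j then rV_coord j z.2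
  else z.1); last by apply/funext => z; rewrite /= /rV_coord rV_consE.
case: unliftP => [j _|_]; last exact: measurable_fst.
apply: (measurableT_comp (@measurable_rV_coord _ _ j)).
exact: measurable_snd.
Qed.

Lemma measurable_rV_uncons m : measurable_fun setT (@rV_uncons m).
Proof.
apply: measurable_fun_pair; first exact: measurable_rV_coord.
apply: measurable_fun_rV => i.
rewrite (_ : _ \o _ = rV_coord (lift ord0 i)); first exact: measurable_rV_coord.
by apply/funext => v; rewrite /= /rV_coord mxE.
Qed.

Section cons.
Variables (m : nat) (mu : {sigma_finite_measure set 'rV[R]_m -> \bar R}).

Definition cons_measure : set 'rV[R]_m.+1 -> \bar R :=
  pushforward (@lebesgue_measure R \x mu) (@rV_cons m).

Let cons0 : cons_measure set0 = 0.
Proof. by rewrite /cons_measure /pushforward preimage_set0 measure0. Qed.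

Let cons_ge0 A : 0 <= cons_measure A.
Proof. by rewrite /cons_measure /pushforward; apply: measure_ge0. Qed.

Let cons_sigma_additive : semi_sigma_additive cons_measure.
Proof.
rewrite /cons_measure => F mF tF mUF.
rewrite /pushforward preimage_bigcup.
apply: measure_semi_sigma_additive.
- by move=> n; rewrite -[X in measurable X]setTI; exact: measurable_rV_cons.
- apply/trivIsetP => /= i j _ _ ij; rewrite -preimage_setI.
  by move/trivIsetP : tF => /(_ _ _ _ _ ij) ->//; rewrite preimage_set0.
- rewrite -preimage_bigcup -[X in measurable X]setTI.
  exact: measurable_rV_cons.
Qed.

HB.instance Definition _ := isMeasure.Build _ _ _ cons_measure
  cons0 cons_ge0 cons_sigma_additive.

Let cons_sigma_finite : sigma_finite setT cons_measure.
Proof.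
have [F FT Foo] := product_sigma_finite
  (@lebesgue_measure R : {sigma_finite_measure set (measurableTypeR R) -> \bar R}) mu.
exists (fun k => @rV_uncons m @^-1` F k).
  by rewrite -preimage_bigcup -FT preimage_setT.
move=> k; have [mF Flty] := Foo k; split.
  by rewrite -[X in measurable X]setTI; exact: measurable_rV_uncons.
rewrite /cons_measure /pushforward -comp_preimage.
by rewrite (_ : _ \o _ = id) //; apply/funext => z /=; rewrite rV_consK.
Qed.

HB.instance Definition _ := Measure_isSigmaFinite.Build _ _ _ cons_measure
  cons_sigma_finite.

End cons.

(* Lebesgue measure on R^m: R^0 is a point of mass 1, and R^(m+1) carries the
   product of Lebesgue measure on R and on R^m. *)
Fixpoint lebesgue_rV (m : nat) : {sigma_finite_measure set 'rV[R]_m -> \bar R} :=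
  match m with
  | 0 => dirac (0%R : 'rV[R]_0)
  | m'.+1 => cons_measure (lebesgue_rV m')
  end.

End lebesgue_measure_rV.
Arguments lebesgue_rV {R} m.

Section euclidean.
Context {R : realType}.

Definition dot (m : nat) (u v : 'rV[R]_m) : R := \sum_i u ord0 i * v ord0 i.

(* The norm `|v| of the library is the sup norm. *)
Definition enorm (m : nat) (v : 'rV[R]_m) : R := Num.sqrt (dot v v).

Definition boundary (m : nat) (A : set 'rV[R]_m) : set 'rV[R]_m :=
  closure A `\` interior A.

Definition dist_boundary (m : nat) (A : set 'rV[R]_m) (v : 'rV[R]_m) : R :=
  inf [set enorm (v - w) | w in boundary A].

Definition partial (m : nat) (j : 'I_m) (f : 'rV[R]_m -> R) : 'rV[R]_m -> R :=
  fun v => 'D_(delta_mx ord0 j) f v.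

Definition smooth (m : nat) (f : 'rV[R]_m -> R) : Prop :=
  forall s : seq 'I_m, let g := foldr (@partial m) f s in
    continuous g /\ forall j v, derivable g v (delta_mx ord0 j).

(* C_c^oo(A), its elements being extended by 0 to the whole space. *)
Definition test_function (m : nat) (A : set 'rV[R]_m) (f : 'rV[R]_m -> R) : Prop :=
  [/\ smooth f, compact (closure [set v | f v != 0])
    & closure [set v | f v != 0] `<=` A].

End euclidean.

Section heisenberg.
Context {R : realType} (n : nat).


(* H^n = R^(2n+1), the point (x, y, t) being the row vector of its coordinates. *)
Definition xidx (i : 'I_n) : 'I_(n + n + 1) := lshift 1 (lshift n i).
Definition yidx (i : 'I_n) : 'I_(n + n + 1) := lshift 1 (rshift n i).
Definition tidx : 'I_(n + n + 1) := rshift (n + n) ord0.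

Implicit Types (xi : 'rV[R]_(n + n + 1)) (u d phi : 'rV[R]_(n + n + 1) -> R).

Definition xc xi (i : 'I_n) : R := xi ord0 (xidx i).
Definition yc xi (i : 'I_n) : R := xi ord0 (yidx i).
Definition tc xi : R := xi ord0 tidx.

Definition Xfield (i : 'I_n) u xi : R :=
  partial (xidx i) u xi + 2 * yc xi i * partial tidx u xi.
Definition Yfield (i : 'I_n) u xi : R :=
  partial (yidx i) u xi - 2 * xc xi i * partial tidx u xi.

Definition hgrad u xi : 'rV[R]_(n + n) :=
  row_mx (\row_i Xfield i u xi) (\row_i Yfield i u xi).

(* The p-Laplacian of d is nonpositive in the weak sense in A.  At points where
   d is not differentiable hgrad d takes a default value; this is harmless for
   a locally Lipschitz d, since such points form a null set.  As 0 `^ a = 0 for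
   a != 0, the vector field |hgrad d|^(p-2) hgrad d is 0 where hgrad d = 0. *)
Definition weakly_p_superharmonic (p : R) (A : set 'rV[R]_(n + n + 1)) d : Prop :=
  forall phi, test_function A phi -> (forall xi, 0 <= phi xi) ->
    (0 <= \int[lebesgue_rV (n + n + 1)]_(xi in A)
       (enorm (hgrad d xi) `^ (p - 2) * dot (hgrad d xi) (hgrad phi xi))%:E)%E.

Definition hardy_inequality (p c : R) (A : set 'rV[R]_(n + n + 1)) d : Prop :=
  forall u, test_function A u ->
    (c%:E * \int[lebesgue_rV (n + n + 1)]_(xi in A)
       (enorm (hgrad d xi) `^ p / d xi `^ p * `|u xi| `^ p)%:E
     <= \int[lebesgue_rV (n + n + 1)]_(xi in A) (enorm (hgrad u xi) `^ p)%:E)%E.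

Definition radius xi : R :=
  Num.sqrt (\sum_i xc xi i ^+ 2 + \sum_i yc xi i ^+ 2).

Definition torus (Rmaj rho : R) : set 'rV[R]_(n + n + 1) :=
  [set xi | (radius xi - Rmaj) ^+ 2 + tc xi ^+ 2 < rho ^+ 2].

End heisenberg.
Arguments torus {R} n Rmaj rho.

(* Main.v *)
(* In T the distance d = rho - sqrt ((r - Rmaj)^2 + t^2) is a function of r and
   t, smooth off the core {r = Rmaj, t = 0}.  There -div (|grad d|^(p-2) grad d)
   is a positive factor times a polynomial in r - Rmaj and t, which is
   nonnegative under the two conditions on R and rho.  Integration by parts
   rests on the invariance of Lebesgue measure under translation.  To cross the
   core, test functions are multiplied by a cutoff that increases with the
   distance to the core, so that its gradient contributes with the right sign,
   and one passes to the limit.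

   The Hardy inequality follows by testing superharmonicity with
   |u|^p d^(1-p) and applying Young's inequality pointwise.

   For sharpness one takes u = d^((p-1)/p) theta (-log d / L - 5/2), a function
   supported in the shell exp (-4L) <= d <= exp (-L), with L large.  Its energy
   exceeds ((p-1)/p)^p times the weighted integral by an arbitrarily small
   multiple of the latter plus L^(-p) times an integral of |theta'|^p.  The last
   one is compared with an integral of theta^p by means of the flux of an
   explicit divergence-free field; this replaces the coarea formula. *)

From mathcomp Require Import all_boot all_order all_algebra.
From mathcomp Require Import all_classical all_reals all_analysis.
From mathcomp Require Import measurable_realfun.
From mathcomp Require Import ring lra.
Require Import Defs.

Import Order.TTheory GRing.Theory Num.Theory.
Import numFieldNormedType.Exports.
Local Open Scope classical_set_scope.
Local Open Scope ring_scope.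

Set Implicit Arguments.
Unset Strict Implicit.
Unset Printing Implicit Defensive.

(** * Lebesgue measure and integration by parts on R^m *)

(** Origin of the two conditions: with a = r - R, the polynomial is a multiple of a square plus a
    combination, with nonnegative coefficients, of 4 r^3 + (2n-1) a and r + (2n+p-3) a. Both
    brackets are smallest at a = -rho, r = R - rho. The first then gives (i), the second R >=
    (2n+p-2) rho, whence the value of beta. The obstacle is the core, near which the first
    derivatives of |grad d|^(p-2) grad d are unbounded. The core is never shown to be a null set:
    [hgrad d] is 0 on it, so the integrands vanish there and T can be replaced by T minus the core.
    For sharpness, d^((p-1)/p) gives equality in Young's inequality, but its energy diverges like
    the integral of 1/d; hence a truncation spread over a long range of log d. Its cost is
    controlled by |theta'|^p <= K1 G' + K2 theta^p with G odd of compact support: G' is negative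
    only where theta is bounded below. The flux identity makes the weighted integral of G' vanish,
    so no slicing by level sets is needed. *)

Section lebesgue_rV_theory.
Context {R : realType}.
Local Open Scope ereal_scope.
Local Notation leb := (@lebesgue_measure R).

Lemma lebesgue_measure_shift (a : R) (A : set R) : measurable A ->
  pushforward leb (fun x : R => x + a : measurableTypeR R)%R A = leb A.
Proof.
move=> mA; apply/esym.
have mf : measurable_fun setT (fun x : R => x + a : measurableTypeR R)%R.
  exact: measurable_funD.
apply: (lebesgue_measure_unique
  (mu := pushforward leb (fun x => x + a : measurableTypeR R)%R)) => //.
move=> _ [[b c]] _ <-; rewrite /pushforward.
transitivity (leb [set` `]b - a, c - a]%R]); last first.
  congr (leb _); apply/seteqP; split => x /=; rewrite !in_itv/= ltrBlDr lerBrDr//.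
rewrite !lebesgue_measure_itv/= !lte_fin ltrD2r -!EFinD.
by case: ifP => // _; congr EFin; ring.
Qed.

Lemma measurable_rV_shift (m : nat) (v : 'rV[R]_m) :
  measurable_fun setT (fun x : 'rV[R]_m => x + v)%R.
Proof.
apply: measurable_fun_rV => i.
rewrite (_ : _ \o _ = fun x => rV_coord i x + v ord0 i)%R; last first.
  by apply/funext => x; rewrite /rV_coord/= mxE.
by apply: measurable_funD => //; exact: measurable_rV_coord.
Qed.

Lemma measurable_set_shift (m : nat) (v : 'rV[R]_m) (A : set 'rV[R]_m) :
  measurable A -> measurable ((fun x => x + v)%R @^-1` A).
Proof. by move=> mA; rewrite -[X in measurable X]setTI; exact: measurable_rV_shift. Qed.

(** Induction on the dimension: conjugated by [rV_cons], a translation is a product of two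
    translations, and a product measure is determined by its values on rectangles. *)
Lemma lebesgue_rV_shift (m : nat) (v : 'rV[R]_m) (A : set 'rV[R]_m) :
  measurable A ->
  lebesgue_rV m ((fun x => x + v)%R @^-1` A) = lebesgue_rV m A.
Proof.
elim: m v A => [|m IH] v A mA.
  rewrite (_ : _ @^-1` A = A)//; apply/seteqP; split => x /=;
  by rewrite (_ : x + v = x)%R//; apply/rowP => -[].
pose v0 := rV_coord ord0 v; pose v' := (rV_uncons v).2.
pose s := fun z : measurableTypeR R * 'rV[R]_m => (z.1 + v0 : measurableTypeR R, z.2 + v')%R.
have ms : measurable_fun setT s.
  apply: measurable_fun_pair => /=.
  - by apply: measurable_funD => //; exact: measurable_fst.
  - by apply: (measurableT_comp (measurable_rV_shift v')); exact: measurable_snd.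
have sE z : rV_cons (s z) = (rV_cons z + v)%R.
  apply/rowP => i; rewrite [RHS]mxE !rV_consE.
  case: unliftP => [j|] -> /=; first by rewrite !mxE.
  by [].
have mC : measurable (@rV_cons R m @^-1` A).
  by rewrite -[X in measurable X]setTI; exact: measurable_rV_cons.
transitivity (pushforward (leb \x lebesgue_rV m) s (@rV_cons R m @^-1` A)).
  rewrite /= /cons_measure /pushforward; congr (_ _).
  by apply/funext => z /=; rewrite sE.
suff H : forall X, measurable X ->
    (leb \x lebesgue_rV m) X = pushforward (leb \x lebesgue_rV m) s X.
  by rewrite /= /cons_measure /pushforward -/(pushforward (leb \x lebesgue_rV m) s _) H.
pose mm : {measure set (measurableTypeR R * 'rV[R]_m) -> \bar R} :=
  pushforward (leb \x lebesgue_rV m) s.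
have := (@product_measure_unique _ _ _ _ _ leb (lebesgue_rV m) (mm ms)).
rewrite /mm; apply.
move=> B C mB mC'; rewrite /pushforward.
change ((leb \x lebesgue_rV m) (((fun x => x + v0)%R @^-1` B) `*` ((fun x => x + v')%R @^-1` C))
  = leb B * lebesgue_rV m C).
rewrite product_measure1E//; last 2 first.
- by rewrite -[X in measurable X]setTI; apply: (measurable_funD (f := id)).
- exact: measurable_set_shift.
by congr (_ * _); [exact: (lebesgue_measure_shift v0 mB) | exact: IH].
Qed.

Definition box (m : nat) (a : 'rV[R]_m) (e : R) : set 'rV[R]_m :=
  [set v | forall i, `|v ord0 i - a ord0 i| < e]%R.

Lemma measurable_box m (a : 'rV[R]_m) e : measurable (box a e).
Proof.
rewrite (_ : box a e = \bigcap_(i in [set: 'I_m]) (@rV_coord R m i @^-1` (ball (a ord0 i) e))).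
  apply: fin_bigcap_measurable => // i _.
  rewrite -[X in measurable X]setTI; apply: measurable_rV_coord => //.
  exact: measurable_ball.
apply/seteqP; split => [v h i _|v h i].
- by rewrite /= /ball/= distrC; exact: h.
- by have := h i I; rewrite /= /ball/= distrC.
Qed.

Lemma lebesgue_rV_box m (a : 'rV[R]_m) (e : R) : (0 < e)%R ->
  0 < lebesgue_rV m (box a e) < +oo.
Proof.
move=> e0; elim: m a => [|m IH] a.
  rewrite /= /dirac indicE mem_set ?lte01 ?ltry//.
  by move=> [].
rewrite /= /cons_measure /pushforward.
rewrite (_ : _ @^-1` _ = ball (a ord0 ord0) e `*` box ((rV_uncons a).2) e); last first.
  apply/seteqP; split => [[x v] h|[x v] [h1 h2] i].
  - split => [|i].
    + by have := h ord0; rewrite /ball /= rV_consE unlift_none /= distrC.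
    + by have := h (lift ord0 i); rewrite rV_consE liftK /= mxE.
  - rewrite rV_consE; case: unliftP => [j ->|->] /=.
      by have := h2 j; rewrite mxE.
    by move: h1; rewrite /ball /= distrC.
have /andP[I1 I2] := IH (rV_uncons a).2.
rewrite product_measure1E//; last 2 first.
- exact: measurable_ball.
- exact: measurable_box.
change (0 < leb (ball (a ord0 ord0) e) * lebesgue_rV m (box (rV_uncons a).2 e) < +oo).
have -> : leb (ball (a ord0 ord0) e) = (e *+ 2)%:E by exact: lebesgue_measure_ball (ltW e0).
have e2 : (0 < e *+ 2)%R by rewrite mulrn_wgt0.
apply/andP; split; first by apply: mule_gt0 => //; rewrite lte_fin.
by apply: lte_mul_pinfty => //; rewrite lee_fin ltW.
Qed.

(** The sigma-algebra is generated by the coordinates, so an open set is exhibited as the union of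
    the countably many boxes with rational centre and radius 1/(k+1) that it contains. *)
Lemma open_rV_measurable m (U : set 'rV[R]_m) : open U -> measurable U.
Proof.
move=> oU.
pose q (x : 'rV[rat]_m * nat) := box (map_mx (@ratr R) x.1) x.2.+1%:R^-1%R.
pose P := [set x | q x `<=` U].
rewrite (_ : U = \bigcup_(x in P) q x).
  rewrite bigcup_mkcond; apply: countable_bigcupT_measurable => [|x].
    exact: countableP.
  by case: ifP => // _; exact: measurable_box.
apply/seteqP; split => [v Uv|v [x Px]]; last exact: Px.
have /nbhs_ballP[e /= e0 eU] : nbhs v U by apply: open_nbhs_nbhs; split.
have [k ke] : exists k : nat, (k.+1%:R^-1 < e / 2)%R.
  have e2 : (0 < e / 2)%R by rewrite divr_gt0.
  have [k _ hk] := near_infty_natSinv_lt (PosNum e2).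
  by exists k; apply: hk => /=.
have hq i : {q : rat | (`|v ord0 i - ratr q| < k.+1%:R^-1)%R}.
  apply: cid.
  have k0 : (0 < k.+1%:R^-1 :> R)%R by rewrite invr_gt0.
  have /rat_in_itvoo[c] : (v ord0 i - k.+1%:R^-1 < v ord0 i + k.+1%:R^-1)%R.
    by rewrite ltrD2l gtrN.
  rewrite inE => /andP[q1 q2]; exists c; move: q1 q2; rewrite !bnd_simp => q1 q2.
  by rewrite distrC ltr_distl q1 q2.
exists (\row_i sval (hq i), k).
  move=> w /= hw; apply: eU; rewrite -ball_normE /=.
  have [m0|m0] := posnP m.
    move: v w {hw Uv hq} => + + ; subst m => v w.
    by rewrite (_ : v - w = 0)%R ?normr0//; apply/rowP => -[].
  rewrite [X in (X < _)%R](mx_normrE (v - w)); apply/bigmax_ltP; split => //= -[i j] _ /=.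
  rewrite ord1 !mxE.
  have := hw j; rewrite !mxE; case: (hq j) => /= c; move: (ratr c) => r h1 h2.
  rewrite (_ : v ord0 j - w ord0 j = (v ord0 j - r) - (w ord0 j - r))%R; last by ring.
  apply: le_lt_trans (ler_normB _ _) _.
  by rewrite [ltRHS](splitr e) ltrD// (lt_trans _ ke).
by move=> i; rewrite !mxE; case: (hq i).
Qed.

Lemma continuous_rV_measurable m (U : set 'rV[R]_m) (f : 'rV[R]_m -> R) :
  open U -> (forall v, U v -> {for v, continuous f}) -> measurable_fun U f.
Proof.
move=> oU cf; apply: (measurability _ (RGenOInfty.measurableE R)) => //.
move=> _ [_ [y ->] <-]; apply: open_rV_measurable.
rewrite openE => v /= [Uv]; rewrite in_itv/= andbT => yf.
apply: filterI; first by apply: open_nbhs_nbhs.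
have := cf v Uv; rewrite /= => /cvgrPdist_lt /(_ (f v - y)%R).
rewrite subr_gt0 => /(_ yf).
apply: filterS => w /= h; rewrite in_itv/= andbT.
move: h; rewrite ltr_norml => /andP[_]; lra.
Qed.

End lebesgue_rV_theory.

(** * Bounded measurable functions of bounded support and their integrals *)

Section tame_functions.
Context {R : realType} (m : nat).
Notation V := 'rV[R]_m.
Notation mu := (lebesgue_rV m).
Implicit Types (f g : V -> R) (K U : set V) (j : 'I_m) (v : V).

Definition dir j : V := delta_mx ord0 j.

(* Bounded measurable functions with bounded support: integrability is closed
   under all the products that occur below. *)
Definition tame f := measurable_fun setT f /\
  exists M B : R, forall v, `|f v| <= M /\ (~ box 0 B v -> f v = 0).

Lemma tame_integrable f : tame f -> mu.-integrable setT (EFin \o f).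
Proof.
move=> [mf [M [B fMB]]].
pose B' := Num.max B 1.
have B'0 : 0 < B' by rewrite /B' lt_max ltr01 orbT.
have mb := measurable_box (0 : V) B'.
rewrite (_ : EFin \o f = (EFin \o f) \_ (box 0 B')); last first.
  apply/funext => v; rewrite patchE; case: ifPn => //; rewrite notin_setE => vb.
  rewrite /= (fMB v).2// => h; apply: vb => i.
  by rewrite (lt_le_trans (h i))// /B' le_max lexx.
apply/(integrable_mkcond _ mb); apply: measurable_bounded_integrable => //.
- by have /andP[] := lebesgue_rV_box (0 : V) B'0.
- exact: measurable_funS mf.
- by exists M; split; [exact: num_real|move=> x Mx v _; exact: le_trans (fMB v).1 (ltW Mx)].
Qed.

Lemma bounded_set_box K : bounded_set K -> exists2 B : R, 0 < B & K `<=` box 0 B.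
Proof.
move=> [M [Mr KM]]; exists (Num.max M 0 + 2).
  by rewrite ltr_wpDl// le_max lexx orbT.
move=> v Kv i; rewrite mxE subr0.
have : `|v| <= Num.max M 0 + 1.
  apply: KM Kv; rewrite (@le_lt_trans _ _ (Num.max M 0))//; last by rewrite ltrDl.
  by rewrite le_max lexx.
have : `|v ord0 i| <= `|v|.
  rewrite [leRHS]mx_normrE; apply/bigmax_geP; right => /=.
  by exists (ord0, i).
move=> h1 h2; apply: (le_lt_trans h1); apply: (le_lt_trans h2).
by rewrite ltrD2l ltr1n.
Qed.

Lemma compact_box K : compact K -> exists2 B : R, 0 < B & K `<=` box 0 B.
Proof. by move=> /compact_bounded/bounded_set_box. Qed.

Lemma continuous_tame f K : continuous f -> compact K ->
  (forall v, ~ K v -> f v = 0) -> tame f.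
Proof.
move=> cf cK f0; split.
  apply: continuous_rV_measurable; first exact: openT.
  by move=> v _; exact: cf.
have [B B0 KB] := compact_box cK.
have : compact (f @` K).
  by apply: continuous_compact => //; exact: continuous_subspaceT.
move=> /compact_bounded[M [Mr fM]].
exists (Num.max M 0 + 1), B => v; split; last first.
  by move=> vB; apply: f0 => Kv; apply: vB; exact: KB.
have [Kv|Kv] := pselect (K v).
  apply: (fM (Num.max M 0 + 1)); last by exists v.
  by rewrite (@le_lt_trans _ _ (Num.max M 0)) ?le_max ?lexx// ltrDl.
by rewrite f0// normr0 addr_ge0// le_max lexx orbT.
Qed.

Lemma tame0 : tame (cst 0).
Proof.
split; first exact: measurable_cst.
by exists 0, 0 => v; rewrite normr0.
Qed.

Lemma tameD f g : tame f -> tame g -> tame (f \+ g).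
Proof.
move=> [mf [M [B fM]]] [mg [N [C gN]]]; split; first exact: measurable_funD.
exists (M + N), (Num.max B C) => v; split.
  by apply: le_trans (ler_normD _ _) _; apply: lerD; [exact: (fM v).1|exact: (gN v).1].
move=> vb /=; rewrite (fM v).2 ?(gN v).2 ?addr0// => h; apply: vb => i;
by rewrite (lt_le_trans (h i))// le_max lexx ?orbT.
Qed.

Lemma tameMl f g (M : R) : measurable_fun setT f -> (forall v, `|f v| <= M) ->
  tame g -> tame (f \* g).
Proof.
move=> mf fM [mg [N [C gN]]]; split; first exact: measurable_funM.
exists (M * N), C => v; split; last by move=> /(gN v).2 /= ->; rewrite mulr0.
by rewrite normrM ler_pM//; exact: (gN v).1.
Qed.

Lemma tameZ (k : R) f : tame f -> tame (fun v => k * f v).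
Proof. by apply: (@tameMl (cst k) f `|k|) => //; exact: measurable_cst. Qed.

Lemma tame_le f g : measurable_fun setT f -> (forall v, `|f v| <= g v) ->
  tame g -> tame f.
Proof.
move=> mf fg [mg [N [C gN]]]; split => //.
exists N, C => v; split.
  by rewrite (le_trans (fg v))// (le_trans (ler_norm _))//; exact: (gN v).1.
move=> /(gN v).2 gv; apply/eqP; rewrite -normr_le0; by rewrite -gv.
Qed.

Definition integ f : R := \int[mu]_v f v.

Lemma integE f : tame f -> ((integ f)%:E = \int[mu]_v (f v)%:E)%E.
Proof.
by move=> /tame_integrable/integrable_fin_num h; rewrite /integ /Rintegral fineK// h.
Qed.

Lemma integD f g : tame f -> tame g -> integ (f \+ g) = integ f + integ g.
Proof. by move=> tf tg; rewrite /integ RintegralD//; exact: tame_integrable. Qed.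

Lemma integZ k f : tame f -> integ (fun v => k * f v) = k * integ f.
Proof. by move=> tf; rewrite /integ RintegralZl//; exact: tame_integrable. Qed.

Lemma le_integ f g : tame f -> tame g -> (forall v, f v <= g v) ->
  integ f <= integ g.
Proof.
move=> tf tg fg; rewrite /integ; apply: le_Rintegral => //; exact: tame_integrable.
Qed.

(** Change of variables: the image of Lebesgue measure under the shift is Lebesgue measure. *)
Lemma integ_shift f v : tame f -> integ (fun x => f (x + v)) = integ f.
Proof.
move=> tf; rewrite /integ /Rintegral; congr fine.
have ms := measurable_rV_shift v.
have tf' : mu.-integrable setT (EFin \o (fun x => f (x + v))).
  apply: tame_integrable; case: tf => mf [M [B fM]]; split.
    exact: (measurableT_comp mf).
  have [C C0 vC] := compact_box (@compact_set1 _ v).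
  exists M, (B + C) => w; split; first exact: (fM _).1.
  move=> wB; apply: (fM _).2 => h; apply: wB => i.
  have := h i; have := vC _ erefl i; rewrite !mxE !subr0 => h1 h2.
  rewrite (_ : w ord0 i = w ord0 i + v ord0 i - v ord0 i); last by rewrite addrK.
  by rewrite (le_lt_trans (ler_normB _ _))// ltrD.
have := integral_pushforward ms (f := EFin \o f) (mu := mu).
move=> /(_ setT); rewrite preimage_setT => <- //; last first.
  by move/tame_integrable/integrableP : tf => [].
apply: eq_measure_integral => A mA _.
exact: (lebesgue_rV_shift v mA).
Qed.

End tame_functions.

(** * The integral of a compactly supported derivative vanishes *)

Section integral_of_derivative.
Context {R : realType} (m : nat).
Notation V := 'rV[R]_m.
Notation mu := (lebesgue_rV m).
Implicit Types (f g : V -> R) (K U : set V) (j : 'I_m) (v : V).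

Lemma integ_cvg (f_ : nat -> V -> R) f g :
  (forall k, measurable_fun setT (f_ k)) -> measurable_fun setT f ->
  (forall v, f_ k v @[k --> \oo] --> f v) ->
  (forall k v, `|f_ k v| <= g v) -> tame g ->
  integ (f_ k) @[k --> \oo] --> integ f.
Proof.
move=> mf_ mf f_f f_g tg.
have tf_ k : tame (f_ k) by apply: tame_le tg.
have fg v : `|f v| <= g v.
  have h : `|f_ k v| @[k --> \oo] --> `|f v| by apply: cvg_norm; exact: f_f.
  rewrite -(cvg_lim _ h)//; apply: limr_le; first by apply/cvg_ex; exists `|f v|.
  exact: nearW.
have tf : tame f by apply: tame_le tg.
have m1 k : measurable_fun setT (EFin \o f_ k) by exact/measurable_EFinP.
have m2 : measurable_fun setT (EFin \o f) by exact/measurable_EFinP.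
have c1 : {ae mu, forall v, setT v -> (EFin \o f_ k) v @[k --> \oo] --> (EFin \o f) v}.
  by apply: aeW => v _; apply: cvg_EFin; [exact: nearW|exact: f_f].
have c2 : {ae mu, forall v k, setT v -> (`|(EFin \o f_ k) v| <= (EFin \o g) v)%E}.
  by apply: aeW => v k _; rewrite /= lee_fin.
have [_ _] := dominated_convergence measurableT m1 m2 c1 (tame_integrable tg) c2.
rewrite /= -(integE tf) => h.
exact/fine_cvg.
Qed.

Lemma is_derive_line f j v (t : R) : derivable f (v + t *: dir j) (dir j) ->
  is_derive t 1 (fun s : R => f (v + s *: dir j)) (partial j f (v + t *: dir j)).
Proof.
move=> df.
have E : (fun h : R => h^-1 *: (((fun s => f (v + s *: dir j)) \o shift t) (h *: 1)
      - f (v + t *: dir j)))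
  = (fun h : R => h^-1 *: ((f \o shift (v + t *: dir j)) (h *: dir j) - f (v + t *: dir j))).
  apply/funext => h /=; congr (_ *: (f _ - _)).
  by rewrite [h *: 1]mulr1 scalerDl addrCA.
by apply: DeriveDef; rewrite /derivable /derive E.
Qed.

Lemma partial_near f g j v : (\forall w \near v, f w = g w) ->
  partial j f v = partial j g v.
Proof. by move=> fg; rewrite /partial; apply: near_eq_derive. Qed.

Lemma derivable_near f g j v : (\forall w \near v, f w = g w) ->
  derivable f v (dir j) -> derivable g v (dir j).
Proof. by move=> fg; apply: near_eq_derivable. Qed.

Lemma partial_outside f K j v : closed K -> (forall w, ~ K w -> f w = 0) ->
  ~ K v -> partial j f v = 0.
Proof.
move=> cK f0 nK; rewrite (@partial_near _ (cst 0)).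
  by rewrite /partial derive_cst.
near=> w; apply: f0; near: w.
by apply: open_nbhs_nbhs; split => //; exact: closed_openC.
Unshelve. all: by end_near. Qed.

(** The difference quotients of [f] in direction j have integral 0 by translation invariance and
    converge to the partial derivative. The mean value theorem bounds them by its supremum, and
    dominated convergence concludes. Fubini's theorem is avoided. *)
Lemma integ_partial f K j : continuous f -> (forall v, derivable f v (dir j)) ->
  continuous (partial j f) -> compact K -> (forall v, ~ K v -> f v = 0) ->
  tame (partial j f) /\ integ (partial j f) = 0.
Proof.
move=> cf df cdf cK f0.
have clK : closed K by apply: compact_closed => //; exact: norm_hausdorff.
have tf : tame f by exact: continuous_tame f0.
have tdf : tame (partial j f).
  by apply: (continuous_tame cdf cK) => v; exact: partial_outside.
split => //.
have [mdf [M [B1 dfM]]] := tdf.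
have M0 : 0 <= M by have [+ _] := dfM 0; exact: le_trans.
have [B B0 KB] := compact_box cK.
pose h k : R := k.+1%:R^-1.
have h0 k : 0 < h k by rewrite invr_gt0.
have h1 k : h k <= 1 by rewrite invf_le1// ler1n.
pose q k v := (h k)^-1 * (f (v + h k *: dir j) - f v).
have cshift w : continuous (fun v : V => v + w).
  by move=> v; exact: (cvgD cvg_id (cvg_cst w)).
have tshift w : tame (fun v => f (v + w)).
  apply: (@continuous_tame _ _ _ ((fun v => v - w) @` K)).
  - by move=> v; apply: (continuous_comp (cshift w v)); exact: cf.
  - apply: continuous_compact => //; apply: continuous_subspaceT.
    exact: cshift.
  - by move=> v vK; apply: f0 => Kv; apply: vK; exists (v + w) => //; rewrite addrK.
have tN g : tame g -> tame (fun v => - g v).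
  by move=> /(tameZ (-1)); under eq_fun do rewrite mulN1r.
have tq k : tame (q k).
  by apply: tameZ; apply: tameD => //; exact: tN.
have q0 k : integ (q k) = 0.
  rewrite integZ; last by apply: tameD => //; exact: tN.
  rewrite (_ : (fun v => _) = (fun v => f (v + h k *: dir j)) \+ (fun v => -1 * f v)); last first.
    by apply/funext => v /=; rewrite mulN1r.
  rewrite integD//; last exact: tameZ.
  by rewrite integZ// integ_shift// mulN1r subrr mulr0.
have qM k v : `|q k v| <= M.
  have cl : continuous (fun s : R => f (v + s *: dir j)).
    move=> s; have /= := cvgD (cvg_cst v) (@cvgZr_tmp _ _ _ _ _ _ _ (dir j) (@cvg_id _ (nbhs s))).
    move=> h'; apply: (@continuous_comp _ _ _ (fun s : R => v + s *: dir j) f); first exact: h'.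
    exact: cf.
  have [c _] := @MVT_segment R (fun s => f (v + s *: dir j))
    (fun s => partial j f (v + s *: dir j)) 0 (h k) (ltW (h0 k))
    (fun s _ => is_derive_line (df _)) (continuous_subspaceT cl).
  rewrite scale0r addr0 subr0 /q => ->.
  by rewrite mulrC mulfK ?gt_eqF//; exact: (dfM _).1.
(* The steps [h k] are at most 1, so all quotients vanish outside the box enlarged by 1; this gives
   a common dominating function. *)
have tg : tame (fun v => M * \1_(box (0 : V) (B + 1)) v).
  apply: tameZ; split.
    by apply/measurable_indicP; exact: measurable_box.
  exists 1, (B + 1) => v; rewrite indicE; split.
    by rewrite ger0_norm ?ler0n// lern1 leq_b1.
  by move=> vb; rewrite memNset.
have qg k v : `|q k v| <= M * \1_(box (0 : V) (B + 1)) v.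
  rewrite indicE; have [vb|vb] := pselect (box 0 (B + 1) v).
    by rewrite mem_set// mulr1.
  rewrite memNset// mulr0 /q !f0 ?subrr ?mulr0 ?normr0//.
    move=> /KB h'; apply: vb => i.
    by rewrite (lt_trans (h' i))// ltrDl.
  move=> /KB h'; apply: vb => i; have := h' i; rewrite !mxE !subr0 => h2.
  have -> : v ord0 i = (v ord0 i + h k * (true && (i == j))%:R) - h k * (true && (i == j))%:R.
    by rewrite addrK.
  rewrite (le_lt_trans (ler_normB _ _))// ltr_leD//.
  rewrite normrM (ger0_norm (ltW (h0 k))) ger0_norm ?ler0n//.
  by rewrite mulr_ile1 ?h1 ?(ltW (h0 k)) ?ler0n// lern1 leq_b1.
have hcvg : h k @[k --> \oo] --> 0^'.
  move=> A [e /= e0 eA]; have [N _ hN] := near_infty_natSinv_lt (PosNum e0).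
  exists N => // k /= Nk; apply: eA; last by rewrite gt_eqF.
  rewrite /ball_/= sub0r normrN gtr0_norm//; exact: hN.
have H : integ (q k) @[k --> \oo] --> integ (partial j f).
  suff qc v : q k v @[k --> \oo] --> partial j f v.
    exact: (integ_cvg (fun k => (tq k).1) mdf qc qg tg).
  have := df v; rewrite /derivable => dfv.
  apply: (cvg_trans _ (cvg_comp _ _ hcvg dfv)).
  apply: near_eq_cvg; apply: nearW => k /=.
  by rewrite /q (addrC v).
have H0 : integ (q k) @[k --> \oo] --> (0 : R).
  by apply: cvg_near_cst; exact: nearW.
exact: (cvg_unique _ H H0).
Qed.

End integral_of_derivative.

(** * Functions of class C^k on an open set *)

Section differentiability_classes.
Context {R : realType} (m : nat).
Notation V := 'rV[R]_m.
Implicit Types (f g : V -> R) (K U : set V) (j : 'I_m) (v : V).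

(** Only derivatives along the coordinate directions are required, as in [smooth]. Restricting to a
    set [U] admits functions that are singular elsewhere, and the explicit order [k] makes closure
    under products, compositions and gluing provable by induction. *)
Fixpoint Ck (k : nat) U f : Prop :=
  (forall v, U v -> {for v, continuous f}) /\
  if k is k'.+1 then
    forall j, (forall v, U v -> derivable f v (dir j)) /\ Ck k' U (partial j f)
  else True.

Lemma Ck_continuous k U f v : Ck k U f -> U v -> {for v, continuous f}.
Proof. by case: k => [|k] [h _]; exact: h. Qed.

Lemma Ck_derivable k U f j v : Ck k.+1 U f -> U v -> derivable f v (dir j).
Proof. by move=> [_ /(_ j)[h _]]; exact: h. Qed.

Lemma Ck_partial k U f j : Ck k.+1 U f -> Ck k U (partial j f).
Proof. by move=> [_ /(_ j)[]]. Qed.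

Lemma CkS k U f : Ck k.+1 U f -> Ck k U f.
Proof.
elim: k f => [|k IH] f [cf df]; split => // j; split; first by have [] := df j.
by apply: IH; have [] := df j.
Qed.

Lemma CkW k U W f : W `<=` U -> Ck k U f -> Ck k W f.
Proof.
move=> WU; elim: k f => [|k IH] f [cf df]; split => //.
- by move=> v /WU; exact: cf.
- by move=> v /WU; exact: cf.
- move=> j; split; first by move=> v /WU; have [+ _] := df j; apply.
  by apply: IH; have [] := df j.
Qed.

Lemma open_near U f g v : open U -> (forall w, U w -> f w = g w) -> U v ->
  \forall w \near v, f w = g w.
Proof. by move=> oU fg Uv; apply: filterS (open_nbhs_nbhs (conj oU Uv)). Qed.

Lemma near_continuous f g v : (\forall w \near v, f w = g w) ->
  {for v, continuous f} -> {for v, continuous g}.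
Proof.
move=> fg cf; have e : f v = g v by exact: nbhs_singleton fg.
change (g w @[w --> v] --> g v); rewrite -e.
exact: (cvg_trans (near_eq_cvg fg)).
Qed.

Lemma eq_Ck k U f g : open U -> (forall v, U v -> f v = g v) -> Ck k U f -> Ck k U g.
Proof.
move=> oU; elim: k f g => [|k IH] f g fg [cf df].
  by split => // v Uv; apply: near_continuous (cf _ Uv); exact: open_near fg Uv.
split => [v Uv|j].
  by apply: near_continuous (cf _ Uv); exact: open_near fg Uv.
split => [v Uv|].
  have [h _] := df j; apply: derivable_near (h _ Uv).
  exact: open_near fg Uv.
have [_ h] := df j; apply: IH h => v Uv; apply: partial_near.
exact: open_near fg Uv.
Qed.

Lemma Ck_cst k U (c : R) : Ck k U (cst c).
Proof.
elim: k c => [|k IH] c; split => //.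
- by move=> v _; exact: cst_continuous.
- by move=> v _; exact: cst_continuous.
- move=> j; split; first by move=> v _; exact: derivable_cst.
  rewrite (_ : partial j (cst c) = cst 0); first exact: IH.
  by apply/funext => v; rewrite /partial derive_cst.
Qed.

Lemma is_derive_partial f j v : derivable f v (dir j) ->
  is_derive v (dir j) f (partial j f v).
Proof. exact: derivableP. Qed.

Lemma partialE f j v (d : R) : is_derive v (dir j) f d -> partial j f v = d.
Proof. by case. Qed.

Lemma CkD k U f g : open U -> Ck k U f -> Ck k U g -> Ck k U (fun v => f v + g v).
Proof.
move=> oU; elim: k f g => [|k IH] f g [cf df] [cg dg].
  by split => // v Uv; exact: (cvgD (cf _ Uv) (cg _ Uv)).
split => [v Uv|j]; first exact: (cvgD (cf _ Uv) (cg _ Uv)).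
have [df1 df2] := df j; have [dg1 dg2] := dg j.
split => [v Uv|]; first exact: (derivableD (df1 _ Uv) (dg1 _ Uv)).
apply: (eq_Ck oU _ (IH _ _ df2 dg2)) => v Uv.
by rewrite [RHS]/partial deriveD//; [exact: df1|exact: dg1].
Qed.

Lemma CkM k U f g : open U -> Ck k U f -> Ck k U g -> Ck k U (fun v => f v * g v).
Proof.
move=> oU; elim: k f g => [|k IH] f g.
  move=> [cf _] [cg _].
  by split => // v Uv; exact: (cvgM (cf _ Uv) (cg _ Uv)).
move=> Cf Cg; have [cf df] := Cf; have [cg dg] := Cg.
split => [v Uv|j]; first exact: (cvgM (cf _ Uv) (cg _ Uv)).
have [df1 df2] := df j; have [dg1 dg2] := dg j.
split => [v Uv|]; first exact: (derivableM (df1 _ Uv) (dg1 _ Uv)).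
apply: (eq_Ck oU _ (CkD oU (IH _ _ (CkS Cf) dg2) (IH _ _ (CkS Cg) df2))) => v Uv.
by rewrite [RHS]/partial deriveM//; [exact: df1|exact: dg1].
Qed.

Lemma CkN k U f : open U -> Ck k U f -> Ck k U (fun v => - f v).
Proof.
move=> oU Cf; apply: (eq_Ck oU _ (CkM oU (Ck_cst k U (-1)) Cf)) => v _.
by rewrite mulN1r.
Qed.

Lemma CkB k U f g : open U -> Ck k U f -> Ck k U g -> Ck k U (fun v => f v - g v).
Proof. by move=> oU Cf Cg; apply: CkD => //; exact: CkN. Qed.

Lemma CkX k U f i : open U -> Ck k U f -> Ck k U (fun v => f v ^+ i).
Proof.
move=> oU Cf; elim: i => [|i IH]; first exact: Ck_cst.
by under eq_fun do rewrite exprS; exact: CkM.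
Qed.

Lemma Ck_sum k U (I : Type) (s : seq I) (F : I -> V -> R) : open U ->
  (forall i, Ck k U (F i)) -> Ck k U (fun v => \sum_(i <- s) F i v).
Proof.
move=> oU CF; elim: s => [|i s IH].
  by under eq_fun do rewrite big_nil; exact: Ck_cst.
by under eq_fun do rewrite big_cons; exact: CkD.
Qed.

Lemma is_derive_coord (i j : 'I_m) v :
  is_derive v (dir j) (fun w : V => w ord0 i) (i == j)%:R.
Proof.
have E : (fun h : R => h^-1 *: (((fun w : V => w ord0 i) \o shift v) (h *: dir j) - v ord0 i))
    @ 0^' --> ((i == j)%:R : R).
  apply: cvg_near_cst; near=> h => /=.
  rewrite !mxE addrK eqxx /= [_ *: _]mulrA mulVf ?mul1r//.
  by near: h; exact: nbhs_dnbhs_neq.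
apply: DeriveDef; first by apply/cvg_ex; exists (i == j)%:R.
exact: cvg_lim E.
Unshelve. all: by end_near. Qed.

Lemma Ck_coord k U (i : 'I_m) : Ck k U (fun v => v ord0 i).
Proof.
case: k => [|k]; first by split => // v _; exact: coord_continuous.
split => [v _|j]; first exact: coord_continuous.
split => [v _|]; first by have [] := is_derive_coord i j v.
rewrite (_ : partial j _ = cst (i == j)%:R); first exact: Ck_cst.
by apply/funext => v; exact/partialE/is_derive_coord.
Qed.

(** [f] is only derivable along one direction, so the chain rule is taken from the one-variable
    function s |-> f (v + s e_j). *)
Lemma is_derive_comp1 f (Phi : R -> R) (Phi' df : R) j v :
  is_derive (f v) 1 Phi Phi' -> is_derive v (dir j) f df ->
  is_derive v (dir j) (Phi \o f) (Phi' * df).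
Proof.
move=> [dP <-] [dfv <-].
have dl : is_derive (0:R) 1 (fun s : R => f (v + s *: dir j)) (partial j f v).
  by have := @is_derive_line _ _ f j v 0; rewrite scale0r addr0; apply.
have dP' : is_derive (f (v + 0 *: dir j)) 1 Phi ('D_1 Phi (f v)).
  by rewrite scale0r addr0; exact: derivableP.
have [d1 d2] := @is_derive1_comp _ Phi _ _ _ _ dP' dl.
have E : (fun h : R => h^-1 *: (((Phi \o (fun s : R => f (v + s *: dir j))) \o shift 0) (h *: 1)
     - (Phi \o (fun s : R => f (v + s *: dir j))) 0))
  = (fun h : R => h^-1 *: (((Phi \o f) \o shift v) (h *: dir j) - (Phi \o f) v)).
  apply/funext => h /=; rewrite scale0r !addr0.
  by rewrite [h *: 1]mulr1 (addrC v).
split; first by move: d1; rewrite /derivable E.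
by move: d2; rewrite /derive E => ->; rewrite mulrC.
Qed.

(** The outer function comes as the sequence of its successive derivatives; the induction step
    replaces this sequence by its shift. *)
Lemma Ck_comp k U f (W : set R) (Phi : nat -> R -> R) : open U ->
  (forall i x, (i < k)%N -> W x -> is_derive x 1 (Phi i) (Phi i.+1 x)) ->
  (forall i x, (i <= k)%N -> W x -> {for x, continuous (Phi i)}) ->
  (forall v, U v -> W (f v)) -> Ck k U f -> Ck k U (fun v => Phi 0%N (f v)).
Proof.
move=> oU; elim: k Phi f => [|k IH] Phi f dP cP fW Cf.
  split => // v Uv; apply: continuous_comp; first exact: Ck_continuous Cf Uv.
  by apply: cP => //; exact: fW.
split => [v Uv|j].
  apply: continuous_comp; first exact: Ck_continuous Cf Uv.
  by apply: cP => //; exact: fW.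
have D v : U v -> is_derive v (dir j) (Phi 0%N \o f) (Phi 1%N (f v) * partial j f v).
  move=> Uv; apply: is_derive_comp1; first by apply: dP => //; exact: fW.
  by apply: is_derive_partial; exact: Ck_derivable Cf Uv.
split => [v Uv|]; first by have [] := D v Uv.
have C1 : Ck k U (fun v => Phi 1%N (f v)).
  apply: (IH (fun i => Phi i.+1)) => //.
  - by move=> i x ik Wx; exact: dP.
  - by move=> i x ik Wx; exact: cP.
  - exact: CkS.
apply: (eq_Ck oU _ (CkM oU C1 (Ck_partial j Cf))) => v Uv.
exact/esym/partialE/D.
Qed.

(** Every point lies in [U] or in the open complement of [K], near which [f] is 0. The argument
    [glue] is stated for any local property, as it serves both for continuity and for
    derivability. *)
Lemma Ck_glue k U K f : compact K -> open U -> K `<=` U ->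
  (forall v, ~ K v -> f v = 0) -> Ck k U f -> Ck k setT f.
Proof.
move=> cK oU KU.
have clK : closed K by apply: compact_closed => //; exact: norm_hausdorff.
have glue g (P : (V -> R) -> V -> Prop) : (forall v, P (cst 0) v) ->
  (forall v h1 h2, (\forall w \near v, h1 w = h2 w) -> P h1 v -> P h2 v) ->
  (forall v, ~ K v -> g v = 0) -> (forall v, U v -> P g v) -> forall v, P g v.
  move=> P0 PN g0 Pg v; have [Kv|Kv] := pselect (K v); first exact/Pg/KU.
  apply: (PN v (cst 0)) => //; near=> w; apply/esym/g0; near: w.
  by apply: open_nbhs_nbhs; split => //; exact: closed_openC.
have gc g : (forall v, ~ K v -> g v = 0) -> (forall v, U v -> {for v, continuous g}) ->
    forall v, {for v, continuous g}.
  apply: (glue g (fun g v => {for v, continuous g})); first by move=> v; exact: cst_continuous.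
  by move=> v h1 h2; exact: near_continuous.
elim: k f => [|k IH] f f0 [cf df]; split => //.
- by move=> v _; exact: gc.
- by move=> v _; exact: gc.
move=> j; have [df1 df2] := df j; split.
  move=> v _; move: v.
  refine (glue f (fun g v => derivable g v (dir j)) _ _ f0 df1).
    by move=> v; exact: derivable_cst.
  by move=> v h1 h2; exact: derivable_near.
by apply: IH df2 => v; exact: partial_outside.
Unshelve. all: by end_near. Qed.

(** [smooth] quantifies over words of derivations, [Ck] over their length: one direction is an
    induction on the length for all words, the other an induction on the word for all lengths. *)
Lemma smoothP f : smooth f <-> forall k, Ck k setT f.
Proof.
split => [sf k|Cf s].
- suff : forall s, Ck k setT (foldr (@partial R m) f s) by move=> /(_ [::]).
  elim: k => [|k IH] s; have [c d] := sf s.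
    by split => // v _; exact: c.
  split => [v _|j]; first exact: c.
  by split => [v _|]; [exact: d|exact: (IH (j :: s))].
- have : forall k, Ck k setT (foldr (@partial R m) f s).
    elim: s => [//|j s IH] k; exact: (Ck_partial j (IH k.+1)).
  move=> /(_ 1%N)[c d]; split; first by move=> v; exact: c.
  by move=> j v; have [h _] := d j; exact: h.
Qed.

End differentiability_classes.

Section ibp.
Context {R : realType} (m : nat).
Notation V := 'rV[R]_m.
Implicit Types (f g : V -> R) (K U : set V) (j : 'I_m) (v : V).

(** [F] may be singular outside [U]. The product with [psi] is still C^1 on the whole space, being 0
    off the compact [K], so its derivative has integral 0. *)
Lemma ibp U K (F psi : V -> R) j : open U -> Ck 1 U F -> Ck 1 setT psi ->
  compact K -> K `<=` U -> (forall v, ~ K v -> psi v = 0) ->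
  tame (fun v => partial j F v * psi v + F v * partial j psi v) /\
  integ (fun v => partial j F v * psi v + F v * partial j psi v) = 0.
Proof.
move=> oU CF Cp cK KU p0.
have clK : closed K by apply: compact_closed => //; exact: norm_hausdorff.
have f0 v : ~ K v -> F v * psi v = 0 by move=> /p0 ->; rewrite mulr0.
have Cf : Ck 1 setT (fun v => F v * psi v).
  exact: (Ck_glue cK oU KU f0 (CkM oU CF (CkW (@subsetT _ U) Cp))).
have <- : partial j (fun v => F v * psi v) =
    (fun v => partial j F v * psi v + F v * partial j psi v).
  apply/funext => v; have [Kv|Kv] := pselect (K v).
    rewrite [LHS]/partial deriveM.
    - by rewrite addrC [psi v *: _]mulrC.
    - exact: (Ck_derivable CF (KU _ Kv)).
    - exact: (Ck_derivable Cp).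
  by rewrite (partial_outside j clK f0 Kv) (partial_outside j clK p0 Kv) p0// !mulr0 addr0.
apply: (integ_partial (K := K)) => //.
- by move=> v; exact: (Ck_continuous Cf).
- by move=> v; exact: (Ck_derivable Cf).
- by move=> v; exact: (Ck_continuous (Ck_partial j Cf)).
Qed.

End ibp.

(** * Real functions *)

Section real_functions.
Context {R : realType}.
Implicit Types (x : R).

Lemma is_derive_continuous (Phi : R -> R) x d :
  is_derive x 1 Phi d -> {for x, continuous Phi}.
Proof. by move=> [h _]; apply: differentiable_continuous; exact/derivable1_diffP. Qed.

(** Used at the points where a piecewise formula changes: there the quotient is squeezed by a
    modulus that tends to 0. *)
Lemma is_derive_flat (Phi om : R -> R) x : Phi x = 0 ->
  om h @[h --> 0] --> (0 : R) -> (forall h, `|Phi (h + x)| <= om h * `|h|) ->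
  is_derive x 1 Phi 0.
Proof.
move=> P0 om0 Pom.
have om0' : om h @[h --> 0^'] --> (0 : R) by exact: cvg_within_filter om0.
have E : (fun h : R => h^-1 *: ((Phi \o shift x) (h *: 1) - Phi x)) @ 0^' --> (0 : R).
  apply/norm_cvg0P; apply: (squeeze_cvgr _ (cvg_cst 0) om0').
  near=> h; have h0 : h != 0 by near: h; exact: nbhs_dnbhs_neq.
  rewrite normr_ge0/= P0 subr0 [h *: 1]mulr1 normrM normfV.
  by rewrite mulrC ler_pdivrMr ?normr_gt0//; exact: Pom.
apply: DeriveDef; first by apply/cvg_ex; exists 0.
exact: cvg_lim E.
Unshelve. all: by end_near. Qed.

Lemma is_derive_congr (V W : normedModType R) (f : V -> W) (z v : V) (a b : W) :
  is_derive z v f a -> a = b -> is_derive z v f b.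
Proof. by move=> h <-. Qed.

Definition sqpos x : R := Num.max 0 x ^+ 2.

Lemma is_derive_sqpos x : is_derive x 1 sqpos (2 * Num.max 0 x).
Proof.
have [x0|x0|->] := ltgtP x 0.
- rewrite mulr0; apply: (near_eq_is_derive (f := cst 0)).
    near=> y; rewrite /sqpos max_l ?expr0n// ltW//; near: y; exact: lt_nbhsl.
- have d2 : is_derive x 1 ((id : R -> R) * id) (2 * x).
    apply: (is_derive_congr (is_deriveM (is_derive_id x (1 : R)) (is_derive_id x (1 : R)))).
    by rewrite /= [x *: 1]mulr1 -mulr2n mulr_natl.
  apply: near_eq_is_derive d2.
  near=> y; rewrite /sqpos max_r ?expr2// ltW//; near: y; exact: lt_nbhsr.
- rewrite mulr0; apply: (@is_derive_flat _ (fun h => `|h|)).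
  + by rewrite /sqpos maxxx expr0n.
  + by have := @norm_continuous R R 0; rewrite /continuous_at normr0.
  + move=> h; rewrite addr0 /sqpos normrX -expr2 ler_sqr ?nnegrE//.
    by have [h0|h0] := leP 0 h; rewrite ?normr0.
Unshelve. all: by end_near. Qed.

Definition abspow (p : R) x : R := `|x| `^ p.

Lemma cvg_abspow0 (a : R) : 0 < a -> abspow a h @[h --> 0] --> (0 : R).
Proof.
move=> a0; apply/cvgrPdist_lt => e e0.
have d0 : 0 < e `^ a^-1 by exact: powR_gt0.
apply/nbhs_ballP; exists (e `^ a^-1) => // h.
rewrite /ball/= sub0r normrN => hd.
rewrite sub0r normrN ger0_norm ?powR_ge0//.
have -> : e = (e `^ a^-1) `^ a.
  by rewrite -powRrM mulVf ?gt_eqF// powRr1// ltW.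
by rewrite gt0_ltr_powR ?nnegrE ?normr_ge0 ?(ltW d0).
Qed.

Lemma is_derive_abspow (p : R) x : 1 < p ->
  is_derive x 1 (abspow p) (p * Num.sg x * `|x| `^ (p - 1)).
Proof.
move=> p1; have p0 : p != 0 by rewrite gt_eqF// (lt_trans ltr01).
have pB : p - 1 != 0 by rewrite subr_eq0 gt_eqF.
have [x0|x0|->] := ltgtP x 0.
- rewrite ltr0_sg// mulrN1 mulNr ltr0_norm//.
  apply: (near_eq_is_derive (f := (@powR R ^~ p) \o -%R)).
    near=> y; rewrite /abspow ltr0_norm//; near: y; exact: lt_nbhsl.
  have x0' : 0 < - x by rewrite oppr_gt0.
  apply: (is_derive_congr (is_derive1_comp (is_derive1_powR p x0') (is_deriveNid x 1))).
  by rewrite /= mulrN1.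
- rewrite gtr0_sg// mulr1 gtr0_norm//.
  apply: (near_eq_is_derive (f := @powR R ^~ p)).
    near=> y; rewrite /abspow gtr0_norm//; near: y; exact: lt_nbhsr.
  exact: is_derive1_powR.
- rewrite sgr0 mulr0 mul0r; apply: (@is_derive_flat _ (fun h => `|h| `^ (p - 1))).
  + by rewrite /abspow normr0 powR0.
  + by apply: cvg_abspow0; rewrite subr_gt0.
  + move=> h; rewrite addr0 /abspow ger0_norm ?powR_ge0//.
    have [->|h0] := eqVneq h 0; first by rewrite normr0 powR0// mulr0.
    rewrite -[X in _ * X]powRr1// -powRD ?subrK//.
    by rewrite normr_eq0 h0 implybT.
Unshelve. all: by end_near. Qed.

End real_functions.

(** * The smooth function exp (-1/x) on x > 0 and its derivatives *)

Section bump.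
Context {R : realType}.
Implicit Types (x z : R) (P : {poly R}).

Lemma expRN_poly_bounded P : exists2 C : R, 0 <= C &
  forall z, 0 <= z -> `|P.[z]| * expR (- z) <= C.
Proof.
have mono k : exists2 C : R, 0 <= C & forall z, 0 <= z -> z ^+ k * expR (- z) <= C.
  case: k => [|k].
    exists 1 => // z z0; rewrite expr0 mul1r -expR0 ler_expR; lra.
  (* The constant comes from exp z = exp (z/(k+1))^(k+1) >= (z/(k+1))^(k+1). *)
  exists (k.+1%:R ^+ k.+1); first exact: exprn_ge0.
  move=> z z0; rewrite expRN ler_pdivrMr ?expR_gt0//.
  have kz : 0 < k.+1%:R :> R by [].
  have -> : expR z = expR (z / k.+1%:R) ^+ k.+1.
    by rewrite -expRM_natl mulrC divfK ?gt_eqF.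
  rewrite -exprMn lerXn2r ?nnegrE ?mulr_ge0 ?expR_ge0//.
  rewrite mulrC -ler_pdivrMr//; apply: le_trans (expR_ge1Dx _).
  by rewrite lerDr.
elim/poly_ind: P => [|P c [C C0 PC]].
  by exists 0 => // z _; rewrite horner0 normr0 mul0r.
have {C0 PC} : exists2 D : R, 0 <= D & forall z, 0 <= z -> `|(P * 'X).[z]| * expR (- z) <= D.
  exists (\sum_(i < size P) `|P`_i| * sval (cid2 (mono i.+1))).
    by apply: sumr_ge0 => i _; rewrite mulr_ge0//; case: cid2.
  move=> z z0; rewrite hornerM hornerX horner_coef mulr_suml.
  rewrite (le_trans (ler_wpM2r (expR_ge0 _) (ler_norm_sum _ _ _)))//.
  rewrite mulr_suml; apply: ler_sum => i _.
  rewrite !normrM normrX (ger0_norm z0) -!mulrA ler_wpM2l//.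
  by rewrite mulrA -exprSr; case: cid2 => /= D D0; apply.
clear C; move=> [C C0 PC]; exists (C + `|c|); first by rewrite addr_ge0.
move=> z z0; rewrite hornerD hornerC.
rewrite (le_trans (ler_wpM2r (expR_ge0 _) (ler_normD _ _)))// mulrDl lerD ?PC//.
by rewrite ler_piMr// -expR0 ler_expR; lra.
Qed.

(** The recursion is the rule (P(1/x) exp(-1/x))' = x^-2 (P - P')(1/x) exp(-1/x). *)
Fixpoint bump_poly (k : nat) : {poly R} :=
  if k is k'.+1 then 'X^2 * (bump_poly k' - (bump_poly k')^`()) else 1.

Definition bump (k : nat) x : R :=
  if 0 < x then (bump_poly k).[x^-1] * expR (- x^-1) else 0.

Lemma is_derive_bump k x : is_derive x 1 (bump k) (bump k.+1 x).
Proof.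
have [x0|x0|->] := ltgtP x 0.
- rewrite {2}/bump ltNge (ltW x0)/=; apply: (near_eq_is_derive (f := cst 0)).
  near=> y; rewrite /bump ltNge le_eqVlt.
  have -> : y < 0 by near: y; exact: lt_nbhsl.
  by rewrite orbT.
- pose P := bump_poly k.
  have dinv : is_derive x 1 (fun y : R => y^-1) (- (x ^- 2)).
    have x0' : id x != 0 by rewrite /= gt_eqF.
    apply: (is_derive_congr (is_deriveV x0' (is_derive_id x (1:R)))).
    by rewrite /= [_ *: _]mulr1.
  have dE : is_derive x 1 (expR \o (fun y : R => - y^-1)) (expR (- x^-1) * x ^- 2).
    apply: (is_derive1_comp (is_derive_expR _)).
    by apply: (is_derive_congr (is_deriveN dinv)); rewrite opprK.
  have dP : is_derive x 1 (fun y : R => P.[y^-1]) (P^`().[x^-1] * - (x ^- 2)).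
    exact: (is_derive1_comp (is_derive_poly P x^-1) dinv).
  apply: (near_eq_is_derive (f := fun y : R => P.[y^-1] * expR (- y^-1))).
    near=> y; rewrite /bump ifT//; near: y; exact: lt_nbhsr.
  apply: (is_derive_congr (is_deriveM dP dE)).
  rewrite /bump x0 /= hornerM hornerD hornerN hornerXn /=.
  by rewrite -/P /GRing.scale/= exprVn; ring.
(* The additional factor X^2 turns boundedness into |bump k h| <= C h^2, which is flatness at 0. *)
- rewrite /bump ltxx; have [C C0 PC] := expRN_poly_bounded ('X^2 * bump_poly k).
  apply: (@is_derive_flat _ _ (fun h => C * `|h|)).
  + by rewrite /bump ltxx.
  + have := @norm_continuous R R 0; rewrite /continuous_at normr0 => n0.
    have n1 := cvgM (cvg_cst C) n0. rewrite mulr0 in n1; exact: n1.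
  + move=> h; rewrite addr0; case: ifPn => h0; last by rewrite normr0 !mulr_ge0.
    have := PC h^-1; rewrite invr_ge0 (ltW h0) hornerM hornerXn => /(_ isT).
    rewrite !normrM (ger0_norm (expR_ge0 _)) ger0_norm ?exprn_ge0 ?invr_ge0 ?(ltW h0)//.
    rewrite (gtr0_norm h0) -[C * h * h]mulrA -expr2 exprVn => H.
    move: H (ler_wpM2r (exprn_ge0 2 (ltW h0)) H).
    set A := `|_|; set e := expR _ => _; apply: le_trans.
    have hn : h != 0 by rewrite gt_eqF.
    by rewrite le_eqVlt; apply/orP; left; apply/eqP; field.
Unshelve. all: by end_near. Qed.

Lemma bump_eq0 k x : x <= 0 -> bump k x = 0.
Proof. by move=> x0; rewrite /bump ltNge x0. Qed.

Lemma bump0_gt0 x : 0 < x -> 0 < bump 0 x.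
Proof. by move=> x0; rewrite /bump x0 /= hornerC mul1r expR_gt0. Qed.

Lemma bump0_ge0 x : 0 <= bump 0 x.
Proof. by have [x0|x0] := leP x 0; [rewrite bump_eq0|exact/ltW/bump0_gt0]. Qed.

End bump.

(** * Composition with logarithms, powers, bumps and absolute powers *)

Section compositions.
Context {R : realType} (m : nat).
Notation V := 'rV[R]_m.
Implicit Types (f g : V -> R) (K U : set V) (j : 'I_m) (v : V).

Lemma Ck_comp_smooth k U f (W : set R) (Phi : nat -> R -> R) : open U ->
  (forall i (x : R), W x -> is_derive x 1 (Phi i) (Phi i.+1 x)) ->
  (forall v, U v -> W (f v)) -> Ck k U f -> Ck k U (fun v => Phi 0%N (f v)).
Proof.
move=> oU dP fW; apply: (Ck_comp (W := W)) => //.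
by move=> i x _ Wx; exact: is_derive_continuous (dP _ _ Wx).
Qed.

Lemma Ck_comp1 U f (Phi Phi' : R -> R) : open U ->
  (forall x : R, is_derive x 1 Phi (Phi' x)) -> continuous Phi' ->
  Ck 1 U f -> Ck 1 U (fun v => Phi (f v)).
Proof.
move=> oU dP cP.
apply: (Ck_comp (W := setT) (Phi := fun i => if i is 0 then Phi else Phi')) => //.
- by move=> [|i] x //; move=> _ _; exact: dP.
- by move=> [|i] x _ _; [exact: is_derive_continuous (dP x)|exact: cP].
Qed.

Lemma Ck_expR k U f : open U -> Ck k U f -> Ck k U (fun v => expR (f v)).
Proof.
move=> oU; exact: (Ck_comp_smooth (W := setT) (Phi := fun=> expR)).
Qed.

Lemma is_derive_invX (i : nat) (x : R) : 0 < x ->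
  is_derive x 1 (fun y => y ^- i.+1) (- i.+1%:R * x ^- i.+2).
Proof.
move=> x0; elim: i => [|i IH].
  have x0' : id x != 0 by rewrite /= gt_eqF.
  apply: (is_derive_congr (is_deriveV x0' (is_derive_id x (1:R)))).
  by rewrite /= [_ *: _]mulr1 mulN1r.
have x0' : id x != 0 by rewrite /= gt_eqF.
have d1 := is_deriveV x0' (is_derive_id x (1:R)).
have d2 := is_deriveM IH d1.
have -> : (fun y : R => y ^- i.+2) = (fun y => y ^- i.+1) * (fun y => y^-1).
  by apply/funext => y; rewrite exprS invfM mulrC.
apply: (is_derive_congr d2); rewrite /= /GRing.scale/=.
have -> : i.+2%:R = i.+1%:R + 1 :> R by rewrite natr1.
by rewrite -!exprVn !exprS; ring.
Qed.

Lemma Ck_ln k U f : open U -> (forall v, U v -> 0 < f v) -> Ck k U f ->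
  Ck k U (fun v => ln (f v)).
Proof.
move=> oU f0.
pose Phi (i : nat) (x : R) := if i is i'.+1 then (-1) ^+ i' * i'`!%:R * x ^- i else ln x.
apply: (Ck_comp_smooth (W := [set x | 0 < x]) (Phi := Phi)) => //.
move=> [|i] x /= x0; rewrite /Phi.
  by apply: (is_derive_congr (is_derive1_ln x0)); rewrite expr0 expr1 !mul1r.
apply: (is_derive_congr (is_deriveZ ((-1) ^+ i * i`!%:R) (is_derive_invX i x0))).
by rewrite factS natrM -!exprVn !exprS /GRing.scale/=; ring.
Qed.

(** Inverses, like the real powers and roots below, are reduced to exp and ln on positive
    functions. *)
Lemma Ck_inv k U f : open U -> (forall v, U v -> 0 < f v) -> Ck k U f ->
  Ck k U (fun v => (f v)^-1).
Proof.
move=> oU f0 Cf; apply: (eq_Ck oU _ (Ck_expR oU (CkN oU (Ck_ln oU f0 Cf)))).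
by move=> v Uv; rewrite expRN lnK// posrE f0.
Qed.

Lemma Ck_powR k U f (a : R) : open U -> (forall v, U v -> 0 < f v) ->
  Ck k U f -> Ck k U (fun v => f v `^ a).
Proof.
move=> oU f0 Cf.
apply: (eq_Ck oU _ (Ck_expR oU (CkM oU (Ck_cst k U a) (Ck_ln oU f0 Cf)))).
by move=> v Uv; rewrite /powR gt_eqF// f0.
Qed.

Lemma Ck_sqrt k U f : open U -> (forall v, U v -> 0 < f v) ->
  Ck k U f -> Ck k U (fun v => Num.sqrt (f v)).
Proof.
move=> oU f0 Cf; apply: (eq_Ck oU _ (Ck_powR 2^-1 oU f0 Cf)).
by move=> v Uv; rewrite powR12_sqrt// ltW// f0.
Qed.

Lemma Ck_bump k U f : open U -> Ck k U f -> Ck k U (fun v => bump 0 (f v)).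
Proof.
move=> oU; apply: (Ck_comp_smooth (W := setT) (Phi := bump)) => //.
by move=> i x _; exact: is_derive_bump.
Qed.

Lemma Ck_sqpos U f : open U -> Ck 1 U f -> Ck 1 U (fun v => sqpos (f v)).
Proof.
move=> oU; apply: Ck_comp1 => //; first exact: is_derive_sqpos.
move=> x; apply: cvgM; first exact: cvg_cst.
by apply: continuous_max => y; [exact: cst_continuous|exact: cvg_id].
Qed.

Lemma Ck_abspow U f (p : R) : 1 < p -> open U -> Ck 1 U f ->
  Ck 1 U (fun v => abspow p (f v)).
Proof.
move=> p1 oU; apply: Ck_comp1 => //; first by move=> x; exact: is_derive_abspow.
have pB : 0 < p - 1 by rewrite subr_gt0.
pose Phi' (y : R) := p * Num.sg y * `|y| `^ (p - 1).
have near_cont (g : R -> R) (x d : R) : (\forall y \near x, g y = Phi' y) ->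
    is_derive x 1 g d -> {for x, continuous Phi'}.
  by move=> gP dg; exact: is_derive_continuous (near_eq_is_derive gP dg).
move=> x; have [x0|x0|->] := ltgtP x 0.
- have x0' : 0 < - x by rewrite oppr_gt0.
  have dg := is_derive1_comp (is_derive1_powR (p - 1) x0') (is_deriveNid x 1).
  apply: (near_cont _ _ _ _ (is_deriveZ (- p) dg)).
  near=> y; have y0 : y < 0 by near: y; exact: lt_nbhsl.
  by rewrite /Phi' ltr0_sg// ltr0_norm// mulrN1.
- apply: (near_cont _ _ _ _ (is_deriveZ p (is_derive1_powR (p - 1) x0))).
  near=> y; have y0 : 0 < y by near: y; exact: lt_nbhsr.
  by rewrite /Phi' gtr0_sg// gtr0_norm// mulr1.
- change (Phi' y @[y --> 0] --> Phi' 0).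
  rewrite {2}/Phi' sgr0 mulr0 mul0r; apply/norm_cvg0P.
  have c0 : (p * abspow (p - 1) y) @[y --> 0] --> (0 : R).
    by rewrite -[X in _ --> X](mulr0 p); apply: cvgM; [exact: cvg_cst|exact: cvg_abspow0].
  apply: (squeeze_cvgr _ (cvg_cst 0) c0); apply: nearW => y.
  rewrite normr_ge0 /= /Phi' /abspow !normrM (ger0_norm (powR_ge0 _ _)).
  rewrite ler_wpM2r ?powR_ge0// gtr0_norm ?(lt_trans ltr01 p1)//.
  by rewrite normr_sg ler_piMr ?(ltW (lt_trans ltr01 p1))// lern1 leq_b1.
Unshelve. all: by end_near. Qed.

End compositions.

(** * Axisymmetric functions and the geometry of the torus *)

Section axisymmetric.
Context {R : realType} (n : nat).
Notation V := 'rV[R]_(n + n + 1).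
Implicit Types (f g psi : V -> R) (K U : set V) (v : V) (i : 'I_n).
Notation rd := (@radius R n).

Definition qrad v : R := \sum_i xc v i ^+ 2 + \sum_i yc v i ^+ 2.

Lemma qrad_ge0 v : 0 <= qrad v.
Proof. by apply: addr_ge0; apply: sumr_ge0 => i _; exact: sqr_ge0. Qed.

Lemma radius_ge0 v : 0 <= rd v. Proof. exact: sqrtr_ge0. Qed.

Lemma sqr_radius v : rd v ^+ 2 = qrad v.
Proof. by rewrite sqr_sqrtr// qrad_ge0. Qed.

Lemma radius_gt0 v : (0 < rd v) = (0 < qrad v).
Proof. by rewrite sqrtr_gt0. Qed.

Lemma Ck_xc k U i : Ck k U (fun v => xc v i).
Proof. exact: Ck_coord. Qed.
Lemma Ck_yc k U i : Ck k U (fun v => yc v i).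
Proof. exact: Ck_coord. Qed.
Lemma Ck_tc k U : Ck k U (@tc R n).
Proof. exact: Ck_coord. Qed.

Lemma Ck_qrad k U : open U -> Ck k U qrad.
Proof.
move=> oU; apply: CkD => //; apply: Ck_sum => // i; apply: CkX => //.
- exact: Ck_xc.
- exact: Ck_yc.
Qed.

Lemma continuous_radius : continuous rd.
Proof.
move=> v; apply: (@continuous_comp _ _ _ qrad (@Num.sqrt R)).
  exact: (Ck_continuous (Ck_qrad 0 openT)).
exact: sqrt_continuous.
Qed.

Lemma Ck_radius k U : open U -> (forall v, U v -> 0 < rd v) -> Ck k U rd.
Proof.
move=> oU r0; apply: Ck_sqrt => //; first by move=> v /r0; rewrite radius_gt0.
exact: Ck_qrad.
Qed.

Lemma xidx_eq i j : (xidx i == xidx j) = (i == j).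
Proof. by rewrite /xidx !(inj_eq (@lshift_inj _ _)). Qed.
Lemma yidx_eq i j : (yidx i == yidx j) = (i == j).
Proof. by rewrite /yidx (inj_eq (@lshift_inj _ _)) (inj_eq (@rshift_inj _ _)). Qed.
Lemma xyidx_eq i j : (xidx i == yidx j) = false.
Proof. by rewrite /xidx /yidx (inj_eq (@lshift_inj _ _)) eq_lrshift. Qed.
Lemma yxidx_eq i j : (yidx i == xidx j) = false.
Proof. by rewrite eq_sym xyidx_eq. Qed.
Lemma xtidx_eq i : (xidx i == tidx n) = false.
Proof. by rewrite /xidx /tidx eq_lrshift. Qed.
Lemma ytidx_eq i : (yidx i == tidx n) = false.
Proof. by rewrite /yidx /tidx eq_lrshift. Qed.

(* [axi U f fr ft]: on [U], [f] is a differentiable function of r and t, with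
   partial derivatives [fr] and [ft]. *)
Definition axi U f fr ft := forall v, U v ->
  [/\ forall i, is_derive v (dir (xidx i)) f (fr v * xc v i / rd v),
      forall i, is_derive v (dir (yidx i)) f (fr v * yc v i / rd v)
    & is_derive v (dir (tidx n)) f (ft v)].

Lemma axi_cst U (c : R) : axi U (cst c) (cst 0) (cst 0).
Proof. by move=> v _; split=> [i|i|]; rewrite ?mul0r; exact: is_derive_cst. Qed.

Lemma axi_t U : axi U (@tc R n) (cst 0) (cst 1).
Proof.
move=> v _; split=> [i|i|].
- by apply: (is_derive_congr (is_derive_coord _ _ _)); rewrite eq_sym xtidx_eq !mul0r.
- by apply: (is_derive_congr (is_derive_coord _ _ _)); rewrite eq_sym ytidx_eq !mul0r.
- by apply: (is_derive_congr (is_derive_coord _ _ _)); rewrite eqxx.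
Qed.

Lemma axi_comp U f fr ft (Phi Phi' : R -> R) :
  (forall v, U v -> is_derive (f v) 1 Phi (Phi' (f v))) -> axi U f fr ft ->
  axi U (fun v => Phi (f v)) (fun v => Phi' (f v) * fr v) (fun v => Phi' (f v) * ft v).
Proof.
move=> dP af v Uv; have [h1 h2 h3] := af v Uv; split=> [i|i|].
- by apply: (is_derive_congr (is_derive_comp1 (dP _ Uv) (h1 i))); rewrite !mulrA.
- by apply: (is_derive_congr (is_derive_comp1 (dP _ Uv) (h2 i))); rewrite !mulrA.
- exact: (is_derive_comp1 (dP _ Uv) h3).
Qed.

Lemma axiD U f fr ft g gr gt : axi U f fr ft -> axi U g gr gt ->
  axi U (fun v => f v + g v) (fun v => fr v + gr v) (fun v => ft v + gt v).
Proof.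
move=> af ag v Uv; have [f1 f2 f3] := af v Uv; have [g1 g2 g3] := ag v Uv.
split=> [i|i|].
- by apply: (is_derive_congr (is_deriveD (f1 i) (g1 i))); rewrite !mulrDl.
- by apply: (is_derive_congr (is_deriveD (f2 i) (g2 i))); rewrite !mulrDl.
- exact: is_deriveD f3 g3.
Qed.

Lemma axiM U f fr ft g gr gt : axi U f fr ft -> axi U g gr gt ->
  axi U (fun v => f v * g v) (fun v => fr v * g v + f v * gr v)
    (fun v => ft v * g v + f v * gt v).
Proof.
move=> af ag v Uv; have [f1 f2 f3] := af v Uv; have [g1 g2 g3] := ag v Uv.
split=> [i|i|].
- by apply: (is_derive_congr (is_deriveM (f1 i) (g1 i))); rewrite /GRing.scale/=; ring.
- by apply: (is_derive_congr (is_deriveM (f2 i) (g2 i))); rewrite /GRing.scale/=; ring.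
- by apply: (is_derive_congr (is_deriveM f3 g3)); rewrite /GRing.scale/=; ring.
Qed.

Lemma axi_eq U f fr ft gr gt : axi U f fr ft ->
  (forall v, U v -> fr v = gr v) -> (forall v, U v -> ft v = gt v) -> axi U f gr gt.
Proof.
move=> af e1 e2 v Uv; have [f1 f2 f3] := af v Uv.
by rewrite -(e1 _ Uv) -(e2 _ Uv).
Qed.

Lemma is_derive_sumf (I : Type) (s : seq I) (F : I -> V -> R) (dF : I -> R) v w :
  (forall k, is_derive v w (F k) (dF k)) ->
  is_derive v w (fun x => \sum_(k <- s) F k x) (\sum_(k <- s) dF k).
Proof.
move=> dFi; elim: s => [|k s IH].
  by under eq_fun do rewrite big_nil; rewrite big_nil; exact: is_derive_cst.
under eq_fun do rewrite big_cons.
by rewrite big_cons; exact: is_deriveD (dFi k) IH.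
Qed.

Lemma axi_q U : (forall v, U v -> 0 < rd v) ->
  axi U qrad (fun v => 2 * rd v) (cst 0).
Proof.
move=> r0 v Uv; have rn : rd v != 0 by rewrite gt_eqF// r0.
have dsq (k j : 'I_(n + n + 1)) : is_derive v (dir j) (fun w : V => w ord0 k ^+ 2)
    (2 * v ord0 k * (k == j)%:R).
  have h := is_derive_coord k j v.
  by apply: (is_derive_congr (is_deriveM h h)); rewrite /GRing.scale/=; ring.
have D j : is_derive v (dir j) qrad (\sum_i 2 * xc v i * (xidx i == j)%:R
    + \sum_i 2 * yc v i * (yidx i == j)%:R).
  by apply: is_deriveD; apply: is_derive_sumf => i; exact: dsq.
have cancel c : 2 * rd v * c / rd v = 2 * c by field.
split=> [i|i|]; apply: (is_derive_congr (D _)); rewrite ?cancel.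
- rewrite (bigD1 i)//= eqxx mulr1 big1 => [|j ji]; last first.
    by rewrite xidx_eq (negbTE ji) mulr0.
  by rewrite big1 ?addr0// => j _; rewrite yxidx_eq mulr0.
- rewrite big1 ?add0r => [|j _]; last by rewrite xyidx_eq mulr0.
  rewrite (bigD1 i)//= eqxx mulr1 big1 ?addr0// => j ji.
  by rewrite yidx_eq (negbTE ji) mulr0.
- rewrite big1 ?add0r => [|j _]; last by rewrite xtidx_eq mulr0.
  by rewrite big1// => j _; rewrite ytidx_eq mulr0.
Qed.

Lemma axi_r U : (forall v, U v -> 0 < rd v) -> axi U rd (cst 1) (cst 0).
Proof.
move=> r0; have dS v : U v -> is_derive (qrad v) 1 (@Num.sqrt R) ((2 * Num.sqrt (qrad v))^-1).
  by move=> Uv; apply: is_derive1_sqrt; rewrite -radius_gt0 r0.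
apply: (axi_eq (axi_comp (Phi' := fun x => (2 * Num.sqrt x)^-1) dS (axi_q r0))) => v Uv.
  by rewrite /= -/(rd v) mulVf// mulf_neq0// gt_eqF// r0.
by rewrite /= mulr0.
Qed.

(** [euler] is r d/dr. [swirl] differentiates along the rotation (y, -x), so it annihilates
    functions of r and t. Together with the t-derivative they express every horizontal product that
    is needed. *)
Definition euler psi v : R :=
  \sum_i (xc v i * partial (xidx i) psi v + yc v i * partial (yidx i) psi v).
Definition swirl psi v : R :=
  \sum_i (yc v i * partial (xidx i) psi v - xc v i * partial (yidx i) psi v).

Lemma sum_x2y2 v : \sum_i (xc v i ^+ 2 + yc v i ^+ 2) = rd v ^+ 2.
Proof. by rewrite sqr_radius /qrad big_split. Qed.

Lemma axi_euler U f fr ft v : axi U f fr ft -> U v -> 0 < rd v ->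
  euler f v = rd v * fr v.
Proof.
move=> af Uv r0; have [f1 f2 _] := af v Uv.
have rn : rd v != 0 by rewrite gt_eqF.
rewrite /euler (eq_bigr (fun i => (xc v i ^+ 2 + yc v i ^+ 2) * (fr v / rd v))) => [|i _].
  by rewrite -mulr_suml sum_x2y2; field.
by rewrite (partialE (f1 i)) (partialE (f2 i)); field.
Qed.

Lemma axi_swirl U f fr ft v : axi U f fr ft -> U v -> swirl f v = 0.
Proof.
move=> af Uv; have [f1 f2 _] := af v Uv.
rewrite /swirl big1// => i _.
by rewrite (partialE (f1 i)) (partialE (f2 i)); ring.
Qed.

Lemma axi_partialt U f fr ft v : axi U f fr ft -> U v -> partial (tidx n) f v = ft v.
Proof. by move=> af Uv; have [_ _ f3] := af v Uv; exact: partialE. Qed.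

Lemma tame_sum (I : Type) (s : seq I) (F : I -> V -> R) :
  (forall k, tame (F k) /\ integ (F k) = 0) ->
  tame (fun v => \sum_(k <- s) F k v) /\ integ (fun v => \sum_(k <- s) F k v) = 0.
Proof.
move=> HF; elim: s => [|k s [IH1 IH2]].
  under eq_fun do rewrite big_nil.
  split; first exact: tame0.
  have := @integZ _ _ 0 _ (@tame0 R (n + n + 1)).
  by under eq_fun do rewrite mul0r; rewrite mul0r.
under eq_fun do rewrite big_cons.
have [h1 h2] := HF k; split; first exact: tameD.
by rewrite (integD h1 IH1) h2 IH2 addr0.
Qed.

(** The divergence theorem for the field A (x, y) + B (y, -x) + C e_t multiplied by [psi]. The
    coefficient of [psi] is the divergence of the field: the rotational part contributes nothing
    because [B] depends on r and t only. *)
Lemma axi_div U K (A B C A' B' C' At Bt Ct psi : V -> R) : open U ->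
  (forall v, U v -> 0 < rd v) ->
  axi U A A' At -> axi U B B' Bt -> axi U C C' Ct ->
  Ck 1 U A -> Ck 1 U B -> Ck 1 U C -> Ck 1 setT psi ->
  compact K -> K `<=` U -> (forall v, ~ K v -> psi v = 0) ->
  let F v := A v * euler psi v + B v * swirl psi v + C v * partial (tidx n) psi v
     + (2 * n%:R * A v + rd v * A' v + Ct v) * psi v in
  tame F /\ integ F = 0.
Proof.
move=> oU r0 aA aB aC cA cB cC cp cK KU p0 F.
pose G (i : 'I_n + 'I_n) v :=
  match i with
  | inl i => partial (xidx i) (fun v => A v * xc v i + B v * yc v i) v * psi v
        + (A v * xc v i + B v * yc v i) * partial (xidx i) psi v
  | inr i => partial (yidx i) (fun v => A v * yc v i - B v * xc v i) v * psi v
        + (A v * yc v i - B v * xc v i) * partial (yidx i) psi v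
  end.
have HG k : tame (G k) /\ integ (G k) = 0.
  have cx i := @Ck_xc 1 U i; have cy i := @Ck_yc 1 U i.
  case: k => i.
    exact: (ibp (xidx i) oU (CkD oU (CkM oU cA (cx i)) (CkM oU cB (cy i))) cp cK KU p0).
  exact: (ibp (yidx i) oU (CkB oU (CkM oU cA (cy i)) (CkM oU cB (cx i))) cp cK KU p0).
have [hC1 hC2] := ibp (tidx n) oU cC cp cK KU p0.
have [hG1 hG2] := tame_sum (index_enum _) HG.
have clK : closed K by apply: compact_closed => //; exact: norm_hausdorff.
suff -> : F = (fun v => \sum_k G k v) \+
    (fun v => partial (tidx n) C v * psi v + C v * partial (tidx n) psi v).
  by split; [exact: tameD|rewrite (integD hG1 hC1) hG2 hC2 addr0].
apply/funext => v /=; have [Kv|Kv] := pselect (K v); last first.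
  rewrite /F /euler /swirl p0// (partial_outside _ clK p0 Kv) !mulr0.
  rewrite !big1 ?mulr0 ?addr0// => [[i|i] _|i _|i _] /=;
  by rewrite ?p0// !(partial_outside _ clK p0 Kv) !mulr0 ?addr0 ?subr0.
have Uv := KU _ Kv.
have rn : rd v != 0 by rewrite gt_eqF// r0.
have [A1 A2 A3] := aA v Uv; have [B1 B2 B3] := aB v Uv.
rewrite (axi_partialt aC Uv) big_sumType/= -big_split/=.
have dxx i := is_derive_coord (xidx i) (xidx i) v.
have dyy i := is_derive_coord (yidx i) (yidx i) v.
have dyx i := is_derive_coord (yidx i) (xidx i) v.
have dxy i := is_derive_coord (xidx i) (yidx i) v.
rewrite (eq_bigr (fun i => A v * (xc v i * partial (xidx i) psi v + yc v i * partial (yidx i) psi v)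
   + B v * (yc v i * partial (xidx i) psi v - xc v i * partial (yidx i) psi v)
   + (xc v i ^+ 2 + yc v i ^+ 2) * (A' v / rd v * psi v) + 2 * A v * psi v)); last first.
  move=> i _.
  rewrite (partialE (is_deriveD (is_deriveM (A1 i) (dxx i)) (is_deriveM (B1 i) (dyx i)))).
  rewrite (partialE (is_deriveB (is_deriveM (A2 i) (dyy i)) (is_deriveM (B2 i) (dxy i)))).
  rewrite !eqxx yxidx_eq xyidx_eq /GRing.scale/= -!/(xc v i) -!/(yc v i).
  by field.
rewrite !big_split/= -!mulr_sumr -mulr_suml sum_x2y2 sumr_const card_ord.
rewrite /F /euler /swirl -mulr_natl; field; exact: rn.
Qed.

End axisymmetric.

Lemma dot_ge0 (R : realType) m (u : 'rV[R]_m) : 0 <= dot u u.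
Proof. by apply: sumr_ge0 => i _; rewrite -expr2 sqr_ge0. Qed.

Lemma enorm_ge0 (R : realType) m (u : 'rV[R]_m) : 0 <= enorm u.
Proof. exact: sqrtr_ge0. Qed.

Lemma sqr_enorm (R : realType) m (u : 'rV[R]_m) : enorm u ^+ 2 = dot u u.
Proof. by rewrite sqr_sqrtr// dot_ge0. Qed.

(** * The distance to the boundary of the torus *)

Section torus_geometry.
Context {R : realType} (n : nat) (Rmaj rho : R).
Notation V := 'rV[R]_(n + n + 1).
Implicit Types (f g psi : V -> R) (K U : set V) (v w : V) (i : 'I_n).
Notation rd := (@radius R n).
Notation T := (torus n Rmaj rho).

(* [core v] is the distance from [v] to the core {r = Rmaj, t = 0} of the torus,
   the set where [dist_boundary T] is not differentiable. *)
Definition rcore v : R := rd v - Rmaj.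
Definition core2 v : R := rcore v ^+ 2 + tc v ^+ 2.
Definition core v : R := Num.sqrt (core2 v).
Definition depth v : R := rho - core v.
Definition cut_torus : set V := [set v | 0 < core2 v < rho ^+ 2].
Notation T' := cut_torus.

Lemma core2_ge0 v : 0 <= core2 v.
Proof. by rewrite addr_ge0 ?sqr_ge0. Qed.

Lemma core_ge0 v : 0 <= core v. Proof. exact: sqrtr_ge0. Qed.

Lemma sqr_core v : core v ^+ 2 = core2 v.
Proof. by rewrite sqr_sqrtr// core2_ge0. Qed.

Lemma continuous_rcore : continuous rcore.
Proof. by move=> v; exact: (cvgB (@continuous_radius R n v) (cvg_cst _)). Qed.

Lemma continuous_tc : continuous (@tc R n).
Proof. exact: coord_continuous. Qed.

Lemma continuous_core2 : continuous core2.
Proof.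
have -> : core2 = (fun v => rcore v * rcore v + tc v * tc v).
  by apply/funext => v; rewrite /core2 !expr2.
move=> v; exact: (cvgD (cvgM (@continuous_rcore v) (@continuous_rcore v))
  (cvgM (@continuous_tc v) (@continuous_tc v))).
Qed.

Lemma continuous_core : continuous core.
Proof.
move=> v; apply: (@continuous_comp _ _ _ core2 (@Num.sqrt R)).
  exact: continuous_core2.
exact: sqrt_continuous.
Qed.

Lemma continuous_depth : continuous depth.
Proof. by move=> v; exact: (cvgB (cvg_cst _) (@continuous_core v)). Qed.

Lemma open_torus : open T.
Proof.
have := open_comp (fun v _ => @continuous_core2 v) (@open_lt R (rho ^+ 2)).
exact.
Qed.

Lemma open_cut_torus : open T'.
Proof.
have o1 : open T := open_torus.
have o2 : open [set v | 0 < core2 v].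
  exact: (open_comp (fun v _ => @continuous_core2 v) (@open_gt R 0)).
rewrite (_ : T' = [set v | 0 < core2 v] `&` T); first exact: openI.
by apply/seteqP; split => v /= => [/andP[]|[? ?]]//; apply/andP.
Qed.

Lemma cut_torusS : T' `<=` T. Proof. by move=> v /andP[]. Qed.

Hypothesis rho0 : 0 < rho.
Hypothesis rhoR : rho < Rmaj.

Lemma torusE v : T v = (core v < rho) :> Prop.
Proof.
have E : (core v < rho) = (core2 v < rho ^+ 2).
  by rewrite -sqr_core ltr_pXn2r ?nnegrE ?core_ge0 ?(ltW rho0).
by rewrite E.
Qed.

Lemma depth_gt0 v : T v -> 0 < depth v.
Proof. by rewrite torusE /depth subr_gt0. Qed.

Lemma rcore_le v : `|rcore v| <= core v.
Proof.
rewrite -sqrtr_sqr ler_sqrt ?core2_ge0//.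
by rewrite /core2 lerDl sqr_ge0.
Qed.

Lemma tc_le v : `|tc v| <= core v.
Proof. by rewrite -sqrtr_sqr ler_sqrt ?core2_ge0// /core2 lerDr sqr_ge0. Qed.

Lemma radius_bounds v : core v <= rho -> Rmaj - rho <= rd v <= Rmaj + rho.
Proof.
move=> h; have := le_trans (rcore_le v) h.
by rewrite /rcore ler_norml => /andP[? ?]; apply/andP; split; lra.
Qed.

Lemma radius_pos v : core v <= rho -> 0 < rd v.
Proof. by have h1 := rhoR; move=> /radius_bounds/andP[h _]; lra. Qed.

Lemma torus_radius_gt0 v : T v -> 0 < rd v.
Proof. by rewrite torusE => /ltW; exact: radius_pos. Qed.

Lemma cut_core_gt0 v : T' v -> 0 < core v.
Proof. by move=> /andP[h _]; rewrite /core sqrtr_gt0. Qed.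

Lemma axi_rcore : axi T' rcore (cst 1) (cst 0).
Proof.
have r0 v : T' v -> 0 < rd v by move=> /cut_torusS/torus_radius_gt0.
have := axiD (axi_r r0) (@axi_cst _ _ T' (- Rmaj)).
by move/axi_eq; apply => v _ /=; rewrite addr0.
Qed.

Lemma axi_core2 : axi T' core2 (fun v => 2 * rcore v) (fun v => 2 * tc v).
Proof.
have := axiD (axiM axi_rcore axi_rcore) (axiM (@axi_t _ _ T') (@axi_t _ _ T')).
by move/axi_eq; apply => v _ /=; ring.
Qed.

Lemma axi_core : axi T' core (fun v => rcore v / core v) (fun v => tc v / core v).
Proof.
have dS v : T' v -> is_derive (core2 v) 1 (@Num.sqrt R) ((2 * Num.sqrt (core2 v))^-1).
  by move=> Uv; apply: is_derive1_sqrt; case/andP: Uv.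
apply: (axi_eq (axi_comp (Phi' := fun x => (2 * Num.sqrt x)^-1) dS axi_core2)) => v Uv;
have := cut_core_gt0 Uv; rewrite /= -/(core v) => c0;
have cn : core v != 0 by rewrite gt_eqF.
- by field.
- by field.
Qed.

Lemma axi_depth : axi T' depth (fun v => - (rcore v / core v)) (fun v => - (tc v / core v)).
Proof.
have := axiD (@axi_cst _ _ T' rho) (axiM (@axi_cst _ _ T' (-1)) axi_core).
have -> : (fun v => cst rho v + cst (-1) v * core v) = depth.
  by apply/funext => v; rewrite /= mulN1r.
by move/axi_eq; apply => v _ /=; ring.
Qed.

Lemma Ck_rcore k : Ck k T' rcore.
Proof.
have oU := open_cut_torus.
apply: CkB => //; last exact: Ck_cst.
by apply: Ck_radius => // v /cut_torusS/torus_radius_gt0.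
Qed.

Lemma Ck_core2 k : Ck k T' core2.
Proof.
have oU := open_cut_torus.
by apply: CkD => //; apply: CkX => //; [exact: Ck_rcore|exact: Ck_tc].
Qed.

Lemma Ck_core k : Ck k T' core.
Proof.
by apply: Ck_sqrt; [exact: open_cut_torus|move=> v /andP[]|exact: Ck_core2].
Qed.

Lemma Ck_depth k : Ck k T' depth.
Proof.
have oU := open_cut_torus.
by apply: CkB => //; [exact: Ck_cst|exact: Ck_core].
Qed.

Lemma dotE v w : dot v w = \sum_i (xc v i * xc w i + yc v i * yc w i) + tc v * tc w.
Proof. by rewrite /dot !big_split_ord/= big_ord1 big_split. Qed.

Lemma xy_cauchy v w : 0 < rd v -> 0 < rd w ->
  \sum_i (xc v i * xc w i + yc v i * yc w i) <= rd v * rd w.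
Proof.
move=> v0 w0; set S := \sum_i _.
have : 0 <= \sum_i ((rd w * xc v i - rd v * xc w i) ^+ 2
                    + (rd w * yc v i - rd v * yc w i) ^+ 2).
  by apply: sumr_ge0 => i _; rewrite addr_ge0 ?sqr_ge0.
rewrite (eq_bigr (fun i => rd w ^+ 2 * (xc v i ^+ 2 + yc v i ^+ 2)
  + rd v ^+ 2 * (xc w i ^+ 2 + yc w i ^+ 2)
  - 2 * (rd v * rd w) * (xc v i * xc w i + yc v i * yc w i))) => [|i _]; last by ring.
rewrite sumrB big_split/= -!mulr_sumr !sum_x2y2 -/S => h.
have vw : 0 < rd v * rd w by rewrite mulr_gt0.
rewrite -(ler_pM2l vw); nra.
Qed.

(** By Cauchy-Schwarz the projection onto the half-plane of the pairs (r, t) is 1-Lipschitz ([H]),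
    and [core] is the planar distance to the point (Rmaj, 0); the triangle inequality in the plane
    remains. *)
Lemma core_lipschitz v w : 0 < rd v -> 0 < rd w -> core w <= core v + enorm (v - w).
Proof.
move=> v0 w0; have C := xy_cauchy v0 w0.
have E : enorm (v - w) ^+ 2 = rd v ^+ 2 + rd w ^+ 2
    - 2 * \sum_i (xc v i * xc w i + yc v i * yc w i) + (tc v - tc w) ^+ 2.
  rewrite sqr_enorm dotE -!sum_x2y2 mulr_sumr -big_split -sumrB/=.
  congr (_ + _); last by rewrite /tc !mxE expr2.
  by apply: eq_bigr => i _; rewrite /xc /yc !mxE; ring.
have s0 := core_ge0 v; have e0 : 0 <= enorm (v - w) by exact: sqrtr_ge0.
have cv := sqr_core v; have cw := sqr_core w.
have k0 := core_ge0 w.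
have H : (rcore v - rcore w) ^+ 2 + (tc v - tc w) ^+ 2 <= enorm (v - w) ^+ 2.
  by rewrite E /rcore; nra.
rewrite -(ler_pXn2r (n := 2)) ?nnegrE ?addr_ge0//.
rewrite cw sqrrD cv /core2.
set e := enorm _ in H e0 *; set s := core v in s0 cv *.
have M : (rcore v * (rcore w - rcore v) + tc v * (tc w - tc v)) <= s * e.
  apply: le_trans (ler_norm _) _.
  rewrite -(ler_pXn2r (n := 2)) ?nnegrE ?mulr_ge0// -normrX ger0_norm ?sqr_ge0//.
  rewrite exprMn cv /core2.
  (* Lagrange's identity: this square is the defect in the planar Cauchy-Schwarz inequality. *)
  have : 0 <= (rcore v * (tc w - tc v) - tc v * (rcore w - rcore v)) ^+ 2 by exact: sqr_ge0.
  have : 0 <= rcore v ^+ 2 + tc v ^+ 2 by rewrite addr_ge0 ?sqr_ge0.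
  by move: H; nra.
by move: H M; rewrite -mulr_natl; nra.
Qed.

Lemma boundary_torus w : boundary T w -> core w = rho.
Proof.
move=> [cw iw]; have /negP : ~ T w.
  by move=> Tw; apply: iw; rewrite /interior; exact: open_nbhs_nbhs (conj open_torus Tw).
rewrite -leNgt => h; apply/eqP; rewrite eq_le; apply/andP; split.
  have cl : closed [set v | core v <= rho].
    exact: (closed_comp (fun v _ => @continuous_core v) (@closed_le R rho)).
  apply: (cl w); apply: closure_subset cw => v.
  by rewrite torusE => /ltW.
rewrite -(@ler_pXn2r _ 2) ?nnegrE ?core_ge0 ?(ltW rho0)//.
by rewrite sqr_core.
Qed.

(** The point is found in the meridian half-plane through [v], on the ray issuing from the centre
    (Rmaj, 0) of the disc. [P mu] is the point at distance [mu] from the core on this ray. *)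
Lemma ray_to_boundary v : T v -> exists2 w, boundary T w & enorm (v - w) = depth v.
Proof.
move=> Tv; have r0 := torus_radius_gt0 Tv.
have h0 := rho0; have hR := rhoR.
have rn : rd v != 0 by rewrite gt_eqF.
have [c [cE1 cE2 cE3]] : exists c : R * R,
    [/\ c.1 ^+ 2 + c.2 ^+ 2 = 1, rcore v = core v * c.1 & tc v = core v * c.2].
  have [s0|s0] := eqVneq (core v) 0.
    (* On the core every direction is equally good; (0, 1) is taken. *)
    have := sqr_core v; rewrite s0 expr0n /core2/= => /esym/eqP.
    rewrite paddr_eq0 ?sqr_ge0// !sqrf_eq0 => /andP[/eqP a0 /eqP t0].
    by exists (0, 1) => /=; rewrite a0 t0 !mul0r expr0n expr1n add0r.
  exists (rcore v / core v, tc v / core v) => /=; split.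
  - by rewrite !exprMn -mulrDl -/(core2 v) -sqr_core exprVn divff// expf_neq0.
  - by rewrite mulrC divfK.
  - by rewrite mulrC divfK.
pose P mu : V := \row_j (if j == tidx n then mu * c.2
   else (Rmaj + mu * c.1) / rd v * v ord0 j).
have Px mu i : xc (P mu) i = (Rmaj + mu * c.1) / rd v * xc v i.
  by rewrite /xc mxE xtidx_eq.
have Py mu i : yc (P mu) i = (Rmaj + mu * c.1) / rd v * yc v i.
  by rewrite /yc mxE ytidx_eq.
have Pt mu : tc (P mu) = mu * c.2 by rewrite /tc mxE eqxx.
have c1 : `|c.1| <= 1.
  by rewrite -(@ler_pXn2r _ 2) ?nnegrE// expr1n real_normK ?num_real//; have := sqr_ge0 c.2; lra.
have Prd mu : 0 <= mu < Rmaj -> rd (P mu) = Rmaj + mu * c.1.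
  move=> /andP[m0 mR].
  have hc : 0 <= Rmaj + mu * c.1.
    by move: c1; rewrite ler_norml => /andP[? ?]; nra.
  apply/eqP; rewrite -(@eqrXn2 _ 2) ?radius_ge0//; apply/eqP.
  rewrite -sum_x2y2.
  rewrite (eq_bigr (fun i => ((Rmaj + mu * c.1) / rd v) ^+ 2 * (xc v i ^+ 2 + yc v i ^+ 2))).
    by rewrite -mulr_sumr sum_x2y2 -exprMn divfK.
  by move=> i _; rewrite Px Py; ring.
have Pc mu : 0 <= mu < Rmaj -> core2 (P mu) = mu ^+ 2.
  by move=> h; rewrite /core2 /rcore (Prd _ h) Pt -[RHS]mulr1 -cE1; ring.
have cP : continuous P.
  have -> : P = fun mu => P 0 + mu *: (P 1 - P 0).
    apply/funext => x; apply/rowP => j; rewrite !mxE; case: ifP => _; ring.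
  move=> mu.
  exact: (cvgD (cvg_cst (P 0)) (@cvgZr_tmp _ _ _ _ _ _ _ (P 1 - P 0) (@cvg_id _ (nbhs mu)))).
exists (P rho).
  split; last first.
    move=> /interior_subset; rewrite /torus /= -/(rcore _) -/(core2 _) Pc ?ltxx//.
    by rewrite (ltW rho0).
  move=> B /(cP rho)[e /= e0 eB].
  (* [P rho] is approached from inside the torus. The term rho - e/2 brings [mu] close enough to
     rho, and rho/2 keeps it positive, as [Pc] requires 0 <= mu. *)
  pose mu := Num.max (rho / 2) (rho - e / 2).
  have mu1 : mu < rho by rewrite /mu gt_max; apply/andP; split; lra.
  have mu2 : rho - e < mu by rewrite /mu lt_max; apply/orP; right; lra.
  have mu0 : 0 < mu by rewrite /mu lt_max; apply/orP; left; lra.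
  exists (P mu); split; last first.
    by apply: eB; rewrite /ball_ /= ger0_norm ?subr_ge0 ?ltW//; lra.
  rewrite /torus /= -/(rcore _) -/(core2 _) Pc.
    by rewrite ltr_pXn2r ?nnegrE ?ltW.
  by apply/andP; split; lra.
have E : enorm (v - P rho) ^+ 2 = depth v ^+ 2.
  rewrite sqr_enorm dotE.
  rewrite (eq_bigr (fun i => (1 - (Rmaj + rho * c.1) / rd v) ^+ 2 * (xc v i ^+ 2 + yc v i ^+ 2))).
    rewrite -mulr_sumr sum_x2y2 -exprMn mulrBl mul1r divfK//.
    have -> : tc (v - P rho) = tc v - tc (P rho) by rewrite /tc !mxE.
    have -> : rd v = Rmaj + core v * c.1 by rewrite -cE2 /rcore; ring.
    by rewrite Pt cE3 /depth -[RHS]mulr1 -cE1; ring.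
  move=> i _; have := Px rho i; have := Py rho i; rewrite /xc /yc !mxE => -> ->; ring.
by apply/eqP; rewrite -(@eqrXn2 _ 2) ?sqrtr_ge0 ?(ltW (depth_gt0 Tv))//; apply/eqP.
Qed.

(** The Lipschitz bound gives the lower bound, as [core] equals rho on the boundary; the end of the
    ray attains it. *)
Lemma dist_boundary_torus v : T v -> dist_boundary T v = depth v.
Proof.
move=> Tv; have [w bw ew] := ray_to_boundary Tv.
have lb : lbound [set enorm (v - w) | w in boundary T] (depth v).
  move=> _ [w' bw' <-]; have cw := boundary_torus bw'.
  have := @core_lipschitz v w' (torus_radius_gt0 Tv) (radius_pos _).
  by rewrite cw lexx /depth => /(_ isT); lra.
apply/eqP; rewrite eq_le; apply/andP; split.
  by rewrite -ew; apply: ge_inf; [exists (depth v)|exists w].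
by apply: lb_le_inf => //; exists (enorm (v - w)); exists w.
Qed.

End torus_geometry.

Section local_maximum.
Context {R : realType} (m : nat).
Implicit Types (f : 'rV[R]_m -> R).

(* If the difference quotient has no limit, the derivative is the default
   value of [lim], which is 0 as well. *)
Lemma partial_local_max f (j : 'I_m) v :
  (\forall w \near v, f w <= f v) -> partial j f v = 0.
Proof.
move=> fv; rewrite /partial /derive -/(dir j).
set F := (fun h : R => _).
have [cF|] := pselect (cvg (F @ 0^')); last by move/dvgP.
have cF' : F @ 0^' --> lim (F @ 0^') by [].
have nearF : \forall h \near (0 : R), f (h *: dir j + v) <= f v.
  have cl : (fun h : R => h *: dir j + v) @ (0 : R) --> v.
    have := cvgD (@cvgZr_tmp _ _ _ _ _ _ _ (dir j) (@cvg_id _ (nbhs (0 : R)))) (cvg_cst v).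
    by rewrite scale0r add0r; apply.
  exact: (cl _ fv).
apply/eqP; rewrite eq_le; apply/andP; split.
- have cR := cvg_dnbhs_at_right cF'.
  rewrite -[leLHS](cvg_lim _ cR)//; apply: limr_le; first by apply/cvg_ex; exists (lim (F @ 0^')).
  near=> h; rewrite /F /=; have h0 : 0 < h by near: h; exact: nbhs_right_gt.
  rewrite /GRing.scale/= pmulr_rle0 ?invr_gt0// subr_le0.
  by near: h; apply: cvg_within; exact: nearF.
- have cL := cvg_dnbhs_at_left cF'.
  rewrite -[leRHS](cvg_lim _ cL)//; apply: limr_ge; first by apply/cvg_ex; exists (lim (F @ 0^')).
  near=> h; rewrite /F /=; have h0 : h < 0 by near: h; exact: nbhs_left_lt.
  rewrite /GRing.scale/= nmulr_rge0 ?invr_lt0// subr_le0.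
  by near: h; apply: cvg_within; exact: nearF.
Unshelve. all: by end_near. Qed.

End local_maximum.

(** * The horizontal gradient of the distance *)

Section distance_gradient.
Context {R : realType} (n : nat) (Rmaj rho : R).
Hypothesis rho0 : 0 < rho.
Hypothesis rhoR : rho < Rmaj.
Notation V := 'rV[R]_(n + n + 1).
Implicit Types (f g psi : V -> R) (K U : set V) (v w : V) (i : 'I_n).
Notation rd := (@radius R n).
Notation T := (torus n Rmaj rho).
Notation T' := (@cut_torus R n Rmaj rho).
Notation d := (dist_boundary T).
Notation a := (rcore Rmaj).
Notation t := (@tc R n).
Notation sg := (core2 Rmaj).
Notation s := (core Rmaj).

Lemma dist_near v : T v -> \forall w \near v, depth Rmaj rho w = d w.
Proof.
move=> Tv; apply: (open_near (U := T)) => //; first exact: open_torus.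
by move=> w Tw; exact/esym/(dist_boundary_torus rho0 rhoR).
Qed.

(** The formulas persist on the core: there [depth] is maximal, so all its partial derivatives take
    the value 0, and the right-hand sides are 0 because they divide by [s v] = 0. *)
Lemma dist_partial v : T v ->
  [/\ forall i, partial (xidx i) d v = - (a v / s v) * xc v i / rd v,
      forall i, partial (yidx i) d v = - (a v / s v) * yc v i / rd v
    & partial (tidx n) d v = - (t v / s v)].
Proof.
move=> Tv; have P j := partial_near j (dist_near Tv).
have [s0|s0] := eqVneq (s v) 0; last first.
  have Uv : T' v.
    apply/andP; split => //; rewrite -(sqr_core Rmaj v) exprn_gt0//.
    by rewrite lt_neqAle eq_sym s0 core_ge0.
  have [h1 h2 h3] := axi_depth rho0 rhoR Uv.
  split => [i|i|]; rewrite -P.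
  - exact: partialE (h1 i).
  - exact: partialE (h2 i).
  - exact: partialE h3.
have M j : partial j d v = 0.
  rewrite -P; apply: partial_local_max; near=> w.
  by rewrite /depth s0 lerD2l lerN2 core_ge0.
by split => [i|i|]; rewrite M s0 invr0 mulr0 oppr0 ?mul0r.
Unshelve. all: by end_near. Qed.

(** When X_i and Y_i are expanded, the products of an (x, y)-derivative of [psi] with the
    t-derivative of [f] add up to [swirl psi], those of two t-derivatives to 4 r^2, and those of the
    t-derivative of [psi] with (x, y)-derivatives of [f] cancel, [f] being axisymmetric at [v]. *)
Lemma hdot_axi f psi fr ft v : 0 < rd v ->
  (forall i, partial (xidx i) f v = fr * xc v i / rd v) ->
  (forall i, partial (yidx i) f v = fr * yc v i / rd v) ->
  partial (tidx n) f v = ft ->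
  dot (hgrad f v) (hgrad psi v) = fr / rd v * euler psi v
    + 2 * ft * swirl psi v + 4 * rd v ^+ 2 * ft * partial (tidx n) psi v.
Proof.
move=> r0 fx fy fT; have rn : rd v != 0 by rewrite gt_eqF.
rewrite /dot big_split_ord/= /hgrad.
rewrite (eq_bigr (fun i => Xfield i f v * Xfield i psi v)); last first.
  by move=> i _; rewrite !row_mxEl !mxE.
rewrite [X in _ + X](eq_bigr (fun i => Yfield i f v * Yfield i psi v)); last first.
  by move=> i _; rewrite !row_mxEr !mxE.
rewrite -big_split/= (eq_bigr (fun i =>
  fr / rd v * (xc v i * partial (xidx i) psi v + yc v i * partial (yidx i) psi v)
  + 2 * ft * (yc v i * partial (xidx i) psi v - xc v i * partial (yidx i) psi v)
  + (xc v i ^+ 2 + yc v i ^+ 2) * (4 * ft * partial (tidx n) psi v))); last first.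
  move=> i _; rewrite /Xfield /Yfield fx fy fT.
  move: (xc v i) (yc v i) (partial (xidx i) psi v) (partial (yidx i) psi v)
    (partial (tidx n) psi v) => x y px py pt.
  by field.
rewrite !big_split/= -!mulr_sumr -mulr_suml sum_x2y2 -/(euler psi v) -/(swirl psi v).
by ring.
Qed.

(** The numerator of |hgrad d|^2 over the denominator [core2]. *)
Definition gradnum v : R := a v ^+ 2 + 4 * rd v ^+ 2 * t v ^+ 2.

Lemma gradnum_ge0 v : 0 <= gradnum v.
Proof. by rewrite addr_ge0 ?sqr_ge0// mulr_ge0 ?sqr_ge0// mulr_ge0// sqr_ge0. Qed.

Lemma dot_dist psi v : T v -> dot (hgrad d v) (hgrad psi v) =
  - (s v)^-1 * (a v / rd v * euler psi v + 2 * t v * swirl psi v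
      + 4 * rd v ^+ 2 * t v * partial (tidx n) psi v).
Proof.
move=> Tv; have [h1 h2 h3] := dist_partial Tv.
rewrite (hdot_axi _ (torus_radius_gt0 rho0 rhoR Tv) h1 h2 h3); ring.
Qed.

Lemma dot_dist_dist v : T v -> dot (hgrad d v) (hgrad d v) = gradnum v / sg v.
Proof.
move=> Tv; have r0 := torus_radius_gt0 rho0 rhoR Tv.
have rn : rd v != 0 by rewrite gt_eqF.
have [h1 h2 h3] := dist_partial Tv.
rewrite (hdot_axi _ r0 h1 h2 h3) h3 /euler /swirl.
rewrite (eq_bigr (fun i => (xc v i ^+ 2 + yc v i ^+ 2) * (- (a v / s v) / rd v))); last first.
  by move=> i _; rewrite h1 h2; ring.
rewrite [X in 2 * _ * X]big1 => [|i _]; last by rewrite h1 h2; ring.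
rewrite -mulr_suml sum_x2y2 -(sqr_core Rmaj v) /gradnum.
have [s0|s0] := eqVneq (s v) 0; last by field; rewrite rn s0.
by rewrite s0 expr0n invr0 !(mulr0, oppr0, mul0r, addr0).
Qed.

Lemma enorm_dist v (c : R) : T v -> enorm (hgrad d v) `^ c = (gradnum v / sg v) `^ (c / 2).
Proof.
move=> Tv; rewrite /enorm dot_dist_dist// -powR12_sqrt; last first.
  by rewrite divr_ge0 ?gradnum_ge0 ?core2_ge0.
by rewrite -powRrM (mulrC 2^-1).
Qed.

End distance_gradient.

(** * The p-Laplacian of the distance off the core *)

Section gradient_tools.
Context {R : realType}.

Lemma dotC m (u v : 'rV[R]_m) : dot u v = dot v u.
Proof. by apply: eq_bigr => i _; rewrite mulrC. Qed.

Lemma dotDr m (u v w : 'rV[R]_m) : dot u (v + w) = dot u v + dot u w.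
Proof. by rewrite /dot -big_split; apply: eq_bigr => i _; rewrite mxE mulrDr. Qed.

Lemma dotZr m (u v : 'rV[R]_m) c : dot u (c *: v) = c * dot u v.
Proof. by rewrite /dot mulr_sumr; apply: eq_bigr => i _; rewrite mxE; ring. Qed.

Lemma enormZ m (c : R) (z : 'rV[R]_m) : enorm (c *: z) = `|c| * enorm z.
Proof.
rewrite /enorm dotZr dotC dotZr mulrA -expr2 sqrtrM ?sqr_ge0//.
by rewrite sqrtr_sqr.
Qed.

Lemma enorm0_eq m (u : 'rV[R]_m) : enorm u = 0 -> u = 0.
Proof.
move=> u0; apply/rowP => i; rewrite mxE; apply/eqP; rewrite -sqrf_eq0 expr2.
have := sqr_enorm u; rewrite u0 expr0n => /esym/eqP.
rewrite psumr_eq0 => [/allP /(_ i)|j _]; last by rewrite -expr2 sqr_ge0.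
by rewrite mem_index_enum => /(_ isT).
Qed.

Lemma dot_le_enorm m (u v : 'rV[R]_m) : dot u v <= enorm u * enorm v.
Proof.
have [v0|v0] := eqVneq (enorm v) 0.
  by rewrite (enorm0_eq v0) /dot big1 ?mulr_ge0 ?enorm_ge0// => i _; rewrite mxE mulr0.
have vp : 0 < enorm v by rewrite lt_neqAle eq_sym v0 enorm_ge0.
have := dot_ge0 (enorm v *: u + (- enorm u) *: v).
rewrite dotDr dotC dotDr [X in _ + X]dotC dotDr !dotZr !(dotC (_ *: _)) !dotZr.
rewrite -!sqr_enorm (dotC v u) => h.
have [u0|u0] := eqVneq (enorm u) 0.
  rewrite (enorm0_eq u0) /dot big1 ?mulr_ge0 ?enorm_ge0// => i _.
  by rewrite mxE mul0r.
have up : 0 < enorm u by rewrite lt_neqAle eq_sym u0 enorm_ge0.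
have uv := mulr_gt0 up vp.
rewrite -(ler_pM2l uv); nra.
Qed.

Lemma young (p a b : R) : 1 < p -> 0 <= a -> 0 <= b ->
  p * (a `^ (p - 1) * b) <= b `^ p + (p - 1) * a `^ p.
Proof.
move=> p1 a0 b0; have p0 : 0 < p by rewrite (lt_trans ltr01).
have pB : 0 < p - 1 by rewrite subr_gt0.
have q0 : 0 < p / (p - 1) by rewrite divr_gt0.
have pq : p^-1 + (p / (p - 1))^-1 = 1 by field; rewrite !gt_eqF.
have := conjugate_powR b0 (powR_ge0 a (p - 1)) p0 q0 pq.
rewrite -powRrM mulrCA divff ?gt_eqF// mulr1 => h.
have := ler_wpM2l (ltW p0) h; rewrite mulrDr (mulrC b).
have -> : p * (b `^ p / p) = b `^ p by field; rewrite gt_eqF.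
have -> : p * (a `^ p / (p / (p - 1))) = (p - 1) * a `^ p by field; rewrite !gt_eqF.
by [].
Qed.

Lemma powR_bounds (c1 c2 e : R) : 0 < c1 ->
  exists2 k : R * R, 0 < k.1 & forall x, c1 <= x <= c2 -> k.1 <= x `^ e <= k.2.
Proof.
move=> c10; have [e0|e0] := leP 0 e.
  exists (c1 `^ e, c2 `^ e); first exact: powR_gt0.
  move=> x /andP[x1 x2] /=.
  have x0 := lt_le_trans c10 x1; have c20 := lt_le_trans x0 x2.
  by apply/andP; split; apply: (ge0_ler_powR e0); rewrite ?nnegrE// ltW.
have [c12|c12] := leP c1 c2; last first.
  exists (1, 1) => // x /andP[x1 x2].
  by have := lt_le_trans c12 (le_trans x1 x2); rewrite ltxx.
exists (c2 `^ e, c1 `^ e); first by rewrite powR_gt0// (lt_le_trans c10).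
move=> x /andP[x1 x2] /=.
have x0 := lt_le_trans c10 x1; have c20 := lt_le_trans x0 x2.
have H (y z : R) : 0 < y -> y <= z -> z `^ e <= y `^ e.
  move=> y0 yz; have z0 := lt_le_trans y0 yz.
  have E u : u `^ e = (u `^ (- e))^-1 by rewrite powRN invrK.
  rewrite !E lef_pV2 ?posrE ?powR_gt0//.
  have eN : 0 <= - e by rewrite oppr_ge0 ltW.
  by apply: (ge0_ler_powR eN); rewrite ?nnegrE// ltW.
by rewrite !H.
Qed.

Context (n : nat).
Notation V := 'rV[R]_(n + n + 1).
Implicit Types (f g psi : V -> R) (K U : set V) (v w : V) (i : 'I_n).

Lemma hgrad_mul f g v : (forall j, derivable f v (dir j)) ->
  (forall j, derivable g v (dir j)) ->
  hgrad (fun w => f w * g w) v = f v *: hgrad g v + g v *: hgrad f v.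
Proof.
move=> df dg.
have E j : partial j (fun w => f w * g w) v = f v * partial j g v + g v * partial j f v.
  by rewrite /partial deriveM//; [exact: df|exact: dg].
have ring_step (x y p1 p2 q1 q2 c : R) :
  x * p1 + y * p2 + c * (x * q1 + y * q2) = x * (p1 + c * q1) + y * (p2 + c * q2) by ring.
apply/rowP => j; rewrite !mxE; case: splitP => k _; rewrite !mxE /Xfield /Yfield !E.
  exact: ring_step.
by rewrite -!mulNr; exact: ring_step.
Qed.

Lemma hgrad_comp f (Phi : R -> R) (P : R) v : (forall j, derivable f v (dir j)) ->
  is_derive (f v) 1 Phi P -> hgrad (fun w => Phi (f w)) v = P *: hgrad f v.
Proof.
move=> df dP.
have E j : partial j (fun w => Phi (f w)) v = P * partial j f v.
  exact: partialE (is_derive_comp1 dP (is_derive_partial (df j))).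
have ring_step (x p q c : R) : x * p + c * (x * q) = x * (p + c * q) by ring.
apply/rowP => j; rewrite !mxE; case: splitP => k _; rewrite !mxE /Xfield /Yfield !E.
  exact: ring_step.
by rewrite -!mulNr; exact: ring_step.
Qed.

Lemma hgrad_near f g v : (\forall w \near v, f w = g w) -> hgrad f v = hgrad g v.
Proof.
move=> fg; have E j := partial_near j fg.
by apply/rowP => j; rewrite !mxE; case: splitP => k _; rewrite !mxE /Xfield /Yfield !E.
Qed.

Lemma hgrad_outside f K v : closed K -> (forall w, ~ K w -> f w = 0) -> ~ K v ->
  hgrad f v = 0.
Proof.
move=> cK f0 Kv; apply/rowP => j; rewrite mxE; case: splitP => k _; rewrite !mxE;
by rewrite /Xfield /Yfield !(partial_outside _ cK f0 Kv) !mulr0 ?addr0 ?subr0.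
Qed.

Lemma euler_outside psi K v : closed K -> (forall w, ~ K w -> psi w = 0) -> ~ K v ->
  euler psi v = 0.
Proof.
move=> cK p0 Kv; rewrite /euler big1// => i _.
by rewrite !(partial_outside _ cK p0 Kv) !mulr0 addr0.
Qed.

Lemma swirl_outside psi K v : closed K -> (forall w, ~ K w -> psi w = 0) -> ~ K v ->
  swirl psi v = 0.
Proof.
move=> cK p0 Kv; rewrite /swirl big1// => i _.
by rewrite !(partial_outside _ cK p0 Kv) !mulr0 subr0.
Qed.

Lemma dot0r m (u : 'rV[R]_m) : dot u 0 = 0.
Proof. by rewrite /dot big1// => i _; rewrite mxE mulr0. Qed.

Lemma enorm0 m : enorm (0 : 'rV[R]_m) = 0.
Proof. by rewrite /enorm dot0r sqrtr0. Qed.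

Lemma test_functionP (A : set V) f : test_function A f ->
  exists K, [/\ compact K, closed K, K `<=` A, forall v, ~ K v -> f v = 0 & forall k, Ck k setT f].
Proof.
move=> [/smoothP sf cK KA]; exists (closure [set v | f v != 0]); split => //.
- exact: closed_closure.
- move=> v Kv; apply/eqP/negPn/negP => fv; apply: Kv.
  exact: subset_closure.
Qed.

Lemma tame_powR f (q : R) : 0 < q -> (forall v, 0 <= f v) -> tame f ->
  tame (fun v => f v `^ q).
Proof.
move=> q0 f0 [mf [M [B fM]]]; split.
  by apply: (measurableT_comp (measurable_powR q)).
exists (M `^ q), B => v; split.
  have [+ _] := fM v; rewrite ger0_norm// => fv.
  rewrite ger0_norm ?powR_ge0//; apply: (ge0_ler_powR (ltW q0)); rewrite ?nnegrE//.
  by rewrite (le_trans _ fv).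
by move=> /(fM v).2 ->; rewrite powR0// gt_eqF.
Qed.

Lemma hgrad_tame f K : Ck 1 setT f -> compact K -> (forall v, ~ K v -> f v = 0) ->
  tame (fun v => enorm (hgrad f v)).
Proof.
move=> cf cK f0.
have clK : closed K by apply: compact_closed => //; exact: norm_hausdorff.
apply: (continuous_tame _ cK); last first.
  by move=> v Kv; rewrite (hgrad_outside clK f0 Kv) enorm0.
have E : (fun v => enorm (hgrad f v)) = (@Num.sqrt R) \o
    (fun v => \sum_i Xfield i f v ^+ 2 + \sum_i Yfield i f v ^+ 2).
  apply/funext => v; rewrite /enorm/= /dot big_split_ord/=; congr (Num.sqrt (_ + _)).
    by apply: eq_bigr => i _; rewrite !row_mxEl !mxE expr2.
  by apply: eq_bigr => i _; rewrite !row_mxEr !mxE expr2.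
rewrite E => v; apply: continuous_comp; last exact: sqrt_continuous.
have oT := @openT V; have cp j := Ck_partial j cf.
have H : Ck 0 setT (fun v => \sum_i Xfield i f v ^+ 2 + \sum_i Yfield i f v ^+ 2).
  apply: CkD => //; apply: Ck_sum => // i; apply: CkX => //.
    apply: CkD => //; apply: CkM => //; apply: CkM; [exact: oT|exact: Ck_cst|exact: Ck_yc].
  apply: CkB => //; apply: CkM => //; apply: CkM; [exact: oT|exact: Ck_cst|exact: Ck_xc].
exact: (Ck_continuous H).
Qed.

Lemma euler_Ck k U psi : open U -> Ck k.+1 setT psi -> Ck k U (euler psi).
Proof.
move=> oU cp; have cj j : Ck k U (partial j psi).
  by apply: (CkW (U := setT)) => //; exact: Ck_partial.
by apply: Ck_sum => // i; apply: CkD => //; apply: CkM => //; [exact: Ck_xc|exact: Ck_yc].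
Qed.

Lemma swirl_Ck k U psi : open U -> Ck k.+1 setT psi -> Ck k U (swirl psi).
Proof.
move=> oU cp; have cj j : Ck k U (partial j psi).
  by apply: (CkW (U := setT)) => //; exact: Ck_partial.
by apply: Ck_sum => // i; apply: CkB => //; apply: CkM => //; [exact: Ck_yc|exact: Ck_xc].
Qed.

Lemma continuous_patch_measurable U f : open U -> (forall v, U v -> {for v, continuous f}) ->
  measurable_fun setT (f \_ U).
Proof.
move=> oU cf; apply/(measurable_restrictT _ (open_rV_measurable oU)).
exact: continuous_rV_measurable.
Qed.

Lemma integ_patch U f : measurable U -> tame (f \_ U) ->
  (\int[lebesgue_rV (n + n + 1)]_(v in U) (f v)%:E = (integ (f \_ U))%:E)%E.
Proof.
by move=> mU tf; rewrite integral_mkcond (integE tf) restrict_EFin.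
Qed.

End gradient_tools.

(** * The sign of the p-Laplacian away from the core *)

Section superharmonic.
Context {R : realType} (n : nat) (Rmaj rho p : R).
Hypothesis rho0 : 0 < rho.
Hypothesis rhoR : rho < Rmaj.
Hypothesis p1 : 1 < p.
Hypothesis n1 : (1 <= n)%N.
Hypothesis cube_cond : (2 * n%:R - 1) * rho <= 4 * (Rmaj - rho) ^+ 3.
Hypothesis lin_cond : (2 * n%:R + p - 3) * rho <= Rmaj - rho.
Notation V := 'rV[R]_(n + n + 1).
Implicit Types (f g psi : V -> R) (K U : set V) (v w : V) (i : 'I_n).
Notation rd := (@radius R n).
Notation T := (torus n Rmaj rho).
Notation T' := (@cut_torus R n Rmaj rho).
Notation d := (dist_boundary T).
Notation a := (rcore Rmaj).
Notation t := (@tc R n).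
Notation sg := (core2 Rmaj).
Notation s := (core Rmaj).
Notation N := (gradnum Rmaj).

Lemma axi_powR U f fr ft (c : R) : (forall v, U v -> 0 < f v) -> axi U f fr ft ->
  axi U (fun v => f v `^ c) (fun v => c * f v `^ c * (fr v / f v))
    (fun v => c * f v `^ c * (ft v / f v)).
Proof.
move=> f0 af.
have dP v : U v -> is_derive (f v) 1 (@powR R ^~ c) (c * f v `^ (c - 1)).
  by move=> Uv; exact: is_derive1_powR (f0 _ Uv).
have E v : U v -> f v `^ (c - 1) = f v `^ c / f v.
  move=> Uv; have fv := f0 v Uv; rewrite powRB ?(gt_eqF fv) ?implybT//.
  by rewrite powRr1// ltW.
apply: (axi_eq (axi_comp (Phi' := fun x => c * x `^ (c - 1)) dP af)) => v Uv;
by rewrite /= E//; ring.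
Qed.

Lemma axi_inv U f fr ft : (forall v, U v -> 0 < f v) -> axi U f fr ft ->
  axi U (fun v => (f v)^-1) (fun v => - fr v / f v ^+ 2) (fun v => - ft v / f v ^+ 2).
Proof.
move=> f0 af.
have dP v : U v -> is_derive (f v) 1 (fun x : R => x^-1) (- (f v) ^- 2).
  move=> Uv; have x0' : id (f v) != 0 by rewrite /= gt_eqF// f0.
  apply: (is_derive_congr (is_deriveV x0' (is_derive_id (f v) (1:R)))).
  by rewrite /= [_ *: _]mulr1.
by apply: (axi_eq (axi_comp (Phi' := fun x => - x ^- 2) dP af)) => v Uv /=; ring.
Qed.

Let r0 v : T' v -> 0 < rd v.
Proof. by move=> /cut_torusS; exact: (torus_radius_gt0 rho0 rhoR). Qed.

Let sg0 v : T' v -> 0 < sg v.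
Proof. by move=> /andP[]. Qed.

Lemma gradnum_gt0 v : T' v -> 0 < N v.
Proof.
move=> Uv; have := sg0 Uv; have := r0 Uv; rewrite /core2 /gradnum => r1 sp.
have [a0|a0] := eqVneq (a v) 0.
  move: sp; rewrite a0 expr0n !add0r => tp.
  by rewrite (mulr_gt0 (mulr_gt0 _ (exprn_gt0 2 r1))) ?ltr0n.
rewrite ltr_pwDl//; first by rewrite lt_neqAle eq_sym sqrf_eq0 a0 sqr_ge0.
by rewrite mulr_ge0 ?sqr_ge0// mulr_ge0// sqr_ge0.
Qed.

Lemma axi_gradnum : axi T' N (fun v => 2 * a v + 8 * rd v * t v ^+ 2)
  (fun v => 8 * rd v ^+ 2 * t v).
Proof.
have aa := @axi_rcore R n Rmaj rho rho0 rhoR; have at_ := @axi_t R n T'.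
have ar := axi_r r0; have a4 := @axi_cst R n T' 4.
have := axiD (axiM aa aa) (axiM (axiM a4 (axiM ar ar)) (axiM at_ at_)).
have -> : (fun v => a v * a v + cst 4 v * (rd v * rd v) * (t v * t v)) = N.
  by apply/funext => v; rewrite /gradnum /=; ring.
by move/axi_eq; apply => v _ /=; ring.
Qed.

Lemma Ck_rd k : Ck k T' rd.
Proof. by apply: Ck_radius => //; exact: open_cut_torus. Qed.

Lemma Ck_gradnum k : Ck k T' N.
Proof.
have oU := @open_cut_torus R n Rmaj rho.
have ca : Ck k T' (fun v => a v ^+ 2) by apply: CkX => //; exact: Ck_rcore.
apply: CkD => //; apply: CkM => //; last by apply: CkX => //; exact: Ck_tc.
by apply: CkM => //; [exact: Ck_cst|apply: CkX => //; exact: Ck_rd].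
Qed.

(* |grad d|^(p-2) / s, so that |grad d|^(p-2) grad d is
   - weight * (a (x, y) / r + 2 t (y, -x)). *)
Definition weight v : R := N v `^ ((p - 2) / 2) * sg v `^ ((1 - p) / 2).

Definition weight_r v : R := weight v * ((p - 2) / 2 * (2 * a v + 8 * rd v * t v ^+ 2) / N v
   + (1 - p) / 2 * (2 * a v) / sg v).
Definition weight_t v : R := weight v * ((p - 2) / 2 * (8 * rd v ^+ 2 * t v) / N v
   + (1 - p) / 2 * (2 * t v) / sg v).

Lemma axi_weight : axi T' weight weight_r weight_t.
Proof.
have := axiM (axi_powR ((p - 2) / 2) gradnum_gt0 axi_gradnum)
  (axi_powR ((1 - p) / 2) sg0 (@axi_core2 R n Rmaj rho rho0 rhoR)).
by move/axi_eq; apply => v _; rewrite /weight_r /weight_t /weight; ring.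
Qed.

Lemma Ck_weight k : Ck k T' weight.
Proof.
have oU := @open_cut_torus R n Rmaj rho.
apply: CkM => //; apply: Ck_powR => //.
- exact: gradnum_gt0.
- exact: Ck_gradnum.
- exact: Ck_core2.
Qed.

Lemma weight_ge0 v : 0 <= weight v.
Proof. by rewrite mulr_ge0 ?powR_ge0. Qed.

Lemma weightE v : T' v -> enorm (hgrad d v) `^ (p - 2) = weight v * s v.
Proof.
move=> Uv; have c0 := cut_core_gt0 Uv.
rewrite (enorm_dist rho0 rhoR _ (cut_torusS Uv)) /weight.
rewrite powRM ?invr_ge0 ?(ltW (sg0 Uv)) ?(ltW (gradnum_gt0 Uv))//.
rewrite -mulrA; congr (_ * _).
rewrite /core -powR12_sqrt ?(ltW (sg0 Uv))// -powRD; last by rewrite (gt_eqF (sg0 Uv)) implybT.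
rewrite -powR_inv1 ?(ltW (sg0 Uv))// -powRrM; congr (_ `^ _).
by field.
Qed.

(** Here k = 2n-1, x = [rcore], y = [tc] and q = p. Regrouping isolates the brackets 4 r^3 + k x and
    r + (k+q-2) x, whose nonnegativity is what the last two hypotheses say; the rest is made of
    squares with nonnegative factors. *)
Lemma divergence_sign (k r x y q : R) : 1 <= k -> 0 < r -> 1 < q ->
  - x * k <= 4 * r ^+ 3 -> - x * (k + q - 2) <= r ->
  0 <= 4 * r ^+ 3 * (x ^+ 2 + y ^+ 2) ^+ 2
    + (q - 1) * r * x ^+ 2 * y ^+ 2 * (4 * r ^+ 2 - 1) ^+ 2
    + k * x * (x ^+ 2 + y ^+ 2) * (x ^+ 2 + 4 * r ^+ 2 * y ^+ 2)
    + (q - 2) * 4 * x * r ^+ 2 * y ^+ 2 * (x ^+ 2 + y ^+ 2).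
Proof.
move=> k1 r0' q1 h1 h2.
rewrite (_ : _ + _ = (x ^+ 2 + y ^+ 2) * (x ^+ 2 * (4 * r ^+ 3 + k * x)
    + 4 * r ^+ 2 * y ^+ 2 * (r + (k + q - 2) * x))
  + (q - 1) * r * (x * y * (4 * r ^+ 2 - 1)) ^+ 2); last by ring.
have e1 : 0 <= 4 * r ^+ 3 + k * x by lra.
have e2 : 0 <= r + (k + q - 2) * x by lra.
have e3 : 0 <= q - 1 by lra.
apply: addr_ge0; last exact: mulr_ge0 (mulr_ge0 e3 (ltW r0')) (sqr_ge0 _).
apply: mulr_ge0; first by rewrite addr_ge0 ?sqr_ge0.
apply: addr_ge0; first exact: mulr_ge0 (sqr_ge0 _) e1.
by apply: mulr_ge0 e2; apply: mulr_ge0 (sqr_ge0 _); apply: mulr_ge0 (sqr_ge0 _).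
Qed.

(** The left-hand side is the divergence 2n A + r A_r + C_t from [axi_div] for the field |hgrad
    d|^(p-2) hgrad d, in which A = - weight a / r and C = - 4 r^2 weight t. *)
Lemma p_laplacian_le0 v : T' v ->
  2 * n%:R * - (weight v * a v / rd v)
  + rd v * - (weight_r v * a v / rd v + weight v / rd v - weight v * a v / rd v ^+ 2)
  - 4 * rd v ^+ 2 * (weight_t v * t v + weight v) <= 0.
Proof.
move=> Uv; have rv := r0 Uv; have Nv := gradnum_gt0 Uv; have sv := sg0 Uv.
have w0 := weight_ge0 v.
have [rn Nn sn] : [/\ rd v != 0, N v != 0 & sg v != 0] by rewrite !gt_eqF.
rewrite /weight_r /weight_t.
have h0 := rho0; have hR := rhoR; have hp := p1; have hc := cube_cond; have hl := lin_cond.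
have k1 : 1 <= 2 * n%:R - 1 :> R.
  have nn : 1 <= n%:R :> R by rewrite ler1n.
  by lra.
have cv : s v <= rho by have := cut_torusS Uv; rewrite torusE// => /ltW.
have av : - a v <= rho by have := le_trans (rcore_le Rmaj v) cv; rewrite ler_norml => /andP[]; lra.
have rb : Rmaj - rho <= rd v by have /andP[] := radius_bounds cv.
(* Here and in [c2] the worst case is - a = rho and r = Rmaj - rho, where the claim becomes
   [cube_cond], respectively [lin_cond]. *)
have c1 : - a v * (2 * n%:R - 1) <= 4 * rd v ^+ 3.
  have : (Rmaj - rho) ^+ 3 <= rd v ^+ 3 by rewrite lerXn2r// nnegrE; lra.
  by have := ler_wpM2r (le_trans ler01 k1) av; lra.
have c2 : - a v * (2 * n%:R - 1 + p - 2) <= rd v.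
  have k2 : 0 <= 2 * n%:R - 1 + p - 2 by lra.
  by have := ler_wpM2r k2 av; lra.
have H := divergence_sign (t v) k1 rv hp c1 c2.
set P := (X in 0 <= X) in H.
have -> : 2 * n%:R * - (weight v * a v / rd v)
  + rd v * - (weight v * ((p - 2) / 2 * (2 * a v + 8 * rd v * t v ^+ 2) / N v
   + (1 - p) / 2 * (2 * a v) / sg v) * a v / rd v + weight v / rd v - weight v * a v / rd v ^+ 2)
  - 4 * rd v ^+ 2 * (weight v * ((p - 2) / 2 * (8 * rd v ^+ 2 * t v) / N v
   + (1 - p) / 2 * (2 * t v) / sg v) * t v + weight v)
  = - (weight v * P / (rd v * N v * sg v)).
  rewrite /P; move: Nn sn; rewrite /gradnum /core2 => Nn sn.
  by field; rewrite rn Nn sn.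
rewrite oppr_le0; apply: divr_ge0; first exact: mulr_ge0.
exact: ltW (mulr_gt0 (mulr_gt0 rv Nv) sv).
Qed.

(** The divergence theorem says that F + H psi has integral 0, where H is the divergence of the
    field. As H <= 0 on the support and psi >= 0, this integrand is at most F. *)
Lemma dist_superharmonic K psi : Ck 1 setT psi -> compact K -> K `<=` T' ->
  (forall v, ~ K v -> psi v = 0) -> (forall v, 0 <= psi v) ->
  let F v := enorm (hgrad d v) `^ (p - 2) * dot (hgrad d v) (hgrad psi v) in
  tame F /\ 0 <= integ F.
Proof.
move=> cp cK KU p0 pge F.
have clK : closed K by apply: compact_closed => //; exact: norm_hausdorff.
have oU := @open_cut_torus R n Rmaj rho.
pose A v := - (weight v * a v / rd v).
pose B v := - 2 * (weight v * t v).
pose C v := - 4 * (rd v * rd v * (weight v * t v)).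
have aa := @axi_rcore R n Rmaj rho rho0 rhoR; have at_ := @axi_t R n T'.
have ar := axi_r r0.
have aA : axi T' A (fun v => - (weight_r v * a v / rd v + weight v / rd v
    - weight v * a v / rd v ^+ 2)) (fun v => - (weight_t v * a v / rd v)).
  have h := axiM (@axi_cst R n T' (-1)) (axiM (axiM axi_weight aa) (axi_inv r0 ar)).
  have E : (fun v => cst (-1) v * (weight v * a v * (rd v)^-1)) = A.
    by apply/funext => v; rewrite /A /= mulN1r.
  rewrite E in h; apply: (axi_eq h) => v Uv /=;
    have rn : rd v != 0 by rewrite gt_eqF// r0.
  - by field.
  - by field.
have aB := axiM (@axi_cst R n T' (-2)) (axiM axi_weight at_).
have aC : axi T' C (fun v => - 4 * (2 * rd v * weight v * t v + rd v ^+ 2 * weight_r v * t v))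
    (fun v => - 4 * rd v ^+ 2 * (weight_t v * t v + weight v)).
  have h := axiM (@axi_cst R n T' (-4)) (axiM (axiM ar ar) (axiM axi_weight at_)).
  by apply: (axi_eq h) => v Uv /=; ring.
have cw := Ck_weight 1; have ca := @Ck_rcore R n Rmaj rho rho0 rhoR 1.
have ct := @Ck_tc R n 1 T'; have cr := Ck_rd 1.
have cA : Ck 1 T' A := CkN oU (CkM oU (CkM oU cw ca) (Ck_inv oU r0 cr)).
have cB : Ck 1 T' B := CkM oU (Ck_cst 1 T' (-2)) (CkM oU cw ct).
have cC : Ck 1 T' C := CkM oU (Ck_cst 1 T' (-4)) (CkM oU (CkM oU cr cr) (CkM oU cw ct)).
have [tI I0] := axi_div oU r0 aA aB aC cA cB cC cp cK KU p0.
set I := (fun v => _) in tI I0.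
pose H v := 2 * n%:R * A v + rd v * - (weight_r v * a v / rd v + weight v / rd v
    - weight v * a v / rd v ^+ 2) + (- 4 * rd v ^+ 2 * (weight_t v * t v + weight v)).
pose F0 v := A v * euler psi v + B v * swirl psi v + C v * partial (tidx n) psi v.
have F0z v : ~ K v -> F0 v = 0.
  move=> Kv; rewrite /F0 (euler_outside clK p0 Kv) (swirl_outside clK p0 Kv).
  by rewrite (partial_outside _ clK p0 Kv) !mulr0 !addr0.
have FE : F = F0.
  apply/funext => v; have [Kv|Kv] := pselect (K v); last first.
    by rewrite F0z// /F (hgrad_outside clK p0 Kv) dot0r mulr0.
  have Uv := KU _ Kv; have c0 := cut_core_gt0 Uv.
  rewrite /F /F0 (dot_dist rho0 rhoR psi (cut_torusS Uv)) (weightE Uv) /A /B /C.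
  have rn : rd v != 0 by rewrite gt_eqF// r0.
  have sn : s v != 0 by rewrite gt_eqF.
  by field; rewrite rn sn.
have IE v : I v = F v + H v * psi v by rewrite FE.
have FI v : I v <= F v.
  rewrite IE gerDl; have [Kv|Kv] := pselect (K v); last by rewrite p0// mulr0.
  rewrite mulr_le0_ge0//; have := p_laplacian_le0 (KU _ Kv).
  by rewrite /H /A; apply: le_trans; rewrite le_eqVlt; apply/orP; left; apply/eqP; ring.
have tF : tame F.
  have c0 : Ck 0 T' F0.
    have cpj j : Ck 0 T' (partial j psi) := CkW (@subsetT _ T') (Ck_partial j cp).
    have ce := euler_Ck oU cp; have cs := swirl_Ck oU cp.
    exact: (CkD oU (CkD oU (CkM oU (CkS cA) ce) (CkM oU (CkS cB) cs)) (CkM oU (CkS cC) (cpj _))).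
  rewrite FE; apply: (continuous_tame _ cK F0z) => v.
  exact: (Ck_continuous (Ck_glue cK oU KU F0z c0)).
by split => //; rewrite -I0; exact: le_integ.
Qed.

End superharmonic.

(** * Gradient bounds and the cutoff near the core *)

Section cutoff.
Context {R : realType} (n : nat) (Rmaj rho : R).
Hypothesis rho0 : 0 < rho.
Hypothesis rhoR : rho < Rmaj.
Notation V := 'rV[R]_(n + n + 1).
Implicit Types (f g psi : V -> R) (K U : set V) (v w : V) (i : 'I_n).
Notation rd := (@radius R n).
Notation T := (torus n Rmaj rho).
Notation T' := (@cut_torus R n Rmaj rho).
Notation d := (dist_boundary T).
Notation a := (rcore Rmaj).
Notation t := (@tc R n).
Notation sg := (core2 Rmaj).
Notation s := (core Rmaj).
Notation N := (gradnum Rmaj).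

(** The quotient is the mean of 1 and 4 r^2 with weights a^2 / core2 and t^2 / core2. The positive
    lower bound makes every real power of |hgrad d| bounded off the core. *)
Lemma gradient_bounds v : T' v ->
  Num.min 1 (4 * (Rmaj - rho) ^+ 2) <= N v / sg v <= 1 + 4 * (Rmaj + rho) ^+ 2.
Proof.
move=> Uv; have sv : 0 < sg v by case/andP: Uv.
have h0 := rho0; have hR := rhoR.
have cv : s v <= rho by have := cut_torusS Uv; rewrite torusE// => /ltW.
have /andP[r1 r2] := radius_bounds cv.
have q1 : (Rmaj - rho) ^+ 2 <= rd v ^+ 2 by rewrite lerXn2r ?nnegrE; lra.
have q2 : rd v ^+ 2 <= (Rmaj + rho) ^+ 2 by rewrite lerXn2r ?nnegrE; lra.
have a0 := sqr_ge0 (a v); have t0 := sqr_ge0 (t v).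
rewrite ler_pdivlMr// ler_pdivrMr// /gradnum /core2; apply/andP; split.
  set m := Num.min _ _.
  have m1 : m <= 1 by rewrite ge_min lexx.
  have m2 : m <= 4 * rd v ^+ 2 by rewrite ge_min; apply/orP; right; lra.
  by rewrite mulrDr; apply: lerD; [rewrite ler_piMl|exact: ler_wpM2r].
rewrite mulrDr; apply: lerD; first by rewrite ler_peMl//; have := sqr_ge0 (Rmaj + rho); lra.
by apply: ler_wpM2r => //; lra.
Qed.

Lemma enorm_dist_powR_bounds (c : R) :
  exists2 k : R * R, 0 < k.1 & forall v, T' v -> k.1 <= enorm (hgrad d v) `^ c <= k.2.
Proof.
have m0 : 0 < Num.min 1 (4 * (Rmaj - rho) ^+ 2).
  rewrite lt_min ltr01/= mulr_gt0// exprn_gt0// subr_gt0; exact: rhoR.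
have [k k0 H] := powR_bounds (1 + 4 * (Rmaj + rho) ^+ 2) (c / 2) m0.
exists k => // v Uv; rewrite (enorm_dist rho0 rhoR _ (cut_torusS Uv)).
exact/H/gradient_bounds.
Qed.

Lemma enorm_dist_gt0 v : T' v -> 0 < enorm (hgrad d v).
Proof.
move=> Uv; have [k k0 /(_ _ Uv)/andP[h _]] := enorm_dist_powR_bounds 1.
by have := lt_le_trans k0 h; rewrite powRr1// enorm_ge0.
Qed.

Lemma hgrad_dist_core v : T v -> ~ T' v -> hgrad d v = 0.
Proof.
move=> Tv nU; apply: enorm0_eq; rewrite /enorm (dot_dist_dist rho0 rhoR Tv).
have -> : sg v = 0; last by rewrite invr0 mulr0 sqrtr0.
apply/eqP/negPn/negP => s0; apply: nU; apply/andP; split => //.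
by rewrite lt_neqAle eq_sym s0 core2_ge0.
Qed.

(* (1 - e / core2)_+ ^ 2; it vanishes near the core, junk value included. *)
Definition cutoff (e : R) v : R := sqpos (sg v - e) * (sg v `^ 2)^-1.

(** The derivative of ((x - e)_+ / x)^2 with respect to x, in a form that shows its sign. *)
Definition cutoff' (e x : R) : R :=
  2 * Num.max 0 (x - e) * (x - Num.max 0 (x - e)) / x ^+ 3.

Lemma cutoffE e v : cutoff e v = sqpos (sg v - e) / sg v ^+ 2.
Proof. by rewrite /cutoff powR_mulrn ?core2_ge0. Qed.

Lemma cutoff_ge0 e v : 0 <= cutoff e v.
Proof. by rewrite cutoffE mulr_ge0 ?sqr_ge0// invr_ge0 sqr_ge0. Qed.

Lemma cutoff_le1 e v : 0 < e -> cutoff e v <= 1.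
Proof.
move=> e0; rewrite cutoffE; have [s0|s0] := eqVneq (sg v) 0.
  by rewrite s0 expr0n invr0 mulr0.
have sp : 0 < sg v by rewrite lt_neqAle eq_sym s0 core2_ge0.
rewrite ler_pdivrMr ?exprn_gt0// mul1r /sqpos lerXn2r ?nnegrE ?le_max ?lexx ?(ltW sp)//.
by rewrite ge_max (ltW sp)/= lerBlDr lerDl ltW.
Qed.

Lemma cutoff_eq0 e v : sg v <= e -> cutoff e v = 0.
Proof.
move=> h; rewrite cutoffE /sqpos max_l ?subr_le0// expr0n mul0r //.
Qed.

Lemma cutoff_cvg v : 0 < sg v -> cutoff k.+1%:R^-1 v @[k --> \oo] --> (1 : R).
Proof.
move=> sp.
have c0 : {for sg v, continuous (@sqpos R)} := is_derive_continuous (is_derive_sqpos (sg v)).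
have l1 : (sg v - k.+1%:R^-1) @[k --> \oo] --> sg v.
  rewrite -[X in _ --> X]subr0; apply: cvgB; [exact: cvg_cst|exact: cvg_harmonic].
have l2 : sqpos (sg v - k.+1%:R^-1) @[k --> \oo] --> sqpos (sg v).
  exact: (cvg_comp _ _ l1 c0).
have E : sqpos (sg v) / sg v ^+ 2 = 1.
  by rewrite /sqpos max_r ?divff ?expf_neq0 ?gt_eqF// ltW.
rewrite -[X in _ --> X]E; under eq_fun do rewrite cutoffE.
by apply: cvgM; [exact: l2|exact: cvg_cst].
Qed.

Lemma Ck_cutoff e : Ck 1 T' (cutoff e).
Proof.
have oU := @open_cut_torus R n Rmaj rho.
have cs : Ck 1 T' sg := @Ck_core2 R n Rmaj rho rho0 rhoR 1.
have s0 v : T' v -> 0 < sg v by case/andP.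
have s20 v : T' v -> 0 < sg v `^ 2 by move=> Uv; rewrite powR_gt0 ?s0.
exact: (CkM oU (Ck_sqpos oU (CkB oU cs (Ck_cst 1 T' e))) (Ck_inv oU s20 (Ck_powR 2 oU s0 cs))).
Qed.

Lemma axi_cutoff e : axi T' (cutoff e) (fun v => cutoff' e (sg v) * (2 * a v))
  (fun v => cutoff' e (sg v) * (2 * t v)).
Proof.
have aS := @axi_core2 R n Rmaj rho rho0 rhoR.
have s0 v : T' v -> 0 < sg v by case/andP.
have s20 v : T' v -> 0 < sg v `^ 2 by move=> Uv; rewrite powR_gt0 ?s0.
have a1 := axi_comp (Phi := @sqpos R) (Phi' := fun x => 2 * Num.max 0 x)
  (fun v _ => is_derive_sqpos _) (axiD aS (@axi_cst R n T' (- e))).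
have a2 := axi_inv s20 (axi_powR 2 s0 aS).
have E v : sg v `^ 2 = sg v ^+ 2 by rewrite powR_mulrn ?core2_ge0.
apply: (axi_eq (axiM a1 a2)) => v Uv /=;
  have sn : sg v != 0 by rewrite gt_eqF// s0.
- by rewrite E /cutoff' /sqpos; field.
- by rewrite E /cutoff' /sqpos; field.
Qed.

Lemma cutoff'_ge0 e x : 0 < e -> 0 < x -> 0 <= cutoff' e x.
Proof.
move=> e0 x0; apply: mulr_ge0; last by rewrite invr_ge0 exprn_ge0// ltW.
apply: mulr_ge0; first by rewrite mulr_ge0// le_max lexx.
by rewrite subr_ge0 ge_max (ltW x0)/= lerBlDr lerDl ltW.
Qed.

(** The distance decreases and the cutoff increases with [core], so their horizontal gradients are
    multiples of that of [core] with opposite signs. *)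
Lemma dot_dist_cutoff e v : 0 < e -> T' v ->
  dot (hgrad d v) (hgrad (cutoff e) v) <= 0.
Proof.
move=> e0 Uv; have Tv := cut_torusS Uv.
have r0 := torus_radius_gt0 rho0 rhoR Tv.
rewrite (dot_dist rho0 rhoR _ Tv) (axi_euler (axi_cutoff e) Uv r0).
rewrite (axi_swirl (axi_cutoff e) Uv) (axi_partialt (axi_cutoff e) Uv).
have c0 : 0 <= cutoff' e (sg v) by apply: cutoff'_ge0 => //; case/andP: Uv.
have rn : rd v != 0 by rewrite gt_eqF.
set c := cutoff' _ _ in c0 *.
have -> : - (s v)^-1 * (a v / rd v * (rd v * (c * (2 * a v))) + 2 * t v * 0 +
   4 * rd v ^+ 2 * t v * (c * (2 * t v))) = - (2 * (c * N v) / s v).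
  by rewrite /gradnum; field; rewrite rn gt_eqF// (cut_core_gt0 Uv).
by rewrite oppr_le0 divr_ge0 ?core_ge0// mulr_ge0// mulr_ge0 ?gradnum_ge0.
Qed.

End cutoff.

Section cut_superharmonic.
Context {R : realType} (n : nat) (Rmaj rho p : R).
Hypothesis rho0 : 0 < rho.
Hypothesis rhoR : rho < Rmaj.
Hypothesis p1 : 1 < p.
Hypothesis n1 : (1 <= n)%N.
Hypothesis cube_cond : (2 * n%:R - 1) * rho <= 4 * (Rmaj - rho) ^+ 3.
Hypothesis lin_cond : (2 * n%:R + p - 3) * rho <= Rmaj - rho.
Notation V := 'rV[R]_(n + n + 1).
Implicit Types (f g h psi : V -> R) (K U : set V) (v w : V) (i : 'I_n).
Notation T := (torus n Rmaj rho).
Notation T' := (@cut_torus R n Rmaj rho).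
Notation d := (dist_boundary T).
Notation sg := (core2 Rmaj).

(* As the cutoff grows with the distance to the core, its gradient contributes
   a term of the favourable sign, which is dropped. *)
Lemma cutoff_superharmonic e K g h : 0 < e -> compact K -> K `<=` T ->
  Ck 1 T' g -> (forall v, ~ K v -> g v = 0) -> (forall v, T v -> 0 <= g v) ->
  tame h -> (forall v, ~ T' v -> 0 <= h v) ->
  (forall v, T' v -> cutoff Rmaj e v * (enorm (hgrad d v) `^ (p - 2)
    * dot (hgrad d v) (hgrad g v)) <= h v) ->
  0 <= integ h.
Proof.
move=> e0 cK KT cg g0 gge th hU hle.
have oU := @open_cut_torus R n Rmaj rho.
have clK : closed K by apply: compact_closed => //; exact: norm_hausdorff.
pose psi v := cutoff Rmaj e v * g v.
pose K' := K `&` [set v | e <= sg v].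
have clS : closed [set v : V | e <= sg v].
  exact: (closed_comp (fun v _ => @continuous_core2 R n Rmaj v) (@closed_ge R e)).
have cK' : compact K'.
  by apply: (subclosed_compact _ cK); [exact: closedI|move=> v []].
have KU : K' `<=` T'.
  move=> v [/KT Tv /= ev]; apply/andP; split => //; exact: lt_le_trans ev.
have p0 v : ~ K' v -> psi v = 0.
  move=> nK; rewrite /psi; have [Kv|/g0 ->] := pselect (K v); last by rewrite mulr0.
  by rewrite cutoff_eq0 ?mul0r// leNgt; apply/negP => /ltW ev; apply: nK.
have cp : Ck 1 setT psi := Ck_glue cK' oU KU p0 (CkM oU (Ck_cutoff n rho0 rhoR e) cg).
have pge v : 0 <= psi v.
  have [Kv|Kv] := pselect (K' v); last by rewrite p0.
  by rewrite mulr_ge0 ?cutoff_ge0// gge//; exact: (cut_torusS (KU _ Kv)).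
have [tF F0] := dist_superharmonic rho0 rhoR p1 n1 cube_cond lin_cond cp cK' KU p0 pge.
apply: (le_trans F0); apply: le_integ => // v.
have [Uv|nU] := pselect (T' v); last first.
  have clK' : closed K' by exact: closedI.
  have nK : ~ K' v by move=> /KU.
  by rewrite (hgrad_outside clK' p0 nK) dot0r mulr0 hU.
apply: le_trans (hle _ Uv).
have dc j := Ck_derivable (j := j) (Ck_cutoff n rho0 rhoR e) Uv.
have dg j := Ck_derivable (j := j) cg Uv.
rewrite (hgrad_mul dc dg) dotDr !dotZr mulrDr [leRHS]mulrCA gerDl mulr_ge0_le0 ?powR_ge0//.
by rewrite mulr_ge0_le0// ?(dot_dist_cutoff rho0 rhoR e0 Uv)// gge//; exact: cut_torusS.
Qed.

End cut_superharmonic.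

(** * Superharmonicity and the Hardy inequality *)

Section hardy_algebra.
Context {R : realType}.

(** In the application D = d(v), e = |hgrad d|, b = |hgrad u|, x = |u|, z is the sign of u and X the
    product of the two gradients. The left-hand side is then the integrand of superharmonicity for
    the test function |u|^p d^(1-p). *)
Lemma hardy_algebra (p D e b x z X : R) : 1 < p -> 0 < D -> 0 < e -> 0 <= b ->
  0 <= x -> z * X <= e * b ->
  e `^ (p - 2) * (x `^ p * ((1 - p) * D `^ (1 - p - 1) * e ^+ 2)
    + D `^ (1 - p) * (p * z * x `^ (p - 1) * X))
  <= ((p - 1) / p) `^ (1 - p) * (b `^ p - ((p - 1) / p) `^ p * (e `^ p / D `^ p * x `^ p)).
Proof.
move=> p1 D0 e0 b0 x0 sX.
have p0 : 0 < p by lra.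
have pB : 0 < p - 1 by lra.
set lam := (p - 1) / p.
have lam0 : 0 < lam by rewrite divr_gt0.
have De : D `^ (1 - p - 1) = D `^ (1 - p) / D.
  by rewrite powRB ?powRr1 ?(ltW D0)// (gt_eqF D0) implybT.
have Dp : D `^ p = D * (D `^ (1 - p))^-1.
  rewrite -powRN -[X in X * _]powRr1 ?(ltW D0)// -powRD; last by rewrite (gt_eqF D0) implybT.
  by congr (_ `^ _); ring.
have ep : e `^ p = e `^ (p - 2) * e ^+ 2.
  rewrite -powR_mulrn ?(ltW e0)// -powRD ?subrK//.
  by rewrite (gt_eqF e0) implybT.
(* The value of [b] for which the two Hardy integrands agree. *)
pose y := lam * (x * e / D).
have y0 : 0 <= y by rewrite !mulr_ge0 ?invr_ge0// ltW.
have Y := young p1 y0 b0.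
have Dinv (q : R) : (D)^-1 `^ q = (D `^ q)^-1.
  by rewrite -powR_inv1 ?(ltW D0)// -powRrM mulN1r powRN.
have yq q : y `^ q = lam `^ q * (x `^ q * e `^ q * (D `^ q)^-1).
  have xe : 0 <= x * e by rewrite mulr_ge0// ltW.
  have Di : 0 <= (D)^-1 by rewrite invr_ge0 ltW.
  by rewrite /y (@powRM _ _ _ q (ltW lam0) (mulr_ge0 xe Di)) (@powRM _ _ _ q xe Di)
    (@powRM _ _ _ q x0 (ltW e0)) Dinv.
have e1 : e `^ (p - 1) = e `^ (p - 2) * e.
  rewrite -[X in _ * X]powRr1 ?(ltW e0)// -powRD; first by congr (_ `^ _); ring.
  by rewrite (gt_eqF e0) implybT.
have D1 : (D `^ (p - 1))^-1 = D `^ (1 - p).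
  by rewrite -powRN; congr (_ `^ _); ring.
have l1 : lam `^ (p - 1) = (lam `^ (1 - p))^-1.
  by rewrite -powRN; congr (_ `^ _); ring.
have lp : lam `^ p = lam * (lam `^ (1 - p))^-1.
  rewrite -powRN -[X in X * _]powRr1 ?(ltW lam0)// -powRD; last by rewrite (gt_eqF lam0) implybT.
  by congr (_ `^ _); ring.
rewrite !yq e1 D1 l1 lp ep Dp in Y *; rewrite De.
set Lm := lam `^ (1 - p) in Y *; set E := e `^ (p - 2) in Y *.
set Dm := D `^ (1 - p) in Y *; set xp := x `^ p in Y *; set xq := x `^ (p - 1) in Y *.
set bp := b `^ p in Y *.
have Lm0 : 0 < Lm by exact: powR_gt0.
have E0 : 0 < E by exact: powR_gt0.
have Dm0 : 0 < Dm by exact: powR_gt0.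
have xq0 : 0 <= xq by exact: powR_ge0.
have key : E * (xp * ((1 - p) * (Dm / D) * e ^+ 2) + Dm * (p * z * xq * X))
   <= E * (xp * ((1 - p) * (Dm / D) * e ^+ 2)) + p * (xq * (E * e) * Dm * b).
  have -> : E * (xp * ((1 - p) * (Dm / D) * e ^+ 2) + Dm * (p * z * xq * X))
     = E * (xp * ((1 - p) * (Dm / D) * e ^+ 2)) + E * Dm * p * xq * (z * X) by ring.
  rewrite lerD2l.
  have -> : p * (xq * (E * e) * Dm * b) = E * Dm * p * xq * (e * b) by ring.
  by rewrite ler_wpM2l// !mulr_ge0// ltW.
apply: (le_trans key).
have Dn : D != 0 by rewrite gt_eqF.
have Dmn : Dm != 0 by rewrite gt_eqF.
have Ln : Lm != 0 by rewrite gt_eqF.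
have pn : p != 0 by rewrite gt_eqF.
(* [Z] is (x e / D)^p and [W] is (x e / D)^(p-1) b. In terms of [Z], [W] and b^p both Young's
   inequality and the goal are linear. *)
pose Z := xp * (E * e ^+ 2) / (D / Dm); pose W := xq * (E * e) * Dm * b.
have Y' := ler_wpM2l (ltW Lm0) Y.
have F1 : E * (xp * ((1 - p) * (Dm / D) * e ^+ 2)) = (1 - p) * Z.
  by rewrite /Z; field; rewrite Dn Dmn.
have F2 : Lm * (bp - lam / Lm * (E * e ^+ 2 / (D / Dm) * xp)) = Lm * bp - lam * Z.
  by rewrite /Z; field; rewrite Ln Dn Dmn.
have F3 : Lm * (p * (Lm^-1 * (xq * (E * e) * Dm) * b)) = p * W.
  by rewrite /W; field.
have F4 : Lm * (bp + (p - 1) * (lam / Lm * (xp * (E * e ^+ 2) / (D / Dm))))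
    = Lm * bp + ((p - 1) * Z - lam * Z).
  by rewrite /Z /lam; field; rewrite pn Ln Dn Dmn.
rewrite F3 F4 in Y'; rewrite F1 F2 -/W.
clear F1 F2 F3 F4 key; move: Y'; rewrite -/Z; move: (Z) (W) => z1 w1 Y'; lra.
Qed.

End hardy_algebra.

Section main_inequalities.
Context {R : realType} (n : nat) (Rmaj rho p : R).
Hypothesis rho0 : 0 < rho.
Hypothesis rhoR : rho < Rmaj.
Hypothesis p1 : 1 < p.
Hypothesis n1 : (1 <= n)%N.
Hypothesis cube_cond : (2 * n%:R - 1) * rho <= 4 * (Rmaj - rho) ^+ 3.
Hypothesis lin_cond : (2 * n%:R + p - 3) * rho <= Rmaj - rho.
Notation V := 'rV[R]_(n + n + 1).
Implicit Types (f g h psi : V -> R) (K U : set V) (v w : V) (i : 'I_n).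
Notation rd := (@radius R n).
Notation T := (torus n Rmaj rho).
Notation T' := (@cut_torus R n Rmaj rho).
Notation d := (dist_boundary T).
Notation a := (rcore Rmaj).
Notation t := (@tc R n).
Notation sg := (core2 Rmaj).
Notation s := (core Rmaj).
Notation N := (gradnum Rmaj).
Notation D := (@depth R n Rmaj rho).

Let oT : open T := @open_torus R n Rmaj rho.
Let oU : open T' := @open_cut_torus R n Rmaj rho.

Lemma tame_norm f : tame f -> tame (fun v => `|f v|).
Proof.
move=> [mf [M [B fM]]]; split; first by apply: measurableT_comp.
exists M, B => v; rewrite normr_id; split; first exact: (fM v).1.
by move=> /(fM v).2 ->; rewrite normr0.
Qed.

(** Applied to integrands containing [hgrad d], which is 0 on the core; it does the work of the core
    being negligible. *)
Lemma patch_core f : (forall v, T v -> ~ T' v -> f v = 0) -> f \_ T = f \_ T'.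
Proof.
move=> f0; apply/funext => v; rewrite !patchE.
case: ifPn => [|] vT; case: ifPn => [|] vU //.
- by apply: f0; [rewrite inE in vT|rewrite notin_setE in vU].
- by move: vU vT; rewrite inE notin_setE => /cut_torusS.
Qed.

Lemma cutoff_patch_cvg f v : cutoff Rmaj k.+1%:R^-1 v * (f \_ T') v @[k --> \oo] --> (f \_ T') v.
Proof.
rewrite patchE; case: ifPn => [|vU].
  rewrite inE => Uv; rewrite -[X in _ --> X]mul1r; apply: cvgM; last exact: cvg_cst.
  by apply: cutoff_cvg; case/andP: Uv.
by under eq_fun do rewrite mulr0; exact: cvg_cst.
Qed.

Lemma cutoff_patch_measurable (e : R) : measurable_fun setT (cutoff Rmaj e \_ T').
Proof.
apply: continuous_patch_measurable => // v Uv.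
exact: (Ck_continuous (Ck_cutoff n rho0 rhoR e)).
Qed.

Lemma cutoff_patchM e f v : cutoff Rmaj e v * (f \_ T') v = (cutoff Rmaj e \_ T') v * (f \_ T') v.
Proof. by rewrite !patchE; case: ifPn => // _; rewrite !mulr0. Qed.

Lemma cutoff_patch_le1 (e : R) v : 0 < e -> `|(cutoff Rmaj e \_ T') v| <= 1.
Proof.
move=> e0; rewrite patchE; case: ifPn => _; last by rewrite normr0.
by rewrite ger0_norm ?cutoff_ge0// cutoff_le1.
Qed.

Lemma tame_cutoff e f : 0 < e -> tame (f \_ T') ->
  tame (fun v => cutoff Rmaj e v * (f \_ T') v).
Proof.
move=> e0 tf; under eq_fun do rewrite cutoff_patchM.
apply: (tameMl (M := 1)) => //; first exact: cutoff_patch_measurable.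
by move=> v; exact: cutoff_patch_le1.
Qed.

Lemma integ_cutoff_cvg f : tame (f \_ T') ->
  integ (fun v => cutoff Rmaj k.+1%:R^-1 v * (f \_ T') v) @[k --> \oo] --> integ (f \_ T').
Proof.
move=> tf; have e0 k : 0 < k.+1%:R^-1 :> R by rewrite invr_gt0.
apply: (integ_cvg (g := fun v => `|(f \_ T') v|)).
- by move=> k; case: (tame_cutoff (e0 k) tf).
- by case: tf.
- by move=> v; exact: cutoff_patch_cvg.
- move=> k v; rewrite cutoff_patchM normrM ler_piMl//.
  exact: cutoff_patch_le1.
- exact: tame_norm.
Qed.

Lemma Ck_enorm_powR k (c : R) : Ck k T' (fun v => enorm (hgrad d v) `^ c).
Proof.
have s0 v : T' v -> 0 < sg v by case/andP.
have g0 v : T' v -> 0 < N v * (sg v)^-1.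
  by move=> Uv; exact: divr_gt0 (gradnum_gt0 rho0 rhoR Uv) (s0 _ Uv).
have cN := @Ck_gradnum R n Rmaj rho rho0 rhoR k.
have cS := @Ck_core2 R n Rmaj rho rho0 rhoR k.
apply: (eq_Ck oU _ (Ck_powR (c / 2) oU g0 (CkM oU cN (Ck_inv oU s0 cS)))) => v Uv.
exact/esym/(enorm_dist rho0 rhoR)/cut_torusS.
Qed.

(** Although [a / s] and [t / s] have no limit at the core, they are at most 1 in absolute value.
    The bound has no singularity and provides the domination for the passage to the limit. *)
Lemma dot_dist_bound phi v : T' v -> `|dot (hgrad d v) (hgrad phi v)| <=
  (Rmaj - rho)^-1 * `|euler phi v| + 2 * `|swirl phi v|
  + 4 * (Rmaj + rho) ^+ 2 * `|partial (tidx n) phi v|.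
Proof.
move=> Uv; have Tv := cut_torusS Uv; have s0 := cut_core_gt0 Uv.
have h0 := rho0; have hR := rhoR.
have cv : s v <= rho by have := Tv; rewrite torusE// => /ltW.
have /andP[r1 r2] := radius_bounds cv.
have rp : 0 < rd v by lra.
have q2 : rd v ^+ 2 <= (Rmaj + rho) ^+ 2 by rewrite lerXn2r ?nnegrE; lra.
rewrite (dot_dist rho0 rhoR _ Tv).
have -> : - (s v)^-1 * (a v / rd v * euler phi v + 2 * t v * swirl phi v +
    4 * rd v ^+ 2 * t v * partial (tidx n) phi v)
  = - ((a v / s v) * ((rd v)^-1 * euler phi v) + (t v / s v) * (2 * swirl phi v)
    + (t v / s v) * (4 * rd v ^+ 2 * partial (tidx n) phi v)).
  by field; rewrite !gt_eqF.
have a1 : `|a v / s v| <= 1.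
  by rewrite normrM normfV (gtr0_norm s0) ler_pdivrMr// mul1r rcore_le.
have t1 : `|t v / s v| <= 1.
  by rewrite normrM normfV (gtr0_norm s0) ler_pdivrMr// mul1r tc_le.
rewrite normrN; apply: le_trans (ler_normD _ _) _; apply: lerD.
  apply: le_trans (ler_normD _ _) _; apply: lerD; rewrite normrM.
    apply: le_trans (ler_piMl _ a1) _ => //.
    rewrite normrM ler_wpM2r// normfV gtr0_norm// lef_pV2 ?posrE// subr_gt0//.
  by apply: le_trans (ler_piMl _ t1) _ => //; rewrite normrM gtr0_norm.
rewrite normrM; apply: le_trans (ler_piMl _ t1) _ => //.
have q0 : 0 <= 4 * rd v ^+ 2 by apply: mulr_ge0 => //; exact: sqr_ge0.
by rewrite normrM (ger0_norm q0) ler_wpM2r// ler_wpM2l.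
Qed.

Lemma torus_superharmonic : weakly_p_superharmonic p T d.
Proof.
move=> phi /test_functionP[K [cK clK KT phi0 cphi]] phige.
pose G v := enorm (hgrad d v) `^ (p - 2) * dot (hgrad d v) (hgrad phi v).
have GT : G \_ T = G \_ T'.
  apply: patch_core => v Tv nU.
  by rewrite /G (hgrad_dist_core rho0 rhoR Tv nU) dotC dot0r mulr0.
have ctp := Ck_partial (tidx n) (cphi 1%N).
have ce := euler_Ck openT (cphi 1%N); have cs := swirl_Ck openT (cphi 1%N).
have te : tame (euler phi).
  apply: (continuous_tame _ cK) => v; first exact: (Ck_continuous ce).
  exact: (euler_outside clK phi0).
have ts : tame (swirl phi).
  apply: (continuous_tame _ cK) => v; first exact: (Ck_continuous cs).
  exact: (swirl_outside clK phi0).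
have tt : tame (partial (tidx n) phi).
  apply: (continuous_tame _ cK) => v; first exact: (Ck_continuous ctp).
  exact: (partial_outside _ clK phi0).
have tG : tame (G \_ T').
  (* For p < 2 this uses that |hgrad d| is bounded away from 0 off the core. *)
  have [k k0 kP] := @enorm_dist_powR_bounds R n Rmaj rho rho0 rhoR (p - 2).
  pose dom v := `|k.2| * (((Rmaj - rho)^-1 * `|euler phi v| + 2 * `|swirl phi v|)
     + 4 * (Rmaj + rho) ^+ 2 * `|partial (tidx n) phi v|).
  have tdom : tame dom.
    apply: tameZ; apply: tameD; last by apply: tameZ; exact: tame_norm.
    by apply: tameD; apply: tameZ; exact: tame_norm.
  apply: (tame_le _ _ tdom).
  - apply: (continuous_patch_measurable oU) => v Uv.
    have cphi' := CkW (@subsetT _ T') (cphi 1%N).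
    have cd : Ck 0 T' (fun w => dot (hgrad d w) (hgrad phi w)).
      have s0 w : T' w -> 0 < s w by exact: cut_core_gt0.
      have r0 w : T' w -> 0 < rd w by move=> /cut_torusS/(torus_radius_gt0 rho0 rhoR).
      have cS := @Ck_core R n Rmaj rho rho0 rhoR 0.
      have cA := @Ck_rcore R n Rmaj rho rho0 rhoR 0.
      have cR := @Ck_rd R n Rmaj rho rho0 rhoR 0.
      have cT := @Ck_tc R n 0 T'.
      have cP := CkW (@subsetT _ T') ctp.
      have c4 := CkM oU (CkM oU (CkM oU (Ck_cst 0 T' 4) (CkX 2 oU cR)) cT) cP.
      have c2 := CkM oU (CkM oU (Ck_cst 0 T' 2) cT) (CkW (@subsetT _ T') cs).
      have c1 := CkM oU (CkM oU cA (Ck_inv oU r0 cR)) (CkW (@subsetT _ T') ce).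
      have cc := CkM oU (CkN oU (Ck_inv oU s0 cS)) (CkD oU (CkD oU c1 c2) c4).
      apply: (eq_Ck oU _ cc) => w Uw.
      exact: esym (dot_dist rho0 rhoR phi (cut_torusS Uw)).
    exact: (Ck_continuous (CkM oU (Ck_enorm_powR 0 (p - 2)) cd)).
  - move=> v; rewrite patchE; case: ifPn => vU.
      rewrite inE in vU; rewrite /G /dom normrM (ger0_norm (powR_ge0 _ _)).
      have /andP[k1 k2] := kP _ vU.
      apply: ler_pM => //; [exact: powR_ge0|exact: le_trans (ler_norm _)|exact: dot_dist_bound].
    rewrite normr0 /dom; have h0 := rho0; have hR := rhoR.
    rewrite mulr_ge0// addr_ge0// ?addr_ge0// mulr_ge0// ?invr_ge0; last first.
      by rewrite mulr_ge0 ?sqr_ge0.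
    by lra.
have mT : measurable T := open_rV_measurable oT.
rewrite (integ_patch (f := G) mT) ?GT// lee_fin.
(* The integral is the limit of the cut integrals, each of which is nonnegative by
   [cutoff_superharmonic]. *)
have cv := integ_cutoff_cvg tG.
rewrite -(cvg_lim _ cv)//; apply: limr_ge; first by apply/cvg_ex; exists (integ (G \_ T')).
apply: nearW => k; have e0 : 0 < k.+1%:R^-1 :> R by rewrite invr_gt0.
apply: (cutoff_superharmonic rho0 rhoR p1 n1 cube_cond lin_cond e0 cK KT
   (CkW (@subsetT _ T') (cphi 1%N)) phi0) => //.
- exact: tame_cutoff.
- by move=> v nU; rewrite patchE memNset// mulr0.
- by move=> v Uv; rewrite patchE mem_set.
Qed.

Lemma hardy_pointwise u v : T' v -> (forall j, derivable u v (dir j)) ->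
  enorm (hgrad d v) `^ (p - 2) * dot (hgrad d v)
     (hgrad (fun w => abspow p (u w) * D w `^ (1 - p)) v)
  <= ((p - 1) / p) `^ (1 - p) * (enorm (hgrad u v) `^ p - ((p - 1) / p) `^ p *
      (enorm (hgrad d v) `^ p / d v `^ p * `|u v| `^ p)).
Proof.
move=> Uv du; have Tv := cut_torusS Uv; have hp := p1.
have p0 : 0 < p by lra.
have pB : 0 < p - 1 by lra.
have D0 : 0 < D v by exact: depth_gt0.
have e0 := enorm_dist_gt0 rho0 rhoR Uv.
have dD j : derivable D v (dir j) := Ck_derivable (@Ck_depth R n Rmaj rho rho0 rhoR 1) Uv.
have dDp j : derivable (fun w => D w `^ (1 - p)) v (dir j).
  have [h _] := is_derive_comp1 (is_derive1_powR (1 - p) D0) (is_derive_partial (dD j)).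
  exact: h.
have dup j : derivable (fun w => abspow p (u w)) v (dir j).
  have [h _] := is_derive_comp1 (is_derive_abspow (u v) p1) (is_derive_partial (du j)).
  exact: h.
have E1 := hgrad_comp dD (is_derive1_powR (1 - p) D0).
have E2 := hgrad_comp du (is_derive_abspow (u v) p1).
have E3 := hgrad_mul dup dDp.
have ED := hgrad_near (dist_near rho0 rhoR Tv).
have -> : dot (hgrad d v) (hgrad (fun w => abspow p (u w) * D w `^ (1 - p)) v)
  = abspow p (u v) * ((1 - p) * D v `^ (1 - p - 1) * enorm (hgrad d v) ^+ 2)
    + D v `^ (1 - p) * (p * Num.sg (u v) * `|u v| `^ (p - 1) * dot (hgrad d v) (hgrad u v)).
  apply: (etrans (congr1 (dot (hgrad d v)) E3)); rewrite dotDr; congr (_ + _).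
    apply: (etrans (dotZr _ _ _)); congr (_ * _).
    apply: (etrans (congr1 (dot (hgrad d v)) E1)); apply: (etrans (dotZr _ _ _)).
    by congr (_ * _); rewrite ED sqr_enorm.
  apply: (etrans (dotZr _ _ _)); congr (_ * _).
  by apply: (etrans (congr1 (dot (hgrad d v)) E2)); exact: dotZr.
clear E1 E2 E3 ED.
rewrite (dist_boundary_torus rho0 rhoR Tv).
(* The sign comes from differentiating |u|^p; Cauchy-Schwarz is needed for both signs. *)
have sX : Num.sg (u v) * dot (hgrad d v) (hgrad u v) <= enorm (hgrad d v) * enorm (hgrad u v).
  set X := dot _ _.
  have h1 : X <= enorm (hgrad d v) * enorm (hgrad u v) by exact: dot_le_enorm.
  have h2 : - X <= enorm (hgrad d v) * enorm (hgrad u v).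
    rewrite /X -mulN1r -dotZr; apply: le_trans (dot_le_enorm _ _) _.
    rewrite (_ : enorm (-1 *: _) = enorm (hgrad u v))//.
    by rewrite /enorm dotZr dotC dotZr mulrA mulrNN !mul1r.
  by case: (sgrP (u v)) => _; rewrite ?mul0r ?mul1r ?mulN1r// mulr_ge0 ?enorm_ge0.
exact: hardy_algebra p1 D0 e0 (enorm_ge0 _) (normr_ge0 _) sX.
Qed.

End main_inequalities.

Section hardy.
Context {R : realType} (n : nat) (Rmaj rho p : R).
Hypothesis rho0 : 0 < rho.
Hypothesis rhoR : rho < Rmaj.
Hypothesis p1 : 1 < p.
Hypothesis n1 : (1 <= n)%N.
Hypothesis cube_cond : (2 * n%:R - 1) * rho <= 4 * (Rmaj - rho) ^+ 3.
Hypothesis lin_cond : (2 * n%:R + p - 3) * rho <= Rmaj - rho.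
Notation V := 'rV[R]_(n + n + 1).
Implicit Types (f g h psi : V -> R) (K U : set V) (v w : V) (i : 'I_n).
Notation T := (torus n Rmaj rho).
Notation T' := (@cut_torus R n Rmaj rho).
Notation d := (dist_boundary T).
Notation D := (@depth R n Rmaj rho).

Let oT : open T := @open_torus R n Rmaj rho.
Let oU : open T' := @open_cut_torus R n Rmaj rho.

Definition hardy_weight (u : V -> R) (v : V) : R := enorm (hgrad d v) `^ p / d v `^ p * `|u v| `^ p.

Lemma hardy_weight_patch u : hardy_weight u \_ T = hardy_weight u \_ T'.
Proof.
apply: patch_core => v Tv nU.
rewrite /hardy_weight (hgrad_dist_core rho0 rhoR Tv nU) enorm0 powR0 ?mul0r//.
by apply: lt0r_neq0; exact: lt_trans ltr01 p1.
Qed.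

(** The factor d^(-p) is unbounded at the boundary, so |u|^p d^(-p) is first glued by 0 outside [K].
    The gradient factor is continuous only off the core and enters merely as a bounded measurable
    function. *)
Lemma tame_hardy_weight u K : Ck 0 setT u -> compact K -> K `<=` T ->
  (forall v, ~ K v -> u v = 0) -> tame (hardy_weight u \_ T').
Proof.
move=> cu cK KT u0; have p0 : p != 0 by apply: lt0r_neq0; exact: lt_trans ltr01 p1.
pose g v := abspow p (u v) * (D v `^ p)^-1.
have g0 v : ~ K v -> g v = 0 by move=> /u0; rewrite /g /abspow => ->; rewrite normr0 powR0 ?mul0r.
have cD v : T v -> {for v, continuous (fun w => (D w `^ p)^-1)}.
  move=> Tv; have D0 := depth_gt0 rho0 Tv.
  have c1 : {for D v, continuous (@powR R ^~ p)} := is_derive_continuous (is_derive1_powR p D0).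
  have Dn : D v `^ p != 0 by apply: lt0r_neq0; exact: powR_gt0.
  exact: (cvgV Dn (continuous_comp (@continuous_depth R n Rmaj rho v) c1)).
have cA v : {for v, continuous (fun w => abspow p (u w))}.
  have c1 : {for u v, continuous (abspow p)} := is_derive_continuous (is_derive_abspow (u v) p1).
  exact: (continuous_comp (Ck_continuous cu (I : setT v)) c1).
have cg0 : Ck 0 T g by split => // v Tv; exact: (cvgM (cA v) (cD v Tv)).
have tg : tame g.
  apply: (continuous_tame _ cK g0) => v.
  exact: (Ck_continuous (Ck_glue cK oT KT g0 cg0)).
have [k k0 kP] := @enorm_dist_powR_bounds R n Rmaj rho rho0 rhoR p.
have -> : hardy_weight u \_ T' = ((fun v => enorm (hgrad d v) `^ p) \_ T') \* g.
  apply/funext => v /=; rewrite !patchE; case: ifPn => vU; last by rewrite mul0r.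
  rewrite inE in vU; rewrite /hardy_weight /g (dist_boundary_torus rho0 rhoR (cut_torusS vU)).
  by rewrite /abspow; ring.
apply: (tameMl (M := `|k.2|)) => //.
  apply: (continuous_patch_measurable oU) => v Uv.
  exact: (Ck_continuous (Ck_enorm_powR n rho0 rhoR 0 p)).
move=> v; rewrite patchE; case: ifPn => vU; last by rewrite normr0.
rewrite inE in vU; rewrite ger0_norm ?powR_ge0//; have /andP[_ h] := kP _ vU.
exact: le_trans (ler_norm _).
Qed.

Lemma torus_hardy : hardy_inequality p (((p - 1) / p) `^ p) T d.
Proof.
move=> u /test_functionP[K [cK clK KT u0 cu]].
have p0 : 0 < p by rewrite (lt_trans ltr01 p1).
pose B v := enorm (hgrad u v) `^ p.
have B0 v : ~ K v -> B v = 0.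
  by move=> Kv; rewrite /B (hgrad_outside clK u0 Kv) enorm0 powR0// gt_eqF.
have tB : tame B.
  by apply: tame_powR => //; [move=> v; exact: enorm_ge0|exact: hgrad_tame (cu 1%N) cK u0].
have BT : B \_ T = B.
  apply/funext => v; rewrite patchE; case: ifPn => //; rewrite notin_setE => vT.
  by rewrite B0// => /KT.
have mT : measurable T := open_rV_measurable oT.
have tA := tame_hardy_weight (cu 0%N) cK KT u0.
have AT := hardy_weight_patch u.
rewrite (integ_patch (f := hardy_weight u) mT) ?AT//.
rewrite (integ_patch (f := B) mT) ?BT// -EFinM lee_fin.
set c := ((p - 1) / p) `^ p.
have e0 k : 0 < k.+1%:R^-1 :> R by rewrite invr_gt0.
pose A k v := cutoff Rmaj k.+1%:R^-1 v * (hardy_weight u \_ T') v.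
have tAk k : tame (A k) := tame_cutoff rho0 rhoR (e0 k) tA.
have lam0 : 0 < ((p - 1) / p) `^ (1 - p) by rewrite powR_gt0// divr_gt0// subr_gt0.
have main k : c * integ (A k) <= integ B.
  (* The test function of the overview; p > 1 makes |u|^p of class C^1, across the zeros of u
     included. *)
  pose g v := abspow p (u v) * D v `^ (1 - p).
  have tH : tame (fun v => B v + - c * A k v) by apply: tameD => //; exact: tameZ.
  have D0 v : T' v -> 0 < D v by move=> /cut_torusS; exact: depth_gt0.
  have cg : Ck 1 T' g := CkM oU (Ck_abspow p1 oU (CkW (@subsetT _ T') (cu 1%N)))
    (Ck_powR (1 - p) oU D0 (@Ck_depth R n Rmaj rho rho0 rhoR 1)).
  have H : 0 <= integ (fun v => ((p - 1) / p) `^ (1 - p) * (B v + - c * A k v)).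
    apply: (cutoff_superharmonic rho0 rhoR p1 n1 cube_cond lin_cond (e0 k) cK KT cg).
    - by move=> v /u0; rewrite /g /abspow => ->; rewrite normr0 powR0 ?mul0r// gt_eqF.
    - by move=> v _; rewrite mulr_ge0 ?powR_ge0.
    - exact: tameZ.
    - move=> v nU; rewrite /A patchE memNset// !mulr0 addr0.
      by rewrite mulr_ge0 ?powR_ge0.
    - move=> v Uv.
      have du j : derivable u v (dir j) := Ck_derivable (cu 1%N) I.
      have P := hardy_pointwise rho0 rhoR p1 Uv du.
      have c0 := cutoff_ge0 Rmaj k.+1%:R^-1 v.
      apply: le_trans (ler_wpM2l c0 P) _.
      rewrite mulrCA ler_wpM2l ?(ltW lam0)// /A patchE mem_set// -/(hardy_weight u v) -/c.
      rewrite mulrBr mulNr; apply: lerB.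
        (* The energy is nonnegative and the cutoff at most 1, so only the weighted term keeps the
           cutoff. *)
        by rewrite ler_piMl ?powR_ge0// cutoff_le1.
      by rewrite mulrCA.
  move: H; rewrite integZ// pmulr_rge0// integD//; last exact: tameZ.
  by rewrite integZ// mulNr subr_ge0.
have cv := integ_cutoff_cvg rho0 rhoR tA.
have cv2 : c * integ (A k) @[k --> \oo] --> c * integ (hardy_weight u \_ T').
  by apply: cvgM; [exact: cvg_cst|exact: cv].
rewrite -(cvg_lim _ cv2)//; apply: limr_le; last exact: nearW.
by apply/cvg_ex; exists (c * integ (hardy_weight u \_ T')).
Qed.

End hardy.

(** * Sharpness of the constant *)

Section positivity.
Context {R : realType} (m : nat).
Implicit Types (f : 'rV[R]_m -> R).

Lemma box_sub_ball (v : 'rV[R]_m) e : 0 < e -> box v e `<=` ball v e.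
Proof.
move=> e0 w hw; rewrite -ball_normE /= [X in X < _](mx_normrE (v - w)).
apply/bigmax_ltP; split => //= -[i j] _ /=.
by rewrite ord1 !mxE distrC; exact: hw.
Qed.

Lemma integ_gt0 f v : tame f -> (forall w, 0 <= f w) -> {for v, continuous f} ->
  0 < f v -> 0 < integ f.
Proof.
move=> tf f0 cf fv.
have c0 : 0 < f v / 2 by rewrite divr_gt0.
have : \forall w \near v, f v / 2 < f w.
  have /cvgrPdist_lt /(_ _ c0) := cf.
  by apply: filterS => w /= h; move: h; rewrite ltr_norml => /andP[_]; lra.
move=> /nbhs_ballP[e /= e0 eb].
have /andP[b0 b1] := lebesgue_rV_box v e0.
have mb := measurable_box v e.
have t1 : tame (\1_(box v e) : 'rV[R]_m -> R).
  split; first exact/measurable_indicP.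
  have [B B0 hB] := compact_box (@compact_set1 _ v).
  exists 1, (B + e) => w; rewrite indicE; split.
    by rewrite ger0_norm ?ler0n// lern1 leq_b1.
  move=> wB; rewrite memNset// => h; apply: wB => i.
  have := hB v erefl i; have := h i; rewrite !mxE !subr0 => h1 h2.
  rewrite -(subrK (v ord0 i) (w ord0 i)) addrC.
  by apply: le_lt_trans (ler_normD _ _) _; exact: ltrD.
have ti := tameZ (f v / 2) t1.
apply: (@lt_le_trans _ _ (integ (fun w => f v / 2 * \1_(box v e) w))).
  rewrite integZ// mulr_gt0// -lte_fin (integE t1).
  by rewrite integral_indic// setIT.
apply: le_integ => // w; rewrite indicE; have [wb|wb] := pselect (box v e w).
  by rewrite mem_set// mulr1; apply/ltW/eb/box_sub_ball.
by rewrite memNset// mulr0.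
Qed.

End positivity.

(** * One-variable profiles *)

Section profile.
Context {R : realType}.
Implicit Types (x y m p : R).

(** Put k = c^(1/p) > l. If |y| <= (k - l) |x|, then |l x - y| <= k |x|; otherwise |x| is at most
    |y| / (k - l) and everything is bounded by a multiple of |y|. *)
Lemma powR_perturb p l c : 0 < p -> 0 < l -> l `^ p < c ->
  exists2 C : R, 0 <= C & forall x y, `|l * x - y| `^ p <= c * `|x| `^ p + C * `|y| `^ p.
Proof.
move=> p0 l0 lc; have c0 : 0 < c by rewrite (le_lt_trans _ lc)// powR_ge0.
pose k := c `^ p^-1.
have kp : k `^ p = c by rewrite -powRrM mulVf ?gt_eqF// powRr1// ltW.
have k0 : 0 < k by exact: powR_gt0.
have lk : l < k.
  rewrite ltNge; apply/negP => kl.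
  have : k `^ p <= l `^ p by apply: (ge0_ler_powR (ltW p0)); rewrite ?nnegrE ?(ltW k0) ?(ltW l0).
  by rewrite kp leNgt lc.
have kl0 : 0 < k - l by rewrite subr_gt0.
have D0 : 0 <= l / (k - l) + 1 by rewrite addr_ge0// divr_ge0// ltW.
exists ((l / (k - l) + 1) `^ p); first exact: powR_ge0.
move=> x y; have x0 := normr_ge0 x; have y0 := normr_ge0 y.
have T1 : `|l * x - y| <= l * `|x| + `|y|.
  by apply: le_trans (ler_normB _ _) _; rewrite normrM (gtr0_norm l0).
have [h|h] := leP `|y| ((k - l) * `|x|).
  have h1 : `|l * x - y| <= k * `|x| by apply: (le_trans T1); lra.
  have h2 : `|l * x - y| `^ p <= (k * `|x|) `^ p.
    by apply: (ge0_ler_powR (ltW p0)) => //; rewrite nnegrE// mulr_ge0// ltW.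
  apply: (le_trans h2); rewrite powRM ?(ltW k0)// kp lerDl mulr_ge0 ?powR_ge0//.
have h1 : `|l * x - y| <= (l / (k - l) + 1) * `|y|.
  apply: (le_trans T1); rewrite mulrDl mul1r lerD2r -mulrA ler_wpM2l ?(ltW l0)//.
  by rewrite mulrC ler_pdivlMr// mulrC ltW.
have h2 : `|l * x - y| `^ p <= ((l / (k - l) + 1) * `|y|) `^ p.
  by apply: (ge0_ler_powR (ltW p0)) => //; rewrite nnegrE// mulr_ge0.
by apply: (le_trans h2); rewrite powRM// lerDr mulr_ge0 ?powR_ge0// ltW.
Qed.

Definition profile m : R := bump 0 (1 - m ^+ 2).
Definition profile' m : R := bump 1 (1 - m ^+ 2) * (- (2 * m)).

(* An odd function with compact support, decreasing only near 0. *)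
Definition odd_bump m : R := - m * sqpos (9 / 4 - m ^+ 2).
Definition odd_bump' m : R := Num.max 0 (9 / 4 - m ^+ 2) * (5 * m ^+ 2 - 9 / 4).

Lemma is_derive_sqr m (c : R) : is_derive m 1 (fun x => c - x ^+ 2) (- (2 * m)).
Proof.
have h := is_deriveB (is_derive_cst c m (1 : R))
  (is_deriveM (is_derive_id m (1 : R)) (is_derive_id m (1 : R))).
have -> : (fun x => c - x ^+ 2) = cst c - (id : R -> R) * id.
  by apply/funext => x; rewrite expr2.
by apply: (is_derive_congr h); rewrite /GRing.scale/=; ring.
Qed.

Lemma is_derive_profile m : is_derive m 1 profile (profile' m).
Proof. exact: (is_derive1_comp (is_derive_bump 0 _) (is_derive_sqr m 1)). Qed.

Lemma is_derive_odd_bump m : is_derive m 1 odd_bump (odd_bump' m).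
Proof.
have h1 := @is_derive1_comp _ (@sqpos R) (fun x => 9 / 4 - x ^+ 2) m _ _
  (is_derive_sqpos (9 / 4 - m ^+ 2)) (is_derive_sqr m (9 / 4)).
have h2 := is_deriveM (is_deriveNid m (1 : R)) h1.
apply: (is_derive_congr h2); rewrite /odd_bump' /sqpos /GRing.scale/=.
by have [h|h] := leP 0 (9 / 4 - m ^+ 2); ring.
Qed.

Lemma continuous_profile' : continuous profile'.
Proof.
move=> m; apply: cvgM.
  have c1 : {for 1 - m ^+ 2, continuous (@bump R 1)} := is_derive_continuous (is_derive_bump 1 _).
  exact: (continuous_comp (is_derive_continuous (is_derive_sqr m 1)) c1).
by apply: cvgN; apply: cvgM; [exact: cvg_cst|exact: cvg_id].
Qed.

Lemma continuous_odd_bump' : continuous odd_bump'.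
Proof.
move=> m; have c2 := is_derive_continuous (is_derive_sqr m (9 / 4)).
apply: cvgM.
  have cm : {for 9 / 4 - m ^+ 2, continuous (Num.max (0 : R))}.
    by apply: continuous_max; [exact: cst_continuous|exact: cvg_id].
  exact: (continuous_comp c2 cm).
have -> : (fun x => 5 * x ^+ 2 - 9 / 4) = (fun x : R => 5 * (x * x) - 9 / 4).
  by apply/funext => x; rewrite expr2.
apply: cvgB; last exact: cvg_cst.
by apply: cvgM; [exact: cvg_cst|apply: cvgM; exact: cvg_id].
Qed.

Lemma profile_ge0 m : 0 <= profile m. Proof. exact: bump0_ge0. Qed.

Lemma profile_eq0 m : 1 <= `|m| -> profile m = 0.
Proof.
move=> h; apply: bump_eq0; rewrite subr_le0 -real_normK ?num_real//.
by rewrite -[X in X <= _](expr1n _ 2) lerXn2r ?nnegrE.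
Qed.

Lemma profile'_eq0 m : 1 <= `|m| -> profile' m = 0.
Proof.
move=> h; rewrite /profile' bump_eq0 ?mul0r// subr_le0 -real_normK ?num_real//.
by rewrite -[X in X <= _](expr1n _ 2) lerXn2r ?nnegrE.
Qed.

Lemma odd_bump_support m : 3 / 2 <= `|m| -> 9 / 4 - m ^+ 2 <= 0.
Proof.
rewrite subr_le0 -real_normK ?num_real// => h.
have -> : 9 / 4 = (3 / 2) ^+ 2 :> R by field.
by rewrite lerXn2r ?nnegrE.
Qed.

Lemma odd_bump_eq0 m : 3 / 2 <= `|m| -> odd_bump m = 0.
Proof.
by move=> /odd_bump_support h; rewrite /odd_bump /sqpos max_l ?expr0n ?mulr0.
Qed.

Lemma odd_bump'_eq0 m : 3 / 2 <= `|m| -> odd_bump' m = 0.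
Proof. by move=> /odd_bump_support h; rewrite /odd_bump' max_l ?mul0r. Qed.

(** For |m| >= 1 the left-hand side is 0 and [odd_bump'] is nonnegative. For 16/25 <= m^2 < 1 one
    has [odd_bump'] >= 1. For m^2 < 16/25 the possibly negative [odd_bump'] is paid for by
    [profile], which is bounded below there. *)
Lemma profile'_bound p : 1 < p -> exists K : R * R,
  [/\ 0 <= K.1, 0 <= K.2 & forall m,
    `|profile' m| `^ p <= K.1 * odd_bump' m + K.2 * profile m `^ p].
Proof.
move=> p1; have p0 : 0 < p by rewrite (lt_trans ltr01).
have [M M0 hM] : exists2 M : R, 0 <= M & forall m, `|profile' m| `^ p <= M.
  have : compact (profile' @` `[-1, 1]).
    apply: continuous_compact; last exact: segment_compact.
    by apply: continuous_subspaceT; exact: continuous_profile'.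
  move=> /compact_bounded[M [Mr hM]].
  exists ((Num.max M 0 + 1) `^ p); first exact: powR_ge0.
  have M1 : 0 <= Num.max M 0 + 1 by rewrite addr_ge0// le_max lexx orbT.
  move=> m; apply: (ge0_ler_powR (ltW p0)); rewrite ?nnegrE//.
  have [m1|m1] := leP `|m| 1; last by rewrite profile'_eq0 ?normr0// ltW.
  apply: (hM (Num.max M 0 + 1)).
    by rewrite (@le_lt_trans _ _ (Num.max M 0)) ?le_max ?lexx// ltrDl.
  by exists m => //; rewrite /= in_itv/= -ler_norml.
have b0 : 0 < bump 0 (9 / 25 : R) by apply: bump0_gt0; rewrite divr_gt0.
pose c := bump 0 (9 / 25 : R) `^ p.
have c0 : 0 < c by exact: powR_gt0.
have K0 : 0 <= 7 * M / c by rewrite divr_ge0 ?mulr_ge0// ltW.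
(* As [odd_bump'] >= -6 in the inner range, the second term must yield 7 M: 6 M for this loss and M
   for the bound on [profile']. *)
exists (M, 7 * M / c) => /=; split=> // m.
have [m1|m1] := leP 1 `|m|.
  rewrite profile'_eq0// profile_eq0// normr0 powR0 ?gt_eqF// mulr0 addr0.
  apply: mulr_ge0 => //; apply: mulr_ge0; first by rewrite le_max lexx.
  have : 1 <= m ^+ 2 by rewrite -real_normK ?num_real// -[X in X <= _](expr1n _ 2) lerXn2r ?nnegrE.
  by lra.
have m2 : m ^+ 2 < 1.
  by rewrite -real_normK ?num_real// -[X in _ < X](expr1n _ 2) ltrXn2r ?nnegrE.
have E : odd_bump' m = (9 / 4 - m ^+ 2) * (5 * m ^+ 2 - 9 / 4).
  by rewrite /odd_bump' max_r//; lra.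
have q0 := sqr_ge0 m; have PM := hM m.
have [h|h] := leP (16 / 25) (m ^+ 2).
  have E1 : 1 <= odd_bump' m by rewrite E; nra.
  have : 0 <= 7 * M / c * profile m `^ p by rewrite mulr_ge0 ?powR_ge0.
  by have := ler_wpM2l M0 E1; lra.
have E1 : - 6 <= odd_bump' m by rewrite E; nra.
have P : c <= profile m `^ p.
  apply: (ge0_ler_powR (ltW p0)); rewrite ?nnegrE ?(ltW b0) ?profile_ge0//.
  rewrite /profile /bump !ifT /=; last 2 first.
  - by lra.
  - by lra.
  rewrite !hornerC !mul1r ler_expR lerN2 lef_pV2 ?posrE//; lra.
have H1 := ler_wpM2l M0 E1.
have H2 : 7 * M <= 7 * M / c * profile m `^ p.
  by rewrite mulrAC (ler_pdivlMr _ _ c0); apply: ler_wpM2l P; exact: (mulr_ge0 (ler0n _ 7) M0).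
by lra.
Qed.

End profile.

(** In the application Di = 1/D, J = |hgrad d|^p, F = [flux], th = profile^p, B = |profile'|^p, A is
    the perturbed power, G = [odd_bump'] and lp = L^p. J and F may be exchanged up to constants in
    the nonnegative terms, but G changes sign and must keep the exact weight F Di, for which its
    integral vanishes. *)
Lemma energy_algebra (R : realType)
    (Di J F A B th G lp c C K1 K2 k1 k2 f1 f2 : R) :
  0 <= Di -> 0 < k1 -> k1 <= J /\ J <= k2 -> 0 < f1 -> f1 <= F /\ F <= f2 ->
  0 <= C -> 0 <= K2 -> 0 <= B -> 0 <= th -> 0 < lp ->
  B <= K1 * G + K2 * th -> A <= c * th + C * (B / lp) ->
  Di * J * A <= (c + C * (k2 / f1) * K2 * (f2 / k1) / lp) * (Di * J * th)
    + C * (k2 / f1) / lp * K1 * (F * Di * G).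
Proof.
move=> Di0 k10 [J1 J2] f10 [F1 F2] C0 K20 B0 th0 lp0 hB hA.
have J0 := lt_le_trans k10 J1; have F0 := lt_le_trans f10 F1.
have k20 := lt_le_trans J0 J2; have f20 := lt_le_trans F0 F2.
have E1 : B <= F / f1 * B.
  by apply: ler_peMl => //; rewrite ler_pdivlMr// mul1r.
have E2 : F * th <= f2 / k1 * (J * th).
  have -> : f2 / k1 * (J * th) = f2 * (J / k1 * th) by ring.
  apply: ler_pM => //; first exact: ltW.
  by apply: ler_peMl => //; rewrite ler_pdivlMr// mul1r.
have E3 : J * B <= k2 / f1 * (K1 * (F * G) + K2 * (f2 / k1 * (J * th))).
  apply: (@le_trans _ _ (k2 * (F / f1 * B))).
    by apply: ler_pM => //; exact: ltW.
  have -> : k2 * (F / f1 * B) = k2 / f1 * (F * B) by ring.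
  apply: ler_wpM2l; first by rewrite divr_ge0 ?ltW.
  apply: (le_trans (ler_wpM2l (ltW F0) hB)).
  have -> : F * (K1 * G + K2 * th) = K1 * (F * G) + K2 * (F * th) by ring.
  by rewrite lerD2l; exact: ler_wpM2l.
have E4 : Di * J * A <= Di * J * c * th + Di * C / lp * (J * B).
  have -> : Di * J * c * th + Di * C / lp * (J * B) = Di * J * (c * th + C * (B / lp)) by ring.
  by apply: ler_wpM2l => //; rewrite mulr_ge0// ltW.
have E5 : 0 <= Di * C / lp by exact: divr_ge0 (mulr_ge0 Di0 C0) (ltW lp0).
apply: (le_trans E4); have := ler_wpM2l E5 E3.
have -> : (c + C * (k2 / f1) * K2 * (f2 / k1) / lp) * (Di * J * th)
    + C * (k2 / f1) / lp * K1 * (F * Di * G)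
  = Di * J * c * th + Di * C / lp * (k2 / f1 * (K1 * (F * G) + K2 * (f2 / k1 * (J * th)))) by ring.
by rewrite lerD2l.
Qed.

(** * Almost extremal functions supported near the boundary *)

Section sharpness.
Context {R : realType} (n : nat) (Rmaj rho p : R).
Hypothesis rho0 : 0 < rho.
Hypothesis rhoR : rho < Rmaj.
Hypothesis p1 : 1 < p.
Hypothesis n1 : (1 <= n)%N.
Notation V := 'rV[R]_(n + n + 1).
Implicit Types (f g h psi : V -> R) (K U : set V) (v w : V) (i : 'I_n).
Notation rd := (@radius R n).
Notation T := (torus n Rmaj rho).
Notation T' := (@cut_torus R n Rmaj rho).
Notation d := (dist_boundary T).
Notation a := (rcore Rmaj).
Notation t := (@tc R n).
Notation sg := (core2 Rmaj).
Notation s := (core Rmaj).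
Notation D := (@depth R n Rmaj rho).

Let oT : open T := @open_torus R n Rmaj rho.
Let oU : open T' := @open_cut_torus R n Rmaj rho.
Let r0 v : T' v -> 0 < rd v.
Proof. by move=> /cut_torusS; exact: (torus_radius_gt0 rho0 rhoR). Qed.
Let sg0 v : T' v -> 0 < sg v.
Proof. by case/andP. Qed.
Let D0 v : T' v -> 0 < D v.
Proof. by move=> /cut_torusS; exact: depth_gt0. Qed.

Variable L : R.
Hypothesis L0 : 0 < L.
Hypothesis Lrho : expR (- L) <= rho / 2.

Definition shell : set V := [set v | expR (- (4 * L)) <= D v <= expR (- L)].

Lemma shell_core v : shell v -> rho / 2 <= s v < rho.
Proof.
move=> /andP[h1 h2]; have e0 := expR_gt0 (- (4 * L)); have hL := Lrho.
by rewrite /depth in h1 h2; apply/andP; split; lra.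
Qed.

Lemma shellS : shell `<=` T'.
Proof.
move=> v /shell_core/andP[h1 h2]; have h0 := rho0.
have s0 : 0 < s v by lra.
have Tv : T v by rewrite torusE.
by apply/andP; split; [rewrite -sqrtr_gt0|exact: Tv].
Qed.

Lemma compact_shell : compact shell.
Proof.
apply: bounded_closed_compact; last first.
  have cD := @continuous_depth R n Rmaj rho.
  rewrite (_ : shell = [set v | expR (- (4 * L)) <= D v] `&` [set v | D v <= expR (- L)]).
    apply: closedI.
      exact: (closed_comp (fun v _ => cD v) (@closed_ge R (expR (- (4 * L))))).
    exact: (closed_comp (fun v _ => cD v) (@closed_le R (expR (- L)))).
  by apply/seteqP; split => v /= => [/andP[]|[? ?]]//; apply/andP.
exists (Rmaj + rho); split; first exact: num_real.
move=> x hx v Kv; rewrite /= (le_trans _ (ltW hx))// [leLHS](mx_normrE v).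
have h0 := rho0; have hR := rhoR.
have /andP[_ /ltW sv] := shell_core Kv; have /andP[_ r2] := radius_bounds sv.
have R0 : 0 <= Rmaj + rho by lra.
apply/bigmax_leP; split => //= -[k j] _ /=; rewrite ord1 {k}.
have H (y : R) : y ^+ 2 <= qrad v -> `|y| <= Rmaj + rho.
  rewrite -sqr_radius -(real_normK (num_real y)) => h; apply: le_trans r2.
  by rewrite -(@ler_pXn2r _ 2) ?nnegrE ?radius_ge0.
case: (split_ordP j) => [j1|j1] ->.
  apply: H; case: (split_ordP j1) => [i|i] ->; rewrite /qrad.
    rewrite (bigD1 i)//= -!/(xc v i) -addrA lerDl addr_ge0//;
    by apply: sumr_ge0 => k _; exact: sqr_ge0.
  rewrite [X in _ + X](bigD1 i)//= -!/(yc v i) addrCA lerDl addr_ge0//;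
  by apply: sumr_ge0 => k _; exact: sqr_ge0.
have := le_trans (tc_le Rmaj v) sv; rewrite ord1 /tc /tidx; lra.
Qed.

(** An affine function of ln D that sends the two faces of the shell to -3/2 and 3/2, the ends of
    the support of [odd_bump]. *)
Definition level v : R := - (ln (D v) / L) - 5 / 2.

Lemma level_outside v : ~ shell v -> 3 / 2 <= `|level v|.
Proof.
move=> nK; have hL := L0.
have L1 : L != 0 by rewrite gt_eqF.
(* Where D <= 0 the logarithm takes the default value 0, so [level] is -5/2, still outside the
   support. *)
have [Dv|Dv] := leP (D v) 0.
  by rewrite /level ln0// mul0r oppr0 sub0r normrN ger0_norm; lra.
rewrite /level; have [h|h] := ltP (D v) (expR (- (4 * L))).
  have : ln (D v) < - (4 * L) by rewrite -[ltRHS]expRK ltr_ln// posrE// expR_gt0.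
  move=> h2; have h3 : ln (D v) / L < - 4.
    by rewrite ltr_pdivrMr// mulNr.
  by rewrite ger0_norm; lra.
have {}h : expR (- L) < D v.
  by rewrite ltNge; apply/negP => h2; apply: nK; apply/andP.
have h3 : - 1 < ln (D v) / L.
  rewrite ltr_pdivlMr// mulN1r -[ltLHS]expRK ltr_ln// posrE//; exact: expR_gt0.
by rewrite ler0_norm; lra.
Qed.

Lemma Ck_level k : Ck k T' level.
Proof.
have cD := @Ck_depth R n Rmaj rho rho0 rhoR k.
exact: (CkB oU (CkN oU (CkM oU (Ck_ln oU D0 cD) (Ck_cst k T' L^-1))) (Ck_cst k T' (5 / 2))).
Qed.

Lemma axi_level : axi T' level (fun v => a v / s v / (D v * L)) (fun v => t v / s v / (D v * L)).
Proof.
have dP v : T' v -> is_derive (D v) 1 (@ln R) (D v)^-1.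
  by move=> Uv; exact: is_derive1_ln (D0 Uv).
have h := axi_comp (Phi' := fun x => x^-1) dP (@axi_depth R n Rmaj rho rho0 rhoR).
have h2 := axiD (axiM (@axi_cst R n T' (- L^-1)) h) (@axi_cst R n T' (- (5 / 2))).
have E : (fun v => cst (- L^-1) v * ln (D v) + cst (- (5 / 2)) v) = level.
  by apply/funext => v; rewrite /level /=; ring.
rewrite E in h2; have L1 : L != 0 by rewrite gt_eqF.
apply: (axi_eq h2) => v Uv /=; have Dn : D v != 0 by rewrite gt_eqF// D0.
- have sn : s v != 0 by rewrite gt_eqF// (cut_core_gt0 Uv).
  by field; rewrite sn Dn L1.
- have sn : s v != 0 by rewrite gt_eqF// (cut_core_gt0 Uv).
  by field; rewrite sn Dn L1.
Qed.

(** The size of the planar divergence-free field (a, t) / s^2 divided by r^(2n-1), the density of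
    the volume in the variables r and t. *)
Definition flux v : R := rd v `^ (1 - 2 * n%:R) / s v.

Definition bal v : R := flux v / D v * odd_bump' (level v).

(* The field (a (x, y) / r, t) / (s^2 r^(2n-1)) is divergence free; tested
   against [odd_bump \o level] it yields the balance of the two shells. *)
Lemma flux_balance : tame (bal \_ T') /\ integ (bal \_ T') = 0.
Proof.
have L1 : L != 0 by rewrite gt_eqF.
pose w v := (sg v)^-1 * rd v `^ (- (2 * n%:R)).
pose wr v := w v * (- (2 * a v) / sg v - 2 * n%:R / rd v).
pose wt v := w v * (- (2 * t v) / sg v).
have aS := @axi_core2 R n Rmaj rho rho0 rhoR.
have ar := axi_r r0; have aa := @axi_rcore R n Rmaj rho rho0 rhoR.
have at_ := @axi_t R n T'.
have aw : axi T' w wr wt.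
  have h := axiM (axi_inv sg0 aS) (axi_powR (- (2 * n%:R)) r0 ar).
  apply: (axi_eq h) => v Uv /=; rewrite /wr /wt /w;
    have sn : sg v != 0 by rewrite gt_eqF// sg0.
  - have rn : rd v != 0 by rewrite gt_eqF// r0.
    by move: (rd v `^ _) => z; field; rewrite rn sn.
  - have rn : rd v != 0 by rewrite gt_eqF// r0.
    by move: (rd v `^ _) => z; field; rewrite rn sn.
have aA : axi T' (fun v => a v * w v) (fun v => w v + a v * wr v) (fun v => a v * wt v).
  by apply: (axi_eq (axiM aa aw)) => v _ /=; ring.
have aB := @axi_cst R n T' 0.
have aC : axi T' (fun v => t v * (rd v * w v)) (fun v => t v * (w v + rd v * wr v))
    (fun v => rd v * w v + t v * rd v * wt v).
  by apply: (axi_eq (axiM at_ (axiM ar aw))) => v _ /=; ring.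
have cr := @Ck_rd R n Rmaj rho rho0 rhoR 1.
have cw : Ck 1 T' w := CkM oU (Ck_inv oU sg0 (@Ck_core2 R n Rmaj rho rho0 rhoR 1))
  (Ck_powR (- (2 * n%:R)) oU r0 cr).
have cA : Ck 1 T' (fun v => a v * w v) := CkM oU (@Ck_rcore R n Rmaj rho rho0 rhoR 1) cw.
have cC : Ck 1 T' (fun v => t v * (rd v * w v)) := CkM oU (@Ck_tc R n 1 T') (CkM oU cr cw).
pose psi v := odd_bump (level v).
have psi0 v : ~ shell v -> psi v = 0.
  by move=> /level_outside h; exact: odd_bump_eq0.
have cpsi : Ck 1 setT psi := Ck_glue compact_shell oU shellS psi0
  (Ck_comp1 oU is_derive_odd_bump continuous_odd_bump' (Ck_level 1)).
have apsi := axi_comp (Phi := odd_bump) (Phi' := odd_bump')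
  (fun v _ => is_derive_odd_bump (level v)) axi_level.
have [h1 h2] := axi_div oU r0 aA aB aC cA (Ck_cst 1 T' 0) cC cpsi compact_shell shellS psi0.
set I := (fun v => _) in h1 h2.
have IE : I = (fun v => L^-1 * (bal \_ T') v).
  have clK : closed shell by apply: compact_closed; [exact: norm_hausdorff|exact: compact_shell].
  apply/funext => v; rewrite /I; have [Kv|Kv] := pselect (shell v); last first.
    rewrite (euler_outside clK psi0 Kv) (swirl_outside clK psi0 Kv).
    rewrite (partial_outside _ clK psi0 Kv) psi0// !mulr0 !addr0 patchE.
    case: ifPn => vU; last by rewrite mulr0.
    by rewrite /bal odd_bump'_eq0 ?mulr0//; exact: level_outside.
  have Uv := shellS Kv; rewrite patchE mem_set//.
  rewrite (axi_euler apsi Uv (r0 Uv)) (axi_swirl apsi Uv) (axi_partialt apsi Uv).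
  have rn : rd v != 0 by rewrite gt_eqF// r0.
  have sn : s v != 0 by rewrite gt_eqF// (cut_core_gt0 Uv).
  have Dn : D v != 0 by rewrite gt_eqF// D0.
  have wE : w v = (sg v)^-1 * rd v `^ (- (2 * n%:R)) by [].
  have fE : flux v = rd v * w v * s v.
    rewrite /flux wE -(sqr_core Rmaj v) powRD; last by rewrite (gt_eqF (r0 Uv)) implybT.
    rewrite powRr1 ?(ltW (r0 Uv))//.
    by move: (rd v `^ _) => z; field.
  have div0 : 2 * n%:R * (a v * w v) + rd v * (w v + a v * wr v)
      + (rd v * w v + t v * rd v * wt v) = 0.
    have sn2 : sg v != 0 by rewrite gt_eqF// sg0.
    rewrite /wr /wt; move: (w v) sn2; rewrite /core2 => z sn2.
    by field; rewrite rn sn2.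
  rewrite div0 /= !mul0r !addr0 /bal fE.
  move: (odd_bump' _) (w v) => y z; have E : a v ^+ 2 + t v ^+ 2 = s v ^+ 2 by rewrite sqr_core.
  have -> : a v * z * (rd v * (y * (a v / s v / (D v * L)))) +
      t v * (rd v * z) * (y * (t v / s v / (D v * L)))
    = (a v ^+ 2 + t v ^+ 2) * (z * rd v * y / s v / (D v * L)) by field; rewrite sn Dn L1.
  by rewrite E; field; rewrite sn Dn L1.
have tb : tame (bal \_ T').
  have := tameZ L h1; rewrite IE.
  have -> : (fun v => L * (L^-1 * (bal \_ T') v)) = bal \_ T'.
    by apply/funext => v; rewrite mulrA divff// mul1r.
  by [].
split => //; have := h2; rewrite IE integZ// => /eqP.
by rewrite mulf_eq0 invr_eq0 (negbTE L1)/= => /eqP.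
Qed.

Let lam : R := (p - 1) / p.

(** As lam p = p - 1, both the energy and the weighted term acquire the factor 1/D, and the profile
    varies slowly in ln D, with derivative of order 1/L. *)
Definition minimizer v : R := D v `^ lam * profile (level v).

Lemma minimizer_outside v : ~ shell v -> minimizer v = 0.
Proof.
move=> /level_outside h; rewrite /minimizer profile_eq0 ?mulr0//.
by apply: le_trans h; lra.
Qed.

Lemma Ck_minimizer k : Ck k setT minimizer.
Proof.
have cD := @Ck_depth R n Rmaj rho rho0 rhoR k.
have cl := CkB oU (Ck_cst k T' 1) (CkX 2 oU (Ck_level k)).
exact: (Ck_glue compact_shell oU shellS minimizer_outside
  (CkM oU (Ck_powR lam oU D0 cD) (Ck_bump oU cl))).
Qed.

Lemma test_minimizer : test_function T minimizer.
Proof.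
have clK : closed shell by apply: compact_closed; [exact: norm_hausdorff|exact: compact_shell].
have sub : closure [set v | minimizer v != 0] `<=` shell.
  rewrite [X in _ `<=` X](closure_id shell).1//; apply: closure_subset => v /eqP mv.
  by apply: contrapT => /minimizer_outside.
split.
- by apply/smoothP => k; exact: Ck_minimizer.
- apply: (subclosed_compact _ compact_shell) => //; exact: closed_closure.
- by move=> v /sub/shellS/cut_torusS.
Qed.

Let slope v : R := D v `^ (lam - 1) * (lam * profile (level v) - profile' (level v) / L).

Lemma hgrad_minimizer v : T' v -> hgrad minimizer v = slope v *: hgrad d v.
Proof.
move=> Uv; have Dv := D0 Uv; have Tv := cut_torusS Uv.
have dD j : derivable D v (dir j) := Ck_derivable (@Ck_depth R n Rmaj rho rho0 rhoR 1) Uv.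
pose Phi (x : R) := x `^ lam * profile (- (ln x / L) - 5 / 2).
have dln : is_derive (D v) 1 (fun x => - (ln x / L) - 5 / 2) (- ((D v)^-1 / L)).
  have h := is_deriveB
    (is_deriveN (is_deriveM (is_derive1_ln Dv) (is_derive_cst L^-1 (D v) (1 : R))))
    (is_derive_cst (5 / 2 : R) (D v) (1 : R)).
  by apply: (is_derive_congr h); rewrite /GRing.scale/=; ring.
have dP : is_derive (D v) 1 Phi (slope v).
  have h := is_deriveM (is_derive1_powR lam Dv)
    (@is_derive1_comp _ profile (fun x => - (ln x / L) - 5 / 2) (D v) _ _
      (is_derive_profile _) dln).
  apply: (is_derive_congr h); rewrite /slope /level /GRing.scale/=.
  have -> : D v `^ lam = D v `^ (lam - 1) * D v.
    by rewrite -[X in _ * X]powRr1 ?(ltW Dv)// -powRD ?subrK// (gt_eqF Dv) implybT.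
  have Dn : D v != 0 by rewrite gt_eqF.
  have Ln : L != 0 by rewrite gt_eqF.
  move: (profile _) (profile' _) (D v `^ _) => x y z.
  by field; rewrite Dn Ln.
have -> : hgrad d v = hgrad D v by exact/esym/hgrad_near/dist_near.
exact: (hgrad_comp dD dP).
Qed.

Let p0 : 0 < p. Proof. by rewrite (lt_trans ltr01 p1). Qed.
Let lamp : lam * p = p - 1. Proof. by rewrite /lam divfK// gt_eqF. Qed.

Lemma energy_minimizer v : T' v -> enorm (hgrad minimizer v) `^ p =
  (D v)^-1 * enorm (hgrad d v) `^ p
   * `|lam * profile (level v) - profile' (level v) / L| `^ p.
Proof.
move=> Uv; have Dv := D0 Uv.
rewrite (hgrad_minimizer Uv) enormZ /slope normrM (ger0_norm (powR_ge0 _ _)).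
rewrite (@powRM _ _ _ p (mulr_ge0 (powR_ge0 _ _) (normr_ge0 _)) (enorm_ge0 _)).
rewrite (@powRM _ _ _ p (powR_ge0 _ _) (normr_ge0 _)) -powRrM mulrBl lamp mul1r.
rewrite (_ : p - 1 - p = - 1); last by ring.
by rewrite powR_inv1 ?(ltW Dv)//; ring.
Qed.

Lemma weight_minimizer v : T' v -> hardy_weight Rmaj rho p minimizer v =
  (D v)^-1 * enorm (hgrad d v) `^ p * profile (level v) `^ p.
Proof.
move=> Uv; have Dv := D0 Uv.
rewrite /hardy_weight (dist_boundary_torus rho0 rhoR (cut_torusS Uv)) /minimizer.
rewrite ger0_norm ?mulr_ge0 ?powR_ge0 ?profile_ge0//.
rewrite (@powRM _ _ _ p (powR_ge0 _ _) (profile_ge0 _)) -powRrM lamp.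
rewrite powRB; last by rewrite (gt_eqF Dv) implybT.
rewrite powRr1 ?(ltW Dv)//.
have Dp : D v `^ p != 0 by apply: lt0r_neq0; exact: powR_gt0.
have Dn : D v != 0 by rewrite gt_eqF.
move: (D v `^ p) Dp (enorm _ `^ p) (profile _ `^ p) => x xn y z.
by field; rewrite xn Dn.
Qed.

(** The pointwise bound is integrated. None of the constants in [C], [K], [k] and [f] need depend on
    [L], so the factor on the right can be brought as close to [c] as desired. *)
Lemma energy_ratio (c C : R) (K k f : R * R) :
  0 <= C -> (forall x y, `|lam * x - y| `^ p <= c * `|x| `^ p + C * `|y| `^ p) ->
  0 <= K.1 -> 0 <= K.2 ->
  (forall m, `|profile' m| `^ p <= K.1 * odd_bump' m + K.2 * profile m `^ p) ->
  0 < k.1 -> (forall v, T' v -> k.1 <= enorm (hgrad d v) `^ p <= k.2) ->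
  0 < f.1 -> (forall v, shell v -> f.1 <= flux v <= f.2) ->
  integ (fun v => enorm (hgrad minimizer v) `^ p) <=
    (c + C * (k.2 / f.1) * K.2 * (f.2 / k.1) / L `^ p) *
      integ (hardy_weight Rmaj rho p minimizer \_ T').
Proof.
move=> C0 hC K10 K20 hK k0 hk f0 hf.
have clK : closed shell by apply: compact_closed; [exact: norm_hausdorff|exact: compact_shell].
have [tb b0] := flux_balance.
have KT : shell `<=` T by move=> v /shellS/cut_torusS.
have tW := tame_hardy_weight rho0 rhoR p1 (Ck_minimizer 0) compact_shell KT minimizer_outside.
have tE : tame (fun v => enorm (hgrad minimizer v) `^ p).
  apply: tame_powR => //; first by move=> v; exact: enorm_ge0.
  exact: hgrad_tame (Ck_minimizer 1) compact_shell minimizer_outside.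
set W := hardy_weight Rmaj rho p minimizer \_ T' in tW *.
pose P := C * (k.2 / f.1) / L `^ p * K.1.
set Q := c + _.
(* Adding a multiple of [bal] does not change the integral, and makes a pointwise comparison
   possible. *)
have -> : Q * integ W = integ (fun v => Q * W v + P * (bal \_ T') v).
  have := integD (tameZ Q tW) (tameZ P tb).
  by rewrite !integZ// b0 mulr0 addr0.
apply: le_integ => //; first by apply: tameD; exact: tameZ.
move=> v; have [Kv|Kv] := pselect (shell v); last first.
  rewrite (hgrad_outside clK minimizer_outside Kv) enorm0 powR0 ?gt_eqF//.
  have -> : W v = 0.
    rewrite /W patchE; case: ifPn => // _; rewrite /hardy_weight minimizer_outside//.
    by rewrite normr0 powR0 ?mulr0// gt_eqF.
  have -> : (bal \_ T') v = 0.
    rewrite patchE; case: ifPn => // _.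
    by rewrite /bal odd_bump'_eq0 ?mulr0//; exact: level_outside.
  by rewrite !mulr0 addr0.
have Uv := shellS Kv; have Dv := D0 Uv.
rewrite /W !patchE mem_set// (energy_minimizer Uv) (weight_minimizer Uv) /bal.
have /andP[k1 k2] := hk v Uv; have /andP[f1 f2] := hf v Kv.
have := hC (profile (level v)) (profile' (level v) / L).
rewrite (ger0_norm (profile_ge0 _)) normrM (gtr0_norm (_ : 0 < L^-1)) ?invr_gt0//.
rewrite (@powRM _ _ _ p (normr_ge0 _)) ?invr_ge0 ?(ltW L0)//.
have -> : L^-1 `^ p = (L `^ p)^-1.
  by rewrite -powR_inv1 ?(ltW L0)// -powRrM mulN1r powRN.
have := hK (level v).
have th0 : 0 <= profile (level v) `^ p by exact: powR_ge0.
have tp0 : 0 <= `|profile' (level v)| `^ p by exact: powR_ge0.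
have Lp : 0 < L `^ p by exact: powR_gt0.
move=> hB hA.
have Di0 : 0 <= (D v)^-1 by rewrite invr_ge0 ltW.
exact: (energy_algebra Di0 k0 (conj k1 k2) f0 (conj f1 f2) C0 K20 tp0 th0 Lp hB hA).
Qed.

End sharpness.

Section sharp_constant.
Context {R : realType} (n : nat) (Rmaj rho p : R).
Hypothesis rho0 : 0 < rho.
Hypothesis rhoR : rho < Rmaj.
Hypothesis p1 : 1 < p.
Hypothesis n1 : (1 <= n)%N.
Notation V := 'rV[R]_(n + n + 1).
Implicit Types (v w : V) (i : 'I_n).
Notation rd := (@radius R n).
Notation T := (torus n Rmaj rho).
Notation T' := (@cut_torus R n Rmaj rho).
Notation d := (dist_boundary T).
Notation s := (core Rmaj).
Notation D := (@depth R n Rmaj rho).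

Lemma flux_bounds : exists2 f : R * R, 0 < f.1 &
  forall v, rho / 2 <= s v < rho -> f.1 <= flux Rmaj v <= f.2.
Proof.
have h0 := rho0; have hR := rhoR.
have m0 : 0 < Rmaj - rho by lra.
have [k k0 hk] := powR_bounds (Rmaj + rho) (1 - 2 * n%:R) m0.
exists (k.1 / rho, k.2 / (rho / 2)); first by rewrite divr_gt0.
move=> v /andP[s1 s2]; have /hk/andP[h1 h2] := radius_bounds (ltW s2).
have sp : 0 < s v by lra.
have k20 := le_trans (ltW k0) (le_trans h1 h2).
rewrite /flux /=; apply/andP; split.
  by apply: ler_pM; rewrite ?(ltW k0) ?invr_ge0 ?(ltW h0)// lef_pV2 ?posrE ?ltW.
apply: ler_pM; rewrite ?powR_ge0 ?invr_ge0 ?core_ge0//.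
by rewrite lef_pV2 ?posrE// divr_gt0.
Qed.

Lemma depth_surj (x : R) : 0 < x < rho -> exists v : V, D v = x.
Proof.
move=> /andP[x0 x1]; have h0 := rho0; have hR := rhoR.
pose i0 := Ordinal n1.
pose v : V := \row_j (if j == xidx i0 then Rmaj else if j == tidx n then rho - x else 0).
exists v.
have xv i : xc v i = if i == i0 then Rmaj else 0.
  by rewrite /xc mxE xidx_eq xtidx_eq.
have yv i : yc v i = 0 by rewrite /yc mxE yxidx_eq ytidx_eq.
have tv : tc v = rho - x.
  by rewrite /tc mxE eq_sym xtidx_eq eqxx.
have q : qrad v = Rmaj ^+ 2.
  rewrite /qrad (bigD1 i0)//= xv eqxx big1 => [|i ii0]; last by rewrite xv (negbTE ii0) expr0n.
  by rewrite big1 ?addr0// => i _; rewrite yv expr0n.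
have r : rd v = Rmaj.
  have -> : rd v = Num.sqrt (qrad v) by [].
  by rewrite q sqrtr_sqr gtr0_norm; lra.
rewrite /depth /core /core2 /rcore r subrr expr0n add0r tv sqrtr_sqr ger0_norm; lra.
Qed.

Lemma torus_hardy_sharp (c : R) : ((p - 1) / p) `^ p < c -> ~ hardy_inequality p c T d.
Proof.
move=> lc H; have h0 := rho0; have hR := rhoR.
have p0 : 0 < p by rewrite (lt_trans ltr01 p1).
have lam0 : 0 < (p - 1) / p by rewrite divr_gt0// subr_gt0.
pose c' := (((p - 1) / p) `^ p + c) / 2.
have lc' : ((p - 1) / p) `^ p < c' by rewrite /c'; lra.
have cc : c' < c by rewrite /c'; lra.
have [C C0 hC] := powR_perturb p0 lam0 lc'.
have [K [K1 K2 hK]] := profile'_bound p1.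
have [k k0 hk] := @enorm_dist_powR_bounds R n Rmaj rho rho0 rhoR p.
have [f f0 hf] := flux_bounds.
pose kap := C * (k.2 / f.1) * K.2 * (f.2 / k.1).
(* L >= 1 gives L <= L^p; the second entry keeps the shell away from the core; the third makes kap /
   L^p smaller than c - c'. *)
pose L := Num.max 1 (Num.max (- ln (rho / 2)) (`|kap| / (c - c') + 1)).
have L1 : 1 <= L by rewrite /L le_max lexx.
have L0 : 0 < L by exact: lt_le_trans ltr01 L1.
have Lrho : expR (- L) <= rho / 2.
  have r2 : 0 < rho / 2 by lra.
  rewrite -[leRHS]lnK ?posrE// ler_expR lerNl.
  by rewrite /L !le_max lexx !orbT.
have Lk : kap / L `^ p < c - c'.
  have L2 : `|kap| / (c - c') < L.
    have : `|kap| / (c - c') + 1 <= L by rewrite /L !le_max lexx !orbT.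
    by lra.
  have L3 : L <= L `^ p by apply: le1r_powR; rewrite // ltW.
  rewrite ltr_pdivrMr ?powR_gt0//.
  apply: le_lt_trans (ler_norm _) _.
  rewrite mulrC -ltr_pdivrMr ?subr_gt0//.
  exact: lt_le_trans L2 L3.
have hf' v : shell Rmaj rho L v -> f.1 <= flux Rmaj v <= f.2.
  by move=> Kv; apply: hf; exact: (shell_core Lrho Kv).
have ratio := energy_ratio rho0 rhoR p1 L0 Lrho C0 hC K1 K2 hK k0 hk f0 hf'.
have tu := @test_minimizer R n Rmaj rho p rho0 rhoR L L0 Lrho.
set u := minimizer Rmaj rho p L in ratio tu.
have cu : forall k, Ck k setT u := @Ck_minimizer R n Rmaj rho p rho0 rhoR L L0 Lrho.
have u0 v : ~ shell Rmaj rho L v -> u v = 0 := @minimizer_outside R n Rmaj rho p L L0 v.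
have cS := @compact_shell R n Rmaj rho rho0 rhoR L Lrho.
have SU := @shellS R n Rmaj rho rho0 L Lrho.
have mT : measurable T := open_rV_measurable (@open_torus R n Rmaj rho).
have clK : closed (@shell R n Rmaj rho L).
  by apply: compact_closed; [exact: norm_hausdorff|exact: cS].
have ST v : shell Rmaj rho L v -> T v by move=> /SU/cut_torusS.
have tW := tame_hardy_weight rho0 rhoR p1 (cu 0%N) cS ST u0.
pose B v := enorm (hgrad u v) `^ p.
have tB : tame B.
  by apply: tame_powR => //; [move=> v; exact: enorm_ge0|exact: hgrad_tame (cu 1%N) cS u0].
have BT : B \_ T = B.
  apply/funext => v; rewrite patchE; case: ifPn => //; rewrite notin_setE => vT.
  by rewrite /B (hgrad_outside clK u0) ?enorm0 ?powR0 ?gt_eqF// => /ST.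
have WT := hardy_weight_patch rho0 rhoR p1 u.
have := H u tu.
have -> : (\int[lebesgue_rV (n + n + 1)]_(xi in T)
    (enorm (hgrad d xi) `^ p / d xi `^ p * `|u xi| `^ p)%:E)%E
    = (integ (hardy_weight Rmaj rho p u \_ T'))%:E.
  by rewrite -WT -(integ_patch (f := hardy_weight Rmaj rho p u) mT) ?WT.
have -> : (\int[lebesgue_rV (n + n + 1)]_(xi in T) (enorm (hgrad u xi) `^ p)%:E)%E
    = (integ B)%:E.
  by rewrite -[in RHS]BT -(integ_patch (f := B) mT) ?BT.
rewrite -EFinM lee_fin.
set I := integ (_ \_ T') in ratio *.
have I0 : 0 < I.
  (* In the middle of the shell [level] is 0 and [profile] is positive, so the weighted integral
     does not vanish. *)
  have [v Dv] : exists v : V, D v = expR (- (5 / 2 * L)).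
    apply: depth_surj; rewrite expR_gt0/=; apply: (@le_lt_trans _ _ (rho / 2)); last lra.
    apply: le_trans Lrho; rewrite ler_expR; lra.
  have Kv : shell Rmaj rho L v.
    by apply/andP; rewrite Dv !ler_expR; split; lra.
  have Uv := SU v Kv.
  have Dp w : T' w -> 0 < D w by move=> /cut_torusS; exact: (depth_gt0 rho0).
  have pv : 0 < profile (level Rmaj rho L v).
    rewrite (_ : level _ _ _ _ = 0).
      by apply: bump0_gt0; rewrite expr0n subr0 ltr01.
    rewrite /level Dv expRK; have L2 : L != 0 by rewrite gt_eqF.
    by field.
  refine (@integ_gt0 _ _ _ v tW _ _ _).
  - move=> w; rewrite patchE; case: ifPn => // _.
    by rewrite mulr_ge0 ?divr_ge0 ?powR_ge0.
  - pose g w := (D w)^-1 * enorm (hgrad d w) `^ p * profile (level Rmaj rho L w) `^ p.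
    apply: (@near_continuous _ _ g).
      apply: (open_near (@open_cut_torus R n Rmaj rho) _ Uv) => w Uw.
      by rewrite patchE mem_set// weight_minimizer.
    have cD := Ck_continuous (Ck_inv (@open_cut_torus R n Rmaj rho) Dp
      (@Ck_depth R n Rmaj rho rho0 rhoR 0)) Uv.
    have ce := Ck_continuous (@Ck_enorm_powR R n Rmaj rho rho0 rhoR 0 p) Uv.
    have cl := Ck_continuous (@Ck_level R n Rmaj rho rho0 rhoR L 0) Uv.
    have cp := is_derive_continuous (is_derive_profile (level Rmaj rho L v)).
    have cq := is_derive_continuous (is_derive1_powR p pv).
    have c1 := @continuous_comp _ _ _ (level Rmaj rho L) profile v cl cp.
    have c2 := @continuous_comp _ _ _ (profile \o level Rmaj rho L) (fun x => x `^ p) v c1 cq.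
    exact: (cvgM (cvgM cD ce) c2).
  - rewrite patchE mem_set// weight_minimizer//.
    by rewrite !mulr_gt0 ?invr_gt0 ?powR_gt0// ?Dp// (enorm_dist_gt0 rho0 rhoR Uv).
move=> cI; have : c * I <= c' * I + kap / L `^ p * I.
  apply: (le_trans cI); apply: (le_trans ratio).
  by rewrite -mulrDl.
rewrite -mulrDl ler_pM2r// leNgt => /negP; apply; lra.
Qed.

End sharp_constant.

Unset Implicit Arguments.

Theorem theoremA (R : realType) (n : nat) (p : R) (hn : (1 <= n)%N) (hp : 1 < p) :
  exists2 beta : R, 0 < beta &
  forall Rmaj rho : R, 0 < rho -> rho < Rmaj ->
    rho + ((2 * n%:R - 1) * rho / 4) `^ (1 / 3) <= Rmaj ->
    beta * rho <= Rmaj ->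
    let T := torus n Rmaj rho in
    let d := dist_boundary T in
    [/\ weakly_p_superharmonic p T d,
        hardy_inequality p (((p - 1) / p) `^ p) T d
      & forall c : R, ((p - 1) / p) `^ p < c -> ~ hardy_inequality p c T d].
Proof.
have n1 : 1 <= n%:R :> R by rewrite ler1n.
(* With this constant, beta rho <= Rmaj implies [lin_cond], that is (2n+p-3) rho <= Rmaj - rho. *)
exists (2 * n%:R + p - 2); first lra.
move=> Rmaj rho rho0 rhoR hcube hlin.
have cube_cond : (2 * n%:R - 1) * rho <= 4 * (Rmaj - rho) ^+ 3.
  have x0 : 0 <= (2 * n%:R - 1) * rho / 4.
    by rewrite divr_ge0// mulr_ge0 ?(ltW rho0)//; lra.
  suff : (2 * n%:R - 1) * rho / 4 <= (Rmaj - rho) ^+ 3 by lra.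
  have -> : (2 * n%:R - 1) * rho / 4 = (((2 * n%:R - 1) * rho / 4) `^ (1 / 3)) ^+ 3.
    by rewrite -powR_mulrn ?powR_ge0// -powRrM divfK// powRr1.
  by rewrite lerXn2r ?nnegrE ?powR_ge0//; lra.
have lin_cond : (2 * n%:R + p - 3) * rho <= Rmaj - rho by move: hlin; nra.
split.
- exact: torus_superharmonic.
- exact: torus_hardy.
- exact: torus_hardy_sharp.
Qed.
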